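(* Let $k$ be a positive integer with $k\equiv0\pmod 4$. Let $f(z)$ be a holomorphic cusp form of weight $k$ on $\Gamma_0(q)$ with Fourier expansion $f(z)=\sum_{n=1}^\infty a_f(n)e^{2\pi inz}$ at the cusp $i\infty$. Assume that $a_f(1)=1$, $Wf=f$, and $f(iy)>0$ for any $y>0$. Write $c_f(n)=c_{f,1/2}(n)$. Then $$L\Bigl(\frac{k+1}{2},f\Bigr)=\frac{(2\pi)^{(k+1)/2}}{q^{k/4}\,\Gamma((k+1)/2)}\sum_{m=0}^\infty\sum_{n=0}^\infty c_f(m)\,c_f(n)\,\frac{e^{-\frac{2\pi}{\sqrt q}\sqrt{(2m+1)(2n+1)}}}{\sqrt{2m+1}}$$ and $$L\Bigl(\frac k2,f\Bigr)=\frac{2}{\Gamma(k/2)}\Bigl(\frac{2\pi}{\sqrt q}\Bigr)^{k/2}\sum_{m=0}^\infty\sum_{n=0}^\infty c_f(m)\,c_f(n)\,K_0\Bigl(\frac{2\pi}{\sqrt q}\sqrt{(2m+1)(2n+1)}\Bigr).$$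
   Context: $\Gamma_0(q)$ is the group of matrices in $SL_2(\mathbb{Z})$ whose lower-left entry is divisible by $q$. $L(s,f)$ is the entire continuation of $\sum_{n=1}^\infty a_f(n)n^{-s}$ (absolutely convergent for $\mathrm{Re}(s)>(k+1)/2$). The Fricke involution is $Wf(z)=q^{-k/2}z^{-k}f\bigl(-\frac{1}{qz}\bigr)$. When $a_f(1)=1$ and $f(iy)>0$ for all $y>0$, for real $\alpha>0$ the numbers $c_{f,\alpha}(m)$ $(m=0,1,2,\dots)$ are defined by the expansion $$f(iy)^\alpha=e^{-2\pi\alpha y}\Bigl(1+\sum_{n=2}^\infty a_f(n)e^{-2\pi(n-1)y}\Bigr)^\alpha=e^{-2\pi\alpha y}\sum_{j=0}^\infty\binom{\alpha}{j}\Bigl(\sum_{n=2}^\infty a_f(n)e^{-2\pi(n-1)y}\Bigr)^j=\sum_{m=0}^\infty c_{f,\alpha}(m)e^{-2\pi(m+\alpha)y},$$ where $f(iy)^\alpha=\exp(\alpha\log f(iy))$. $K_\nu$ is the $K$-Bessel function, $K_\nu(x)=\frac12\int_0^\infty e^{-\frac{x}{2}(t+\frac1t)}t^{-\nu}\frac{dt}{t}$ for $x>0$, $\nu\in\mathbb{C}$.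
   Formalization: The expansion of f(iy)^{1/2} as the series with coefficients c_f(m) is assumed to hold for every y>0; without this the claim fails, e.g. for f=ΔE_4 (k=16, q=1), where E_4 vanishes at exp(2πi/3) and the double series diverge. *)

(* Defs.v *)
From HB Require Import structures.
From mathcomp Require Import all_boot all_order all_algebra.
From mathcomp Require Import complex.
From mathcomp Require Import all_classical all_reals all_analysis.

Set Implicit Arguments.
Unset Strict Implicit.
Unset Printing Implicit Defensive.

Import Order.TTheory GRing.Theory Num.Theory.
Import numFieldNormedType.Exports.

Local Open Scope classical_set_scope.
Local Open Scope ring_scope.
Local Open Scope complex_scope.

(* The complex numbers are R[i]; the regular module R[i]^o carries their
   normed topology, with scalars in R[i], so [derivable] below is complex
   differentiability. *)
Definition complex_derivable (R : realType) (f : R[i] -> R[i]) (z : R[i]) :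
    Prop :=
  derivable (f : R[i]^o -> R[i]^o) z 1.

(* sum_{n >= n0} u n converges, with sum l. *)
Definition sums_to (R : realType) (n0 : nat) (u : nat -> R[i]) (l : R[i]) :
    Prop :=
  (fun N : nat => (\sum_(n0 <= n < N) u n : R[i]^o)) @ \oo --> (l : R[i]^o).

(* Iterated sum: sum_{m >= 0} (sum_{n >= 0} F m n), all series convergent. *)
Definition double_sums_to (R : realType) (F : nat -> nat -> R[i]) (l : R[i]) :
    Prop :=
  exists2 G : nat -> R[i],
    (forall m : nat, sums_to 0 (F m) (G m)) & sums_to 0 G l.

Definition cexp (R : realType) (z : R[i]) : R[i] :=
  (expR (complex.Re z))%:C *
  (cos (complex.Im z) +i* sin (complex.Im z)).

(* x ^ s with the principal value, used only for x > 0. *)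
Definition cpow (R : realType) (x : R) (s : R[i]) : R[i] :=
  cexp (s * (ln x)%:C).

Definition upper_half (R : realType) : set R[i] :=
  [set z | 0 < complex.Im z].

Definition SL2Z : set 'M[int]_2 := [set g | \det g = 1].

Definition Gamma0 (q : nat) : set 'M[int]_2 :=
  [set g | SL2Z g /\ (q%:Z %| (g 1 0)%R)%Z].

Definition autj (R : realType) (g : 'M[int]_2) (z : R[i]) : R[i] :=
  (g 1 0)%:~R * z + (g 1 1)%:~R.

Definition moebius (R : realType) (g : 'M[int]_2) (z : R[i]) : R[i] :=
  ((g 0 0)%:~R * z + (g 0 1)%:~R) / autj g z.

Definition slash (R : realType) (k : nat) (f : R[i] -> R[i])
    (g : 'M[int]_2) (z : R[i]) : R[i] :=
  autj g z ^- k * f (moebius g z).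

(* The last clause is vanishing at every cusp: the cusps are the g(ioo) for g
   in SL2(Z), and f|g tends to 0 as Im z -> +oo, uniformly in Re z. Only the
   values of f on the upper half-plane matter. *)
Definition cusp_form (R : realType) (k q : nat) (f : R[i] -> R[i]) : Prop :=
  [/\ forall z, upper_half z -> complex_derivable f z,
      forall g, Gamma0 q g -> forall z, upper_half z ->
        f (moebius g z) = autj g z ^+ k * f z
    & forall g, SL2Z g -> forall e : R, 0 < e ->
        exists Y : R, forall z, upper_half z -> Y < complex.Im z ->
          `|slash k f g z| < e%:C].

Definition fourier_expansion (R : realType) (f : R[i] -> R[i])
    (a : nat -> R[i]) : Prop :=
  forall z, upper_half z ->
    sums_to 1 (fun n => a n * cexp ((2 * pi * n%:R)%:C * 'i * z)) (f z).

Definition fricke (R : realType) (k q : nat) (f : R[i] -> R[i]) (z : R[i]) :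
    R[i] :=
  (q%:R `^ (- (k%:R / 2)))%:C * z ^- k * f (- (q%:R * z)^-1).

(* L is the entire function that extends sum_{n >= 1} a(n) n^{-s} from the
   half-plane Re s > (k+1)/2; by the identity theorem there is at most one. *)
Definition entire_continuation (R : realType) (k : nat) (a : nat -> R[i])
    (L : R[i] -> R[i]) : Prop :=
  (forall s, complex_derivable L s) /\
  (forall s, (k%:R + 1) / 2 < complex.Re s ->
     sums_to 1 (fun n => a n * cpow n%:R (- s)) (L s)).

Definition gbinomial (R : realType) (alpha : R) (j : nat) : R :=
  (\prod_(i < j) (alpha - i%:R)) / (j`!)%:R.

(* The coefficient of X^m in
     sum_j binomial(alpha, j) (sum_{n >= 2} a(n) X^{n-1})^j.
   The inner series has no constant term, so truncating it at degree m and the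
   outer sum at j = m does not change this coefficient. *)
Definition binomial_coef (R : realType) (a : nat -> R[i]) (alpha : R)
    (m : nat) : R[i] :=
  (\sum_(j < m.+1) (gbinomial alpha j)%:C *:
     (\poly_(l < m.+1) (if l == 0%N then 0 else a l.+1)) ^+ j)`_m.

(* c is the sequence of coefficients in the expansion
     f(iy)^alpha = sum_{m >= 0} c(m) e^{-2 pi (m + alpha) y}   (y > 0)
   obtained from the binomial series; f(iy) is assumed real positive. The
   binomial series determines c formally (it converges for y large), but that
   the expansion holds for all y > 0 is a genuine condition: it excludes f with
   zeros of odd order in the upper half-plane when alpha = 1/2. *)
Definition power_expansion (R : realType) (f : R[i] -> R[i])
    (a : nat -> R[i]) (alpha : R) (c : nat -> R[i]) : Prop :=
  (forall m, c m = binomial_coef a alpha m) /\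
  (forall y : R, 0 < y ->
     sums_to 0 (fun m => c m * (expR (- (2 * pi * (m%:R + alpha) * y)))%:C)
       (expR (alpha * ln (complex.Re (f (0 +i* y)))))%:C).

Definition Gamma (R : realType) (x : R) : R :=
  \int[lebesgue_measure]_(t in `]0, +oo[) (t `^ (x - 1) * expR (- t)).

Definition complex_integral (R : realType) (D : set R) (h : R -> R[i]) : R[i] :=
  (\int[lebesgue_measure]_(t in D) complex.Re (h t)) +i*
  (\int[lebesgue_measure]_(t in D) complex.Im (h t)).

Definition besselK (R : realType) (nu : R[i]) (x : R) : R[i] :=
  2^-1 * complex_integral `]0, +oo[
    (fun t : R => (expR (- (x / 2 * (t + t^-1))))%:C * cpow t (- nu) *
                  (t^-1)%:C).

(* Main.v *)
(* On the imaginary axis let F(y) = f(iy) and g = sqrt F, so that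
   g(y) = sum c(m) exp(-pi (2m+1) y). Since k is divisible by 4, the Fricke
   relation reads F(1/(qy)) = q^(k/2) y^k F(y), so
     F(y) = q^(-k/4) y^(-k/2) g(y) g(1/(qy)).
   Integrating against y^(s-1), the left side is the Mellin transform
   (2 pi)^(-s) Gamma(s) L(s), while the double series on the right, integrated
   term by term, leaves for s = (k+1)/2 and s = k/2 the integrals of
   exp(-Ay - B/y) y^(-1/2) and exp(-Ay - B/y) y^(-1), that is K_{1/2} and K_0.

   Interchanging sum and integral needs sum |c(m)| exp(-2 pi m y) to be
   O(exp(d/y)) for small d: absolute convergence of the Dirichlet series bounds
   the a(n) polynomially, and Cauchy's estimate for the square root of
   sum a(n+1) z^n then bounds c(m) r^m by the square root of
   sum |a(n+1)| r^n. The Mellin identity holds by direct integration only for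
   Re s large; it is carried to s = (k+1)/2 and s = k/2 by an identity theorem
   for functions holomorphic on a half-plane and vanishing on a smaller one. *)
Require Import Defs.
From HB Require Import structures.
From mathcomp Require Import all_boot all_order all_algebra.
From mathcomp Require Import complex.
From mathcomp Require Import all_classical all_reals all_analysis.
From mathcomp Require Import measurable_realfun ring lra zify.

Set Implicit Arguments.
Unset Strict Implicit.
Unset Printing Implicit Defensive.

Import Order.TTheory GRing.Theory Num.Theory.
Import numFieldNormedType.Exports.

Local Open Scope classical_set_scope.
Local Open Scope ring_scope.
Local Open Scope complex_scope.

(** * Complex differentiability and Goursat's theorem *)

(** Every function that is integrated is bounded near 0 and decays exponentially at infinity, so its
    Mellin transform is holomorphic on Re s > 1; as k >= 4, both (k+1)/2 and k/2 lie there. That F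
    is bounded near 0 is itself read off the factorisation, from the decay of g(1/(qy)).

    The constant is d = pi/(2q). The growth factors exp(d/y) of g(y) and exp(dqy) of g(1/(qy)) then
    cost exactly half of the decay exp(-pi/(qy)) and exp(-pi y) of the leading terms. The remaining
    half in y gives integrability at infinity, and the remaining half in 1/y pays for a power of 1/y
    at 0.

    The identity theorem is derived from Goursat's theorem on squares alone, without Cauchy's
    formula or local power series. Rotating about a point turns a counterexample into an entire
    function of compact support, and a weight concentrated at the centre of one side of a square
    rules such a function out. *)

Definition cabs (R : realType) (z : R[i]) : R :=
  Num.sqrt (complex.Re z ^+ 2 + complex.Im z ^+ 2).

(** The norm of [R[i]] takes its values in [R[i]]; [cabs] is the same number in [R], where the real
    decision procedures apply. *)
Lemma normC_cabs (R : realType) (z : R[i]) : `|z| = (cabs z)%:C.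
Proof. exact: normc_def. Qed.

Lemma cabs_ge0 (R : realType) (z : R[i]) : 0 <= cabs z.
Proof. exact: sqrtr_ge0. Qed.

Lemma cabs0 (R : realType) : cabs (0 : R[i]) = 0.
Proof. by rewrite /cabs/= expr0n/= addr0 sqrtr0. Qed.

Lemma cabs1 (R : realType) : cabs (1 : R[i]) = 1.
Proof. by rewrite /cabs/= expr0n/= expr1n addr0 sqrtr1. Qed.

Lemma cabsM (R : realType) (z w : R[i]) : cabs (z * w) = cabs z * cabs w.
Proof. by apply: complexI; rewrite rmorphM/= -!normC_cabs normrM. Qed.

Lemma cabsX (R : realType) (z : R[i]) n : cabs (z ^+ n) = cabs z ^+ n.
Proof. by apply: complexI; rewrite rmorphXn/= -!normC_cabs normrX. Qed.

Lemma cabsN (R : realType) (z : R[i]) : cabs (- z) = cabs z.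
Proof. by apply: complexI; rewrite -!normC_cabs normrN. Qed.

Lemma cabsC (R : realType) (z w : R[i]) : cabs (z - w) = cabs (w - z).
Proof. by rewrite -cabsN opprB. Qed.

Lemma cabsD (R : realType) (z w : R[i]) : cabs (z + w) <= cabs z + cabs w.
Proof. by rewrite -lecR rmorphD/= -!normC_cabs ler_normD. Qed.

Lemma cabs_real (R : realType) (x : R) : cabs x%:C = `|x|.
Proof. by rewrite /cabs/= expr0n/= addr0 sqrtr_sqr. Qed.

Lemma cabs_sum (R : realType) (I : Type) (r : seq I) (P : pred I)
    (u : I -> R[i]) :
  cabs (\sum_(i <- r | P i) u i) <= \sum_(i <- r | P i) cabs (u i).
Proof.
elim/big_rec2: _ => [|i x y _ h]; first by rewrite cabs0.
by rewrite (le_trans (cabsD _ _))// lerD2l.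
Qed.

Lemma ReD (R : realType) (z w : R[i]) :
  complex.Re (z + w) = complex.Re z + complex.Re w.
Proof. by case: z w => ? ? []. Qed.

Lemma ImD (R : realType) (z w : R[i]) :
  complex.Im (z + w) = complex.Im z + complex.Im w.
Proof. by case: z w => ? ? []. Qed.

Lemma ReN (R : realType) (z : R[i]) : complex.Re (- z) = - complex.Re z.
Proof. by case: z. Qed.

Lemma ImN (R : realType) (z : R[i]) : complex.Im (- z) = - complex.Im z.
Proof. by case: z. Qed.

Lemma ReM (R : realType) (z w : R[i]) : complex.Re (z * w) =
  complex.Re z * complex.Re w - complex.Im z * complex.Im w.
Proof. by case: z w => ? ? []. Qed.

Lemma ImM (R : realType) (z w : R[i]) : complex.Im (z * w) =
  complex.Re z * complex.Im w + complex.Im z * complex.Re w.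
Proof. by case: z w => ? ? []. Qed.

Definition reimE := (ReD, ImD, ReN, ImN, ReM, ImM).

Lemma eqC (R : realType) (z w : R[i]) :
  complex.Re z = complex.Re w -> complex.Im z = complex.Im w -> z = w.
Proof. by case: z w => ? ? [? ?] /= -> ->. Qed.

Lemma le_Re_cabs (R : realType) (z : R[i]) : `|complex.Re z| <= cabs z.
Proof. by rewrite -sqrtr_sqr ler_wsqrtr// lerDl sqr_ge0. Qed.

Lemma le_Im_cabs (R : realType) (z : R[i]) : `|complex.Im z| <= cabs z.
Proof. by rewrite -sqrtr_sqr ler_wsqrtr// lerDr sqr_ge0. Qed.

Lemma cabs_le_ReIm (R : realType) (z : R[i]) :
  cabs z <= `|complex.Re z| + `|complex.Im z|.
Proof.
rewrite -(@ler_pXn2r _ 2) ?nnegrE ?cabs_ge0 ?addr_ge0//.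
rewrite sqr_sqrtr ?addr_ge0 ?sqr_ge0// sqrrD !real_normK ?num_real//.
by rewrite [leRHS]addrAC lerDl mulrn_wge0// mulr_ge0.
Qed.

(** Differentiability as a first-order expansion with error e |w - z|, free of division: the form in
    which Goursat's argument and the product rule consume it. *)
Definition cdiff (R : realType) (f : R[i] -> R[i]) (z D : R[i]) : Prop :=
  forall e : R, 0 < e -> exists2 d : R, 0 < d &
    forall w, cabs (w - z) < d ->
      cabs (f w - f z - D * (w - z)) <= e * cabs (w - z).

Lemma complex_derivable_cdiff (R : realType) (f : R[i] -> R[i]) (z : R[i]) :
  complex_derivable f z -> exists D, cdiff f z D.
Proof.
move=> /cvg_ex[/= D HD]; exists D => e e0.
have ec0 : (0 : R[i]) < e%:C by rewrite ltcR.
move/cvgrPdist_le : HD => /(_ _ ec0).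
rewrite /dnbhs => /nbhs_ballP[r /= r0 Hr].
have rE : r = (complex.Re r)%:C by rewrite RRe_real// gtr0_real.
have r0' : 0 < complex.Re r by rewrite -ltcR -rE.
exists (complex.Re r) => // w wz.
have [->|wz0] := eqVneq w z; first by rewrite !subrr mulr0 subr0 cabs0 mulr0.
have wz1 : w - z != 0 by rewrite subr_eq0.
have := Hr (w - z); rewrite /ball/= sub0r normrN normC_cabs rE ltcR.
move=> /(_ wz wz1); rewrite normC_cabs lecR /= /shift/= => H.
have -> : f w - f z - D * (w - z) =
    - (D - (w - z)^-1 *: (f ((w - z) *: 1 + z) - f z)) * (w - z).
  rewrite /GRing.scale/= mulr1 subrK mulNr mulrBl opprB; congr (_ - _).
  by rewrite mulrC mulrA divff// mul1r.
by rewrite cabsM cabsN ler_wpM2r// cabs_ge0.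
Qed.

Definition seg (R : realType) (g : R -> R) (a b : R) : R :=
  \int[lebesgue_measure]_(x in `[a, b]) g x.

Lemma seg_integrable (R : realType) (g : R -> R) (a b : R) :
  continuous g -> (@lebesgue_measure R).-integrable `[a, b] (EFin \o g).
Proof.
move=> cg; apply: continuous_compact_integrable; first exact: segment_compact.
exact: continuous_subspaceT.
Qed.

Lemma segD (R : realType) (g : R -> R) (a b c : R) : continuous g ->
  a <= b -> b <= c -> seg g a c = seg g a b + seg g b c.
Proof.
move=> cg ab bc; have ig := seg_integrable a c cg.
have := Rintegral_itvB (x := b) ig.
rewrite !bnd_simp => /(_ ab bc) H.
apply/eqP; rewrite /seg addrC -subr_eq H; apply/eqP.
rewrite Rintegral_itv_obnd_cbnd//.
apply: integrableS (seg_integrable b c cg) => //=.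
exact: subset_itv_oc_cc.
Qed.

Lemma seg_ge (R : realType) (g : R -> R) (a b K : R) : continuous g ->
  a <= b -> (forall x, a <= x <= b -> K <= g x) -> K * (b - a) <= seg g a b.
Proof.
move=> cg ab Kg.
have -> : K * (b - a) = seg (fun=> K) a b.
  rewrite /seg Rintegral_cst//= lebesgue_measure_itv/= lte_fin.
  case: ltP => //= ba; have -> : a = b by apply/eqP; rewrite eq_le ab ba.
  by rewrite subrr.
apply: le_Rintegral => //.
- by apply: seg_integrable => x; exact: cvg_cst.
- exact: seg_integrable.
Qed.

(** Serves for opposite sides of a square: [g] and [h] are the values of f on the two sides, and [K]
    is the difference predicted by the affine part of f. *)
Lemma segB_close (R : realType) (g h : R -> R) (a l K e : R) :
  continuous g -> continuous h -> 0 <= l ->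
  (forall x, a <= x <= a + l -> `|g x - h x - K| <= e) ->
  `|seg g a (a + l) - seg h a (a + l) - K * l| <= e * l.
Proof.
move=> cg ch l0 H; have ab : a <= a + l by rewrite lerDl.
have cB (u v : R -> R) : continuous u -> continuous v -> continuous (fun x : R => u x - v x).
  by move=> cu cv x; exact: (cvgB (cu x) (cv x)).
have segB (u v : R -> R) : continuous u -> continuous v ->
    seg u a (a + l) - seg v a (a + l) = seg (fun x => u x - v x) a (a + l).
  by move=> cu cv; rewrite /seg RintegralB//; exact: seg_integrable.
have lE : a + l - a = l by lra.
have H1 : (K - e) * (a + l - a) <= seg (fun x => g x - h x) a (a + l).
  apply: seg_ge => //; first exact: cB.
  by move=> x /H; rewrite ler_norml => /andP[]; lra.
have H2 : (- K - e) * (a + l - a) <= seg (fun x => h x - g x) a (a + l).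
  apply: seg_ge => //; first exact: cB.
  by move=> x /H; rewrite ler_norml => /andP[]; lra.
rewrite -segB// lE in H1; rewrite -segB// lE in H2.
by rewrite ler_norml; apply/andP; split; lra.
Qed.

Lemma cdiff_continuous (R : realType) (f : R[i] -> R[i]) (z D : R[i]) :
  cdiff f z D -> forall e : R, 0 < e ->
  exists2 d : R, 0 < d & forall w, cabs (w - z) < d -> cabs (f w - f z) < e.
Proof.
move=> fz e e0; have [d d0 H] := fz 1 ltr01.
have K0 : 0 < 1 + cabs D by rewrite ltr_wpDr// cabs_ge0.
exists (Num.min d (e / (1 + cabs D))); first by rewrite lt_min d0 divr_gt0.
move=> w; rewrite lt_min => /andP[/H wd].
rewrite ltr_pdivlMr// => we; rewrite mul1r in wd.
have -> : f w - f z = (f w - f z - D * (w - z)) + D * (w - z) by rewrite subrK.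
apply: le_lt_trans (cabsD _ _) _; rewrite cabsM.
apply: le_lt_trans _ we; rewrite [leRHS]mulrDr mulr1 lerD//.
by rewrite mulrC.
Qed.

Lemma line_continuous (R : realType) (f : R[i] -> R[i]) (u v : R[i]) :
  (forall z, exists D, cdiff f z D) -> cabs v = 1 ->
  continuous (fun t : R => complex.Re (f (u + t%:C * v))) /\
  continuous (fun t : R => complex.Im (f (u + t%:C * v))).
Proof.
move=> fd v1.
have H (x e : R) : 0 < e -> \forall y \near x,
    cabs (f (u + y%:C * v) - f (u + x%:C * v)) < e.
  move=> e0; have [D fD] := fd (u + x%:C * v).
  have [d d0 Hd] := cdiff_continuous fD e0.
  near=> y; apply: Hd.
  rewrite opprD addrACA subrr add0r -mulrBl cabsM v1 mulr1 -rmorphB cabs_real.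
  near: y; apply/nbhs_ballP; exists d => //= y; rewrite /ball/=.
  by rewrite distrC.
split=> x; apply/cvgrPdist_lt => e e0; near=> y.
- rewrite distrC -ReN -ReD; apply: le_lt_trans (le_Re_cabs _) _.
  by near: y; exact: H.
- rewrite distrC -ImN -ImD; apply: le_lt_trans (le_Im_cabs _) _.
  by near: y; exact: H.
Unshelve. all: by end_near. Qed.

(* Real part of the contour integral of f along the boundary of the square
   [a, a + l] x [c, c + l]. *)
Definition boundary_flux (R : realType) (f : R[i] -> R[i]) (a c l : R) : R :=
  seg (fun x => complex.Re (f (x +i* c))) a (a + l) -
  seg (fun x => complex.Re (f (x +i* (c + l)))) a (a + l) -
  seg (fun y => complex.Im (f ((a + l) +i* y))) c (c + l) +
  seg (fun y => complex.Im (f (a +i* y))) c (c + l).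

Lemma horizontal_continuous (R : realType) (f : R[i] -> R[i]) (c : R) :
  (forall z, exists D, cdiff f z D) ->
  continuous (fun x : R => complex.Re (f (x +i* c))).
Proof.
move=> fd; have := (@line_continuous R f (0 +i* c) 1 fd (cabs1 _)).1.
by under eq_fun do rewrite mulr1 -[_ + _]/((0 + _) +i* (c + 0)) add0r addr0.
Qed.

Lemma vertical_continuous (R : realType) (f : R[i] -> R[i]) (a : R) :
  (forall z, exists D, cdiff f z D) ->
  continuous (fun y : R => complex.Im (f (a +i* y))).
Proof.
move=> fd.
have i1 : cabs ('i : R[i]) = 1 by rewrite /cabs/= expr0n/= add0r expr1n sqrtr1.
have := (@line_continuous R f (a +i* 0) 'i fd i1).2.
suff E y : (a +i* 0) + y%:C * 'i = a +i* y :> R[i].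
  by under eq_fun do rewrite E.
by apply: eqC; rewrite !reimE /=; ring.
Qed.

Lemma boundary_flux_split (R : realType) (f : R[i] -> R[i]) (a c l : R) :
  (forall z, exists D, cdiff f z D) -> 0 <= l ->
  boundary_flux f a c (l + l) =
  boundary_flux f a c l + boundary_flux f (a + l) c l +
  (boundary_flux f a (c + l) l + boundary_flux f (a + l) (c + l) l).
Proof.
move=> fd l0; rewrite /boundary_flux !addrA.
have al : a <= a + l by rewrite lerDl.
have al' : a + l <= a + l + l by rewrite lerDl.
have cl : c <= c + l by rewrite lerDl.
have cl' : c + l <= c + l + l by rewrite lerDl.
rewrite !(segD (@horizontal_continuous _ _ _ fd) al al').
rewrite !(segD (@vertical_continuous _ _ _ fd) cl cl').
ring.
Qed.

(** The affine part f(z) + D (w - z) contributes Im D l^2 from the horizontal sides and -Im D l^2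
    from the vertical ones, so only the remainder counts. It is at most 2 e l on each side, because
    points of the square are within 2 l of z; each of the two pairs of sides thus gives 4 e l^2. *)
Lemma boundary_flux_small (R : realType) (f : R[i] -> R[i]) (z D : R[i])
    (a c l e : R) :
  (forall z, exists D, cdiff f z D) -> 0 <= l -> 0 <= e ->
  (forall w, cabs (w - z) <= 2 * l ->
     cabs (f w - f z - D * (w - z)) <= e * cabs (w - z)) ->
  a <= complex.Re z <= a + l -> c <= complex.Im z <= c + l ->
  `|boundary_flux f a c l| <= 8 * e * l ^+ 2.
Proof.
move=> fd l0 e0 H /andP[az za] /andP[cz zc].
pose r w := f w - f z - D * (w - z).
have Hr x y : a <= x <= a + l -> c <= y <= c + l ->
    cabs (r (x +i* y)) <= 2 * e * l.
  move=> /andP[ax xa] /andP[cy yc].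
  have wz : cabs (x +i* y - z) <= 2 * l.
    apply: le_trans (cabs_le_ReIm _) _; rewrite !reimE /=.
    have -> : 2 * l = l + l by ring.
    by apply: lerD; rewrite ler_norml; apply/andP; split; lra.
  apply: le_trans (H _ wz) _.
  by rewrite [leRHS](_ : _ = e * (2 * l)); [exact: ler_wpM2l|ring].
have fE w : f w = f z + D * (w - z) + r w by rewrite /r; ring.
clearbody r.
have al : a <= a + l by rewrite lerDl.
have cl : c <= c + l by rewrite lerDl.
have caa : a <= a <= a + l by rewrite lexx.
have cab : a <= a + l <= a + l by rewrite lexx al.
have cca : c <= c <= c + l by rewrite lexx.
have ccb : c <= c + l <= c + l by rewrite lexx cl.
have h1 : `|seg (fun x => complex.Re (f (x +i* c))) a (a + l) -
    seg (fun x => complex.Re (f (x +i* (c + l)))) a (a + l) -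
    complex.Im D * l * l| <= 4 * e * l * l.
  refine (segB_close (@horizontal_continuous _ _ c fd)
    (@horizontal_continuous _ _ (c + l) fd) l0 _) => x xa.
  rewrite (fE (x +i* c)) (fE (x +i* (c + l))) !reimE /=.
  have := le_trans (le_Re_cabs _) (Hr x c xa cca).
  have := le_trans (le_Re_cabs _) (Hr x (c + l) xa ccb).
  rewrite !ler_norml => /andP[p1 p2] /andP[p3 p4]; apply/andP; split; lra.
have h2 : `|seg (fun y => complex.Im (f (a +i* y))) c (c + l) -
    seg (fun y => complex.Im (f ((a + l) +i* y))) c (c + l) -
    - (complex.Im D * l) * l| <= 4 * e * l * l.
  refine (segB_close (@vertical_continuous _ _ a fd)
    (@vertical_continuous _ _ (a + l) fd) l0 _) => y yc.
  rewrite (fE (a +i* y)) (fE ((a + l) +i* y)) !reimE /=.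
  have := le_trans (le_Im_cabs _) (Hr a y caa yc).
  have := le_trans (le_Im_cabs _) (Hr (a + l) y cab yc).
  rewrite !ler_norml => /andP[p1 p2] /andP[p3 p4]; apply/andP; split; lra.
move: h1 h2; rewrite /boundary_flux !ler_norml => /andP[p1 p2] /andP[p3 p4].
rewrite expr2; apply/andP; split; lra.
Qed.

Lemma boundary_flux_bisect (R : realType) (f : R[i] -> R[i]) (l : R)
    (p : R * R) :
  (forall z, exists D, cdiff f z D) -> 0 <= l ->
  exists p' : R * R, [/\ p.1 <= p'.1 <= p.1 + l / 2,
    p.2 <= p'.2 <= p.2 + l / 2 &
    `|boundary_flux f p.1 p.2 l| / 4 <= `|boundary_flux f p'.1 p'.2 (l / 2)|].
Proof.
case: p => a c fd l0 /=; set h := l / 2.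
have lE : l = h + h by rewrite /h; lra.
have h0 : 0 <= h by rewrite /h; lra.
have -> : boundary_flux f a c l = boundary_flux f a c (h + h) by rewrite -lE.
rewrite (boundary_flux_split _ _ fd h0).
set x1 := boundary_flux f a c h; set x2 := boundary_flux f (a + h) c h.
set x3 := boundary_flux f a (c + h) h.
set x4 := boundary_flux f (a + h) (c + h) h.
set S := `|_|; apply/not_existsP => H.
have T : S <= `|x1| + `|x2| + (`|x3| + `|x4|).
  by apply: le_trans (ler_normD _ _) _; apply: lerD; exact: ler_normD.
have b a' c' : a <= a' <= a + h -> c <= c' <= c + h ->
    `|boundary_flux f a' c' h| < S / 4.
  by move=> ha hc; rewrite ltNge; apply/negP => hS; apply: (H (a', c')); split.
have b1 : `|x1| < S / 4 by apply: b; rewrite lexx lerDl.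
have b2 : `|x2| < S / 4 by apply: b; rewrite lexx lerDl h0.
have b3 : `|x3| < S / 4 by apply: b; rewrite lexx lerDl h0.
have b4 : `|x4| < S / 4 by apply: b; rewrite lexx lerDl h0.
lra.
Qed.

Lemma nested_intervals (R : realType) (u : nat -> R) (l : R) :
  0 <= l -> (forall n, u n <= u n.+1 <= u n + l / 2 ^+ n.+1) ->
  exists x, forall n, u n <= x <= u n + l / 2 ^+ n.
Proof.
move=> l0 H.
have half n : l / 2 ^+ n = l / 2 ^+ n.+1 + l / 2 ^+ n.+1.
  by rewrite exprS invfM; lra.
have inc m n : (m <= n)%N -> u m <= u n.
  elim: n => [|n IH]; first by rewrite leqn0 => /eqP ->.
  rewrite leq_eqVlt => /predU1P[->//|/IH/le_trans]; apply.
  by have /andP[] := H n.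
have dec m n : (m <= n)%N -> u n + l / 2 ^+ n <= u m + l / 2 ^+ m.
  elim: n => [|n IH]; first by rewrite leqn0 => /eqP ->.
  rewrite leq_eqVlt => /predU1P[->//|/IH]; apply: le_trans.
  by have /andP[_] := H n; have := half n; lra.
have ub n : ubound (range u) (u n + l / 2 ^+ n).
  move=> _ [m _ <-]; apply: le_trans (inc _ _ (leq_maxl m n)) _.
  apply: le_trans (dec _ _ (leq_maxr m n)).
  by rewrite lerDl divr_ge0// exprn_ge0.
have hs : has_sup (range u).
  by split; [exists (u 0%N); exists 0%N|exists (u 0%N + l / 2 ^+ 0); exact: ub].
exists (sup (range u)) => n; apply/andP; split.
  by apply: ub_le_sup; [exact: hs.2|exists n].
by apply: ge_sup; [exact: hs.1|exact: ub].
Qed.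

Lemma pow2_gt (R : realType) (x : R) : exists n : nat, x < 2 ^+ n.
Proof.
have [n xn] : exists n : nat, x < n%:R.
  by exists (Num.truncn x).+1; rewrite truncnS_gt.
exists n; apply: lt_le_trans xn _; rewrite -natrX ler_nat.
by apply: ltnW; exact: ltn_expl.
Qed.

(** Goursat's bisection: some quarter always keeps a fourth of the flux, while at the common point
    of the nested squares differentiability makes the flux small compared with the area. *)
Theorem goursat_square (R : realType) (f : R[i] -> R[i]) (a c l : R) :
  (forall z, exists D, cdiff f z D) -> 0 < l -> boundary_flux f a c l = 0.
Proof.
move=> fd l0; apply/eqP; rewrite -normr_eq0; apply/eqP.
set S := `|_|; apply/eqP; rewrite eq_le normr_ge0 andbT leNgt; apply/negP => S0.
have [s [s0 sS]] : exists s : nat -> R * R, s 0%N = (a, c) /\ forall n,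
    [/\ (s n).1 <= (s n.+1).1 <= (s n).1 + l / 2 ^+ n.+1,
      (s n).2 <= (s n.+1).2 <= (s n).2 + l / 2 ^+ n.+1 &
      `|boundary_flux f (s n).1 (s n).2 (l / 2 ^+ n)| / 4 <=
      `|boundary_flux f (s n.+1).1 (s n.+1).2 (l / 2 ^+ n.+1)|].
  have ex (np : nat * (R * R)) : exists p' : R * R,
      [/\ np.2.1 <= p'.1 <= np.2.1 + l / 2 ^+ np.1.+1,
        np.2.2 <= p'.2 <= np.2.2 + l / 2 ^+ np.1.+1 &
      `|boundary_flux f np.2.1 np.2.2 (l / 2 ^+ np.1)| / 4 <=
      `|boundary_flux f p'.1 p'.2 (l / 2 ^+ np.1.+1)|].
    have -> : l / 2 ^+ np.1.+1 = l / 2 ^+ np.1 / 2 by rewrite exprS invfM; lra.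
    by apply: boundary_flux_bisect => //; rewrite divr_ge0 ?exprn_ge0// ltW.
  have [nxt Hn] := choice ex.
  (* The depth is iterated along with the corner, since the next corner depends on the side l /
     2^n. *)
  pose t n := iter n (fun np => (np.1.+1, nxt np)) (0%N, (a, c)).
  have tn n : (t n).1 = n by elim: n => //= n ->.
  exists (fun n => (t n).2); split => // n.
  by have := Hn (t n); rewrite tn.
have Sn n : S / 4 ^+ n <= `|boundary_flux f (s n).1 (s n).2 (l / 2 ^+ n)|.
  elim: n => [|n IH]; first by rewrite s0 !expr0 !divr1.
  have [_ _] := sS n; apply: le_trans; rewrite exprS invfM mulrA mulrAC.
  by rewrite ler_pM2r ?invr_gt0.
have [|x Hx] := nested_intervals (u := fun n => (s n).1) (ltW l0).
  by move=> n; have [] := sS n.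
have [|y Hy] := nested_intervals (u := fun n => (s n).2) (ltW l0).
  by move=> n; have [] := sS n.
have [D fD] := fd (x +i* y).
(* With this [e] the bound 8 e (l / 2^n)^2 is half of S / 4^n, which contradicts the lower bound
   [Sn]. *)
pose e := S / (16 * l ^+ 2).
have e0 : 0 < e by rewrite divr_gt0// mulr_gt0// exprn_gt0.
have [d d0 Hd] := fD e e0.
have [n ln] := pow2_gt (2 * l / d).
have p2 : 0 < 2 ^+ n :> R by rewrite exprn_gt0.
have ln' : 2 * (l / 2 ^+ n) < d.
  by rewrite mulrA ltr_pdivrMr// -ltr_pdivrMl// mulrC.
have := @boundary_flux_small _ f (x +i* y) D (s n).1 (s n).2 (l / 2 ^+ n) e fd.
move=> /(_ (divr_ge0 (ltW l0) (ltW p2)) (ltW e0)).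
have h w : cabs (w - (x +i* y)) <= 2 * (l / 2 ^+ n) ->
    cabs (f w - f (x +i* y) - D * (w - (x +i* y))) <= e * cabs (w - (x +i* y)).
  by move=> hw; apply: Hd; exact: le_lt_trans ln'.
move=> /(_ h (Hx n) (Hy n)); apply/negP; rewrite -ltNge.
apply: lt_le_trans (Sn n).
have -> : 8 * e * (l / 2 ^+ n) ^+ 2 = S / 4 ^+ n / 2.
  have -> : 4 ^+ n = 2 ^+ n * 2 ^+ n :> R.
    by rewrite -exprMn; congr (_ ^+ _); lra.
  by rewrite /e; field; rewrite !gt_eqF.
have : 0 < S / 4 ^+ n by rewrite divr_gt0 ?exprn_gt0.
lra.
Qed.

(** * Rules of complex differentiation *)

Lemma cdiff_near (R : realType) (f g : R[i] -> R[i]) (z D : R[i]) (r : R) :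
  0 < r -> (forall w, cabs (w - z) < r -> f w = g w) ->
  cdiff f z D -> cdiff g z D.
Proof.
move=> r0 fg fz e e0; have [d d0 H] := fz e e0.
exists (Num.min d r); first by rewrite lt_min d0.
move=> w; rewrite lt_min => /andP[wd wr].
by rewrite -!fg ?subrr ?cabs0//; exact: H.
Qed.

Lemma cdiff_cst (R : realType) (c z : R[i]) : cdiff (fun=> c) z 0.
Proof.
move=> e e0; exists 1 => // w _.
by rewrite subrr mul0r subrr cabs0 mulr_ge0 ?cabs_ge0 ?ltW.
Qed.

Lemma cdiff_id (R : realType) (z : R[i]) : cdiff id z 1.
Proof.
move=> e e0; exists 1 => // w _.
by rewrite mul1r subrr cabs0 mulr_ge0 ?cabs_ge0 ?ltW.
Qed.

Lemma cdiffD (R : realType) (f g : R[i] -> R[i]) (z Df Dg : R[i]) :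
  cdiff f z Df -> cdiff g z Dg -> cdiff (fun w => f w + g w) z (Df + Dg).
Proof.
move=> fz gz e e0; have e2 : 0 < e / 2 by rewrite divr_gt0.
have [d1 d10 H1] := fz _ e2; have [d2 d20 H2] := gz _ e2.
exists (Num.min d1 d2); first by rewrite lt_min d10.
move=> w; rewrite lt_min => /andP[/H1 h1 /H2 h2].
have -> : f w + g w - (f z + g z) - (Df + Dg) * (w - z) =
    (f w - f z - Df * (w - z)) + (g w - g z - Dg * (w - z)) by ring.
by apply: le_trans (cabsD _ _) _; lra.
Qed.

Lemma cdiffM (R : realType) (f g : R[i] -> R[i]) (z Df Dg : R[i]) :
  cdiff f z Df -> cdiff g z Dg ->
  cdiff (fun w => f w * g w) z (Df * g z + f z * Dg).
Proof.
move=> fz gz e e0.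
(* [K] adds up the factors of the three error terms: cabs (g z) + 1 bounds g near z, and the other
   two are |f z| and |Df|. *)
pose K := cabs (g z) + 1 + cabs (f z) + cabs Df.
have K0 : 0 < K.
  by have := cabs_ge0 (g z); have := cabs_ge0 (f z);
    have := cabs_ge0 Df; rewrite /K; lra.
have e1 : 0 < e / K by rewrite divr_gt0.
have [d1 d10 H1] := fz _ e1; have [d2 d20 H2] := gz _ e1.
have m1 : 0 < Num.min 1 (e / K) by rewrite lt_min ltr01.
have [d3 d30 H3] := cdiff_continuous gz m1.
exists (Num.min d1 (Num.min d2 d3)); first by rewrite !lt_min d10 d20.
move=> w; rewrite !lt_min => /and3P[/H1 h1 /H2 h2 /H3].
rewrite lt_min => /andP[g1 g2].
have -> : f w * g w - f z * g z - (Df * g z + f z * Dg) * (w - z) =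
    (f w - f z - Df * (w - z)) * g w +
    (f z * (g w - g z - Dg * (w - z)) + Df * (w - z) * (g w - g z)) by ring.
have gw : cabs (g w) <= cabs (g z) + 1.
  by rewrite -(subrK (g z) (g w)) addrC (le_trans (cabsD _ _))// lerD2l ltW.
have w0 := cabs_ge0 (w - z).
apply: le_trans (cabsD _ _) _.
have -> : e * cabs (w - z) = e / K * cabs (w - z) * (cabs (g z) + 1) +
   (cabs (f z) * (e / K * cabs (w - z)) + cabs Df * cabs (w - z) * (e / K)).
  by rewrite -[in LHS](divfK (lt0r_neq0 K0) e) {2}/K; ring.
apply: lerD; first by rewrite cabsM ler_pM ?cabs_ge0.
apply: le_trans (cabsD _ _) _; apply: lerD; rewrite !cabsM.
  by rewrite ler_wpM2l ?cabs_ge0.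
by rewrite ler_wpM2l ?mulr_ge0 ?cabs_ge0// ltW.
Qed.

Lemma cdiffX (R : realType) (f : R[i] -> R[i]) (z : R[i]) n :
  (exists D, cdiff f z D) -> exists D, cdiff (fun w => f w ^+ n) z D.
Proof.
move=> [D fD]; elim: n => [|n [E fE]].
  by exists 0; exact: cdiff_cst.
have -> : (fun w => f w ^+ n.+1) = (fun w => f w * f w ^+ n).
  by apply/funext => w; rewrite exprS.
by eexists; exact: cdiffM fD fE.
Qed.

Lemma cdiff_affine (R : realType) (f : R[i] -> R[i]) (c u z D : R[i]) :
  cabs u = 1 -> cdiff f (c + u * z) D ->
  cdiff (fun w => f (c + u * w)) z (D * u).
Proof.
move=> u1 fz e e0; have [d d0 H] := fz e e0; exists d => // w wd.
have E : c + u * w - (c + u * z) = u * (w - z) by ring.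
by have := H (c + u * w); rewrite E cabsM u1 mul1r mulrA; apply.
Qed.

(** * The identity theorem on half-planes *)

Lemma exprn_ge1Dxn (R : realType) (x : R) n : 0 <= x ->
  1 + x * n%:R <= (1 + x) ^+ n.
Proof.
move=> x0; elim: n => [|n IH]; first by rewrite mulr0 addr0 expr0.
have n0 : 0 <= x * x * n%:R by rewrite !mulr_ge0.
rewrite exprS -natr1; apply: (@le_trans _ _ ((1 + x) * (1 + x * n%:R))); first by lra.
by rewrite ler_wpM2l// addr_ge0.
Qed.

(* By Goursat on [-M, M] x [0, 2 M], the integral of (4 M^2 - x^2)^n conj(f 0) f(x)
   over [-M, M] vanishes; but for large n a neighbourhood of 0, where the real
   part of the integrand is positive, dominates it. *)
Lemma cdiff_compact_support (R : realType) (f : R[i] -> R[i]) (M : R) :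
  0 < M -> (forall z, exists D, cdiff f z D) ->
  (forall z, M <= `|complex.Re z| \/ M <= `|complex.Im z| -> f z = 0) ->
  f 0 = 0.
Proof.
move=> M0 fd f0; apply/eqP/negPn/negP => v0.
pose v := f 0.
(* Multiplying by the conjugate of f 0 makes the value at 0 equal to |f 0|^2, real and positive. *)
pose h z := (v^*)%C * f z.
have hd z : exists D, cdiff h z D.
  by have [D fD] := fd z; eexists; exact: cdiffM (cdiff_cst _ _) fD.
pose psi x := complex.Re (h (x +i* 0)).
have psi0 : 0 < psi 0.
  rewrite /psi /h -[0 +i* 0]/(0 : R[i]) -/v.
  have := mulcJ_ge0 v; rewrite le_eqVlt mulrC => /predU1P[/esym/eqP|].
    by rewrite mulf_eq0 conjc_eq0 orbb (negPf v0).
  by rewrite ltcE => /andP[].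
have cpsi : continuous psi by exact: horizontal_continuous.
have [eta [eta0 etaM Heta]] : exists eta, [/\ 0 < eta, eta <= M &
    forall x, `|x| <= eta -> psi 0 / 2 <= psi x].
  have /cvgrPdist_lt /(_ (psi 0 / 2)) := cpsi 0.
  rewrite divr_gt0// => /(_ isT) /nbhs_ballP[d /= d0 Hd].
  exists (Num.min (d / 2) M); split; first by rewrite lt_min M0 divr_gt0.
    by rewrite ge_min lexx orbT.
  move=> x; rewrite le_min => /andP[xd _].
  have := Hd x; rewrite /ball/= sub0r normrN => /(_ _).
  have xd' : `|x| < d by lra.
  by move=> /(_ xd'); rewrite ltr_norml => /andP[]; lra.
have [B B0 HB] : exists2 B, 0 <= B & forall x, - M <= x <= M -> `|psi x| <= B.
  have MM : - M <= M by lra.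
  have [c _ Hc] := @EVT_max _ (fun x => `|psi x|) (- M) M MM
    (continuous_subspaceT (fun x => cvg_norm (cpsi x))).
  by exists `|psi c| => // x xM; apply: Hc; rewrite in_itv.
(* Values of the weight 4 M^2 - x^2 at eta and at eta / 2: on [-M, M] the weight is at most [A]
   outside [-eta, eta] and at least [A'] inside [-eta/2, eta/2]. *)
pose A := 4 * M ^+ 2 - eta ^+ 2; pose A' := 4 * M ^+ 2 - (eta / 2) ^+ 2.
have A0 : 0 < A by rewrite /A; nra.
have AA' : A < A' by rewrite /A /A'; nra.
have key n : psi 0 / 2 * A' ^+ n * eta <= B * A ^+ n * (2 * M).
  pose p (z : R[i]) := (4 * M ^+ 2)%:C - z ^+ 2.
  have pd z : exists D, cdiff (fun w => p w ^+ n) z D.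
    apply: cdiffX; have [D HD] := @cdiffX R id z 2 (ex_intro _ _ (cdiff_id z)).
    have HD' := cdiffD (cdiff_cst (4 * M ^+ 2)%:C z) (cdiffM (cdiff_cst (-1) z) HD).
    eexists; apply: cdiff_near ltr01 _ HD' => w _.
    by rewrite /p mulN1r.
  pose F z := h z * p z ^+ n.
  have Fd z : exists D, cdiff F z D.
    by have [D hD] := hd z; have [E pE] := pd z; eexists; exact: cdiffM hD pE.
  have F0 z : M <= `|complex.Re z| \/ M <= `|complex.Im z| -> F z = 0.
    by move=> /f0 fz; rewrite /F /h fz mulr0 mul0r.
  pose g x := psi x * (4 * M ^+ 2 - x ^+ 2) ^+ n.
  have gE x : complex.Re (F (x +i* 0)) = g x.
    have -> : F (x +i* 0) = h (x +i* 0) * ((4 * M ^+ 2 - x ^+ 2) ^+ n)%:C.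
      by rewrite /F /p -[x +i* 0]/(x%:C) -rmorphXn -rmorphB -rmorphXn.
    by rewrite ReM /= mulr0 subr0.
  have cg : continuous g.
    by rewrite -(funext gE); exact: horizontal_continuous.
  (* Only the bottom side contributes: the other three sides lie in the region where f vanishes. *)
  have := @goursat_square _ F (- M) 0 (2 * M) Fd.
  rewrite mulr_gt0// => /(_ isT); rewrite /boundary_flux.
  have -> : - M + 2 * M = M by lra.
  have z0 a b : seg (fun=> 0 : R) a b = 0 by rewrite /seg Rintegral_cst// mul0r.
  rewrite (funext gE).
  have -> : (fun x : R => complex.Re (F (x +i* (0 + 2 * M)))) = (fun=> 0).
    by apply/funext => x; rewrite F0//; right; rewrite /= add0r ger0_norm; lra.
  have -> : (fun y : R => complex.Im (F (M +i* y))) = (fun=> 0).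
    by apply/funext => y; rewrite F0//; left; rewrite /= ger0_norm// ltW.
  have -> : (fun y : R => complex.Im (F ((- M) +i* y))) = (fun=> 0).
    by apply/funext => y; rewrite F0//; left; rewrite /= normrN ger0_norm// ltW.
  rewrite !z0 !subr0 addr0 => g0.
  have p0 x : - M <= x <= M -> 0 <= 4 * M ^+ 2 - x ^+ 2.
    by move=> /andP[]; nra.
  have lb x : - M <= x <= M -> - (B * A ^+ n) <= g x.
    move=> xM; have [xe|xe] := leP `|x| eta.
      apply: (@le_trans _ _ 0).
        by rewrite oppr_le0 mulr_ge0 ?exprn_ge0// ltW.
      by rewrite mulr_ge0 ?exprn_ge0 ?p0// (le_trans _ (Heta x xe))// divr_ge0// ltW.
    have : `|g x| <= B * A ^+ n.
      rewrite normrM ler_pM// ?HB// normrX ger0_norm ?p0//.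
      apply: lerXn2r; rewrite ?nnegrE; [exact: p0|exact: ltW|].
      by rewrite /A lerD2l lerN2 -(real_normK (num_real x)) lerXn2r ?nnegrE// ltW.
    by rewrite ler_norml => /andP[].
  have e2 : 0 < eta / 2 by rewrite divr_gt0.
  have l1 : - (B * A ^+ n) * (- (eta / 2) - - M) <= seg g (- M) (- (eta / 2)).
    by apply: seg_ge => //; [lra|move=> x /andP[? ?]; apply: lb; apply/andP; split; lra].
  have l3 : - (B * A ^+ n) * (M - eta / 2) <= seg g (eta / 2) M.
    by apply: seg_ge => //; [lra|move=> x /andP[? ?]; apply: lb; apply/andP; split; lra].
  have l2 : psi 0 / 2 * A' ^+ n * (eta / 2 - - (eta / 2)) <=
      seg g (- (eta / 2)) (eta / 2).
    apply: seg_ge => //; [lra|move=> x /andP[x1 x2]].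
    have xe : `|x| <= eta / 2 by rewrite ler_norml x1.
    have xe' : `|x| <= eta by lra.
    have xM : - M <= x <= M by apply/andP; split; lra.
    apply: ler_pM => //; [by rewrite divr_ge0// ltW|by rewrite exprn_ge0// ltW// (lt_trans A0)|exact: Heta|].
    apply: lerXn2r; rewrite ?nnegrE; [exact: ltW (lt_trans A0 AA')|exact: p0|].
    by rewrite /A' lerD2l lerN2 -(real_normK (num_real x)) lerXn2r ?nnegrE// ltW.
  have : 0 = seg g (- M) (- (eta / 2)) +
      (seg g (- (eta / 2)) (eta / 2) + seg g (eta / 2) M).
    by rewrite -segD -?segD//; lra.
  have : 0 <= B * A ^+ n by rewrite mulr_ge0 ?exprn_ge0// ltW.
  nra.
(* By Bernoulli's inequality (A'/A)^n exceeds any constant, in contradiction with [key]. *)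
have rho1 : 1 < A' / A by rewrite ltr_pdivlMr// mul1r.
have [n Hn] : exists n : nat, 2 * M * B / (psi 0 / 2 * eta) < (A' / A) ^+ n.
  have [m Hm] : exists m : nat, 2 * M * B / (psi 0 / 2 * eta) / (A' / A - 1) < m%:R.
    by exists (Num.truncn (2 * M * B / (psi 0 / 2 * eta) / (A' / A - 1))).+1;
      rewrite truncnS_gt.
  exists m; have r1 : 0 < A' / A - 1 by lra.
  rewrite ltr_pdivrMr// in Hm; apply: lt_le_trans Hm _.
  have := @exprn_ge1Dxn _ _ m (ltW r1).
  by rewrite [1 + (_ - 1)]addrC subrK; lra.
have An : 0 < A ^+ n by rewrite exprn_gt0.
move: Hn; rewrite expr_div_n ltr_pdivlMr// mulrAC ltr_pdivrMr; last first.
  by rewrite mulr_gt0// divr_gt0.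
have := key n; lra.
Qed.

(* The product of the four functions h(c + i^j z) vanishes near the boundary of
   the square of half-side Re c - b, hence extends by zero to an entire
   function of compact support; its value at 0 is h(c)^4. *)
Lemma halfplane_reflect (R : realType) (h : R[i] -> R[i]) (b s : R) (c : R[i]) :
  (forall z, b < complex.Re z -> exists D, cdiff h z D) ->
  (forall z, s < complex.Re z -> h z = 0) ->
  (b + s) / 2 < complex.Re c -> h c = 0.
Proof.
move=> hd h0 bc; have [sc|cs] := ltP s (complex.Re c); first exact: h0.
pose rho := complex.Re c - b; pose d := s - complex.Re c.
have drho : d < rho by rewrite /d /rho; lra.
have d0 : 0 <= d by rewrite /d; lra.
(* The hypothesis on c says exactly d < rho. If |Re z| or |Im z| is at least M > d, one of the four
   rotated points has real part beyond s, so [G] vanishes; if both are below rho, all four points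
   have real part beyond b, so [G] is differentiable. The two regions overlap because M < rho. *)
pose M := (d + rho) / 2.
have dM : d < M by rewrite /M; lra.
have Mrho : M < rho by rewrite /M; lra.
have M0 : 0 < M by lra.
pose G z := h (c + 1 * z) * h (c + 'i * z) * (h (c + -1 * z) * h (c + - 'i * z)).
pose F z := if (`|complex.Re z| < rho) && (`|complex.Im z| < rho) then G z else 0.
have F0 z : M <= `|complex.Re z| \/ M <= `|complex.Im z| -> F z = 0.
  move=> hz; rewrite /F; case: ifP => // _; rewrite /G.
  have [z1|z1] := leP M (complex.Re z).
    by rewrite (h0 (c + 1 * z)) ?mul0r// !reimE/=; move: dM; rewrite /d; lra.
  have [z2|z2] := leP M (- complex.Re z).
    by rewrite (h0 (c + -1 * z)) ?(mul0r, mulr0)// !reimE/=; move: dM; rewrite /d; lra.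
  have [z3|z3] := leP M (- complex.Im z).
    by rewrite (h0 (c + 'i * z)) ?(mul0r, mulr0)// !reimE/=; move: dM; rewrite /d; lra.
  have [z4|z4] := leP M (complex.Im z).
    by rewrite (h0 (c + - 'i * z)) ?(mul0r, mulr0)// !reimE/=; move: dM; rewrite /d; lra.
  by exfalso; case: hz; rewrite leNgt ltr_norml; lra.
have i1 : cabs ('i : R[i]) = 1 by rewrite /cabs/= expr0n/= add0r expr1n sqrtr1.
have Gd z : `|complex.Re z| < rho -> `|complex.Im z| < rho -> exists D, cdiff G z D.
  rewrite !ltr_norml /rho => /andP[z1 z2] /andP[z3 z4].
  have [|D1 /(cdiff_affine (cabs1 _)) H1] := hd (c + 1 * z); first by rewrite !reimE/=; lra.
  have [|D2 /(cdiff_affine i1) H2] := hd (c + 'i * z); first by rewrite !reimE/=; lra.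
  have n1 : cabs (-1 : R[i]) = 1 by rewrite cabsN cabs1.
  have ni1 : cabs (- 'i : R[i]) = 1 by rewrite cabsN i1.
  have [|D3 /(cdiff_affine n1) H3] := hd (c + -1 * z); first by rewrite !reimE/=; lra.
  have [|D4 /(cdiff_affine ni1) H4] := hd (c + - 'i * z); first by rewrite !reimE/=; lra.
  by eexists; exact: cdiffM (cdiffM H1 H2) (cdiffM H3 H4).
have Fd z : exists D, cdiff F z D.
  have nr w : `|complex.Re w| <= `|complex.Re z| + cabs (w - z) /\
              `|complex.Im w| <= `|complex.Im z| + cabs (w - z).
    split; rewrite -lerBlDl; apply: le_trans (lerB_dist _ _) _.
      by rewrite -ReN -ReD; exact: le_Re_cabs.
    by rewrite -ImN -ImD; exact: le_Im_cabs.
  have rn w : `|complex.Re z| <= `|complex.Re w| + cabs (w - z) /\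
              `|complex.Im z| <= `|complex.Im w| + cabs (w - z).
    rewrite cabsC; split; rewrite -lerBlDl; apply: le_trans (lerB_dist _ _) _.
      by rewrite -ReN -ReD; exact: le_Re_cabs.
    by rewrite -ImN -ImD; exact: le_Im_cabs.
  have [/andP[z1 z2]|zn] :=
    boolP ((`|complex.Re z| < rho) && (`|complex.Im z| < rho)).
    have [D HD] := Gd z z1 z2; exists D.
    have r0 : 0 < Num.min (rho - `|complex.Re z|) (rho - `|complex.Im z|).
      by rewrite lt_min !subr_gt0 z1.
    apply: cdiff_near r0 _ HD => w; rewrite lt_min => /andP[w1 w2].
    by have [n1 n2] := nr w; rewrite /F ifT//; apply/andP; split; lra.
  exists 0; have r0 : 0 < rho - M by rewrite subr_gt0.
  apply: cdiff_near r0 _ (cdiff_cst 0 z) => w wz; rewrite F0//.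
  have [n1 n2] := rn w.
  by move: zn; rewrite negb_and -!leNgt => /orP[zr|zr]; [left|right]; lra.
have := cdiff_compact_support M0 Fd F0.
rewrite /F /= normr0 (lt_le_trans M0 (ltW Mrho)) /= /G !mulr0 addr0.
by move/eqP; rewrite !mulf_eq0 !orbb => /eqP.
Qed.

(** Each use of [halfplane_reflect] moves the boundary of the zero region from s to the midpoint of
    b and s; the remaining gap (s - b) / 2^n becomes smaller than Re z - b. *)
Theorem halfplane_identity (R : realType) (h : R[i] -> R[i]) (b s : R) :
  (forall z, b < complex.Re z -> exists D, cdiff h z D) ->
  (forall z, s < complex.Re z -> h z = 0) ->
  forall z, b < complex.Re z -> h z = 0.
Proof.
move=> hd h0 z bz.
have H n : forall w, b + (s - b) / 2 ^+ n < complex.Re w -> h w = 0.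
  elim: n => [|n IH] w; first by rewrite expr0 divr1 addrC subrK; exact: h0.
  move=> hw; apply: (halfplane_reflect hd IH).
  move: hw; rewrite exprS invfM; lra.
have [n hn] := pow2_gt ((s - b) / (complex.Re z - b)).
apply: (H n).
by rewrite -ltrBrDl ltr_pdivrMr ?exprn_gt0// mulrC -ltr_pdivrMr ?subr_gt0.
Qed.

(** * Taylor estimates for the complex exponential *)

Lemma norm_sin_le (R : realType) (x : R) : `|sin x| <= `|x|.
Proof.
wlog x0 : x / 0 <= x.
  move=> H; have [x0|x0] := leP 0 x; first exact: H.
  by rewrite -normrN -sinN -(normrN x); apply: H; lra.
have [c _] := @MVT_segment R sin cos 0 x x0
  (fun y _ => is_derive_sin y) (continuous_subspaceT (@continuous_sin R)).
rewrite sin0 !subr0 => ->; rewrite normrM.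
by rewrite ler_piMl// cos_max.
Qed.

Lemma one_sub_cos (R : realType) (x : R) : 1 - cos x = 2 * sin (x / 2) ^+ 2.
Proof.
rewrite {1}(_ : x = (x / 2) *+ 2); last by rewrite mulr2n; lra.
by rewrite cos_mulr2n cos2sin2; ring.
Qed.

Lemma norm_cosB1_le (R : realType) (x : R) : `|cos x - 1| <= x ^+ 2.
Proof.
rewrite distrC one_sub_cos normrM normrX ger0_norm//.
have := norm_sin_le (x / 2); set s := `|sin _| => h.
have s0 : 0 <= s by exact: normr_ge0.
rewrite -[x ^+ 2](real_normK (num_real x)).
rewrite normrM [`|2^-1|]ger0_norm// in h.
have := normr_ge0 x; nra.
Qed.

Lemma norm_sinB_le (R : realType) (x : R) : `|sin x - x| <= x ^+ 2.
Proof.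
wlog x0 : x / 0 <= x.
  move=> H; have [x0|x0] := leP 0 x; first exact: H.
  by have := H (- x); rewrite sinN -opprD normrN sqrrN; apply; lra.
have [c] := @MVT_segment R sin cos 0 x x0
  (fun y _ => is_derive_sin y) (continuous_subspaceT (@continuous_sin R)).
rewrite in_itv/= => /andP[c0 cx].
rewrite sin0 !subr0 => ->; rewrite -{2}[x]mul1r -mulrBl normrM (ger0_norm x0).
rewrite expr2 ler_wpM2r// distrC one_sub_cos normrM normrX ger0_norm//.
apply: (@le_trans _ _ (2 * `|sin (c / 2)|)).
  by rewrite ler_pM2l// expr2 ler_piMl// sin_max.
have := norm_sin_le (c / 2); rewrite [`|c / 2|]ger0_norm; lra.
Qed.

Lemma norm_expRB1_le (R : realType) (a : R) :
  `|expR a - 1| <= `|a| * expR `|a|.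
Proof.
have e1 : 1 <= expR `|a| by rewrite (le_trans _ (expR_ge1Dx _))// lerDl.
have [a0|a0] := leP 0 a.
  rewrite (ger0_norm a0) in e1 *; rewrite ger0_norm ?subr_ge0//.
  have := expR_ge1Dx (- a); have := expRxMexpNx_1 a; have := expR_gt0 a; nra.
rewrite (ltr0_norm a0) in e1 *; rewrite ltr0_norm ?subr_lt0 ?expR_lt1//.
have := expR_ge1Dx a; nra.
Qed.

Lemma norm_expRB1D_le (R : realType) (a : R) :
  `|expR a - 1 - a| <= a ^+ 2 * expR `|a|.
Proof.
rewrite ger0_norm; last by rewrite -addrA -opprD subr_ge0 expR_ge1Dx.
apply: (@le_trans _ _ (a * (expR a - 1))).
  have := expR_ge1Dx (- a); have := expRxMexpNx_1 a; have := expR_gt0 a; nra.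
apply: le_trans (ler_norm _) _; rewrite normrM -(real_normK (num_real a)).
by rewrite expr2 -mulrA ler_wpM2l// norm_expRB1_le.
Qed.

Lemma cexpD (R : realType) (z w : R[i]) : cexp (z + w) = cexp z * cexp w.
Proof.
by apply: eqC; rewrite !reimE /= expRD ?sinD ?cosD; ring.
Qed.

Lemma cexp0 (R : realType) : cexp (0 : R[i]) = 1.
Proof. by apply: eqC; rewrite !reimE /= expR0 cos0 sin0; ring. Qed.

Lemma cexp_real (R : realType) (x : R) : cexp x%:C = (expR x)%:C.
Proof. by apply: eqC; rewrite !reimE /= cos0 sin0; ring. Qed.

Lemma cabs_cexp (R : realType) (z : R[i]) : cabs (cexp z) = expR (complex.Re z).
Proof.
rewrite cabsM cabs_real ger0_norm ?expR_ge0//.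
by rewrite /cabs /= cos2Dsin2 sqrtr1 mulr1.
Qed.

(** The quadratic remainder used to differentiate y^(s-1) in s under the integral; real and
    imaginary parts account for 2 |z|^2 exp |z| each. *)
Lemma cexp_taylor2 (R : realType) (z : R[i]) :
  cabs (cexp z - 1 - z) <= 4 * cabs z ^+ 2 * expR (cabs z).
Proof.
case E : z => [a b]; rewrite -E; set r := cabs z.
have r0 : 0 <= r by exact: cabs_ge0.
have ar : `|a| <= r by have := le_Re_cabs z; rewrite {1}E.
have br : `|b| <= r by have := le_Im_cabs z; rewrite {1}E.
have ea : expR `|a| <= expR r by rewrite ler_expR.
have ea' : expR a <= expR r by rewrite ler_expR (le_trans (ler_norm _)).
have e0 := expR_gt0 r; have e0' := expR_gt0 a.
have sq (x : R) : `|x| <= r -> x ^+ 2 <= r ^+ 2.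
  by move=> xr; rewrite -(real_normK (num_real x)) lerXn2r ?nnegrE.
have a2 := sq _ ar; have b2 := sq _ br.
have r2 : 0 <= r ^+ 2 by rewrite sqr_ge0.
apply: le_trans (cabs_le_ReIm _) _; rewrite E /cexp !reimE /= !(mul0r, mulr0, subr0, addr0).
have h1 : `|expR a * cos b - 1 - a| <= 2 * r ^+ 2 * expR r.
  have -> : expR a * cos b - 1 - a = (expR a - 1 - a) + expR a * (cos b - 1) by ring.
  apply: le_trans (ler_normD _ _) _; rewrite normrM (ger0_norm (ltW e0')).
  have p1 : `|expR a - 1 - a| <= r ^+ 2 * expR r.
    by apply: le_trans (norm_expRB1D_le _) _; rewrite ler_pM ?sqr_ge0 ?expR_ge0.
  have p2 : expR a * `|cos b - 1| <= expR r * r ^+ 2.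
    by rewrite ler_pM ?expR_ge0// (le_trans (norm_cosB1_le _)).
  lra.
have h2 : `|expR a * sin b - 0 - b| <= 2 * r ^+ 2 * expR r.
  have -> : expR a * sin b - 0 - b = expR a * (sin b - b) + b * (expR a - 1) by ring.
  apply: le_trans (ler_normD _ _) _; rewrite !normrM (ger0_norm (ltW e0')).
  have p1 : `|b| * `|expR a - 1| <= r * (r * expR r).
    by rewrite ler_pM// (le_trans (norm_expRB1_le _))// ler_pM ?expR_ge0.
  have p2 : expR a * `|sin b - b| <= expR r * r ^+ 2.
    by rewrite ler_pM ?expR_ge0// (le_trans (norm_sinB_le _)).
  lra.
by move: h1 h2; rewrite ?subr0; lra.
Qed.

(** * Integrals and Mellin transforms of exponentially decaying functions *)

(** One class that contains F, the damped Bessel integrands and all dominating functions. It is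
    closed under the operations used below, so integrability is proved once. *)
Definition expdom (R : realType) (phi : R -> R) : Prop :=
  measurable_fun (`]0, +oo[ : set R) phi /\
  exists C b : R, 0 < b /\ forall y, 0 < y -> `|phi y| <= C * expR (- (b * y)).

Lemma integrable_expRN (R : realType) (b : R) : 0 < b ->
  (@lebesgue_measure R).-integrable `]0, +oo[ (EFin \o (fun y => expR (- (b * y)))).
Proof.
move=> b0; have I := integrable_exponential_pdf b0.
have I1 : (@lebesgue_measure R).-integrable `]0, +oo[ (EFin \o exponential_pdf b).
  exact: integrableS I.
have := @integrableZl _ _ R lebesgue_measure _ (measurable_itv _) b^-1 _ I1.
apply: eq_integrable => // y; rewrite inE/= in_itv/= andbT => y0.
by rewrite exponential_pdfE ?ltW// -EFinM mulrA mulVf ?gt_eqF// mul1r mulNr.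
Qed.

Lemma expdom_integrable (R : realType) (phi : R -> R) : expdom phi ->
  (@lebesgue_measure R).-integrable `]0, +oo[ (EFin \o phi).
Proof.
move=> [mphi [C [b [b0 H]]]].
have := @integrableZl _ _ R lebesgue_measure _ (measurable_itv _) C _ (integrable_expRN b0).
apply: le_integrable => //; first exact/measurable_EFinP.
move=> y; rewrite /= in_itv/= andbT => y0; rewrite lee_fin.
exact: le_trans (H y y0) (ler_norm _).
Qed.

Definition pint (R : realType) (phi : R -> R) : R :=
  \int[lebesgue_measure]_(t in `]0, +oo[) phi t.

Lemma expdomD (R : realType) (f g : R -> R) : expdom f -> expdom g ->
  expdom (fun y => f y + g y).
Proof.
move=> [mf [C [b [b0 H]]]] [mg [C' [b' [b0' H']]]]; split.
  exact: measurable_funD.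
exists (`|C| + `|C'|), (Num.min b b'); split; first by rewrite lt_min b0.
move=> y y0; apply: le_trans (ler_normD _ _) _; rewrite mulrDl; apply: lerD.
  apply: le_trans (H y y0) _; apply: le_trans (ler_wpM2r (expR_ge0 _) (ler_norm C)) _.
  by rewrite ler_wpM2l// ler_expR lerN2 ler_pM2r// ge_min lexx.
apply: le_trans (H' y y0) _; apply: le_trans (ler_wpM2r (expR_ge0 _) (ler_norm C')) _.
by rewrite ler_wpM2l// ler_expR lerN2 ler_pM2r// ge_min lexx orbT.
Qed.

Lemma expdomZ (R : realType) (k : R) (f : R -> R) : expdom f ->
  expdom (fun y => k * f y).
Proof.
move=> [mf [C [b [b0 H]]]]; split; first exact: measurable_funM.
exists (`|k| * C), b; split => // y y0.
by rewrite normrM -mulrA ler_wpM2l// H.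
Qed.

Lemma expdomB (R : realType) (f g : R -> R) : expdom f -> expdom g ->
  expdom (fun y => f y - g y).
Proof.
move=> ef /(expdomZ (-1)) eg; have := expdomD ef eg.
by under eq_fun do rewrite mulN1r.
Qed.

Lemma pintD (R : realType) (f g : R -> R) : expdom f -> expdom g ->
  pint (fun y => f y + g y) = pint f + pint g.
Proof. by move=> ef eg; rewrite /pint RintegralD//; exact: expdom_integrable. Qed.

Lemma pintB (R : realType) (f g : R -> R) : expdom f -> expdom g ->
  pint (fun y => f y - g y) = pint f - pint g.
Proof. by move=> ef eg; rewrite /pint RintegralB//; exact: expdom_integrable. Qed.

Lemma pintZ (R : realType) (k : R) (f : R -> R) : expdom f ->
  pint (fun y => k * f y) = k * pint f.
Proof. by move=> ef; rewrite /pint RintegralZl//; exact: expdom_integrable. Qed.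

Lemma eq_pint (R : realType) (f g : R -> R) :
  (forall y, 0 < y -> f y = g y) -> pint f = pint g.
Proof.
by move=> fg; apply: eq_Rintegral => y; rewrite inE/= in_itv/= andbT => /fg.
Qed.

Lemma le_pint (R : realType) (f g : R -> R) : expdom f -> expdom g ->
  (forall y, 0 < y -> f y <= g y) -> pint f <= pint g.
Proof.
move=> ef eg fg; apply: le_Rintegral => //; try exact: expdom_integrable.
by move=> y; rewrite /= in_itv/= andbT => /fg.
Qed.

Lemma norm_pint_le (R : realType) (f g : R -> R) : expdom f -> expdom g ->
  (forall y, 0 < y -> `|f y| <= g y) -> `|pint f| <= pint g.
Proof.
move=> ef eg fg; rewrite ler_norml -mulN1r -pintZ//.
have h y : 0 < y -> - g y <= f y <= g y by move=> /fg; rewrite ler_norml.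
apply/andP; split; apply: le_pint => //; try exact: expdomZ.
  by move=> y /h; rewrite mulN1r => /andP[].
by move=> y /h => /andP[].
Qed.

Lemma expdom_expRN (R : realType) (b : R) : 0 < b ->
  expdom (fun y : R => expR (- (b * y))).
Proof.
move=> b0; split.
  apply: measurable_funTS; apply: measurableT_comp => //.
  by apply: measurableT_comp => //; exact: measurable_funM.
by exists 1, b; split => // y y0; rewrite mul1r ger0_norm ?expR_ge0.
Qed.

Definition cdom (R : realType) (h : R -> R[i]) : Prop :=
  expdom (fun y => complex.Re (h y)) /\ expdom (fun y => complex.Im (h y)).

Definition cint (R : realType) (h : R -> R[i]) : R[i] :=
  complex_integral `]0, +oo[ h.

Lemma cdomB (R : realType) (f g : R -> R[i]) : cdom f -> cdom g ->
  cdom (fun y => f y - g y).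
Proof.
move=> [f1 f2] [g1 g2]; split.
  by under eq_fun do rewrite ReD ReN; exact: expdomB.
by under eq_fun do rewrite ImD ImN; exact: expdomB.
Qed.

Lemma cintB (R : realType) (f g : R -> R[i]) : cdom f -> cdom g ->
  cint (fun y => f y - g y) = cint f - cint g.
Proof.
move=> [f1 f2] [g1 g2]; apply: eqC; rewrite !reimE /= -/(pint _) -?pintB//;
by apply: eq_pint => y _; rewrite !reimE.
Qed.

Lemma cdomZ (R : realType) (k : R[i]) (f : R -> R[i]) : cdom f ->
  cdom (fun y => k * f y).
Proof.
move=> [f1 f2]; split.
  under eq_fun do rewrite ReM; apply: expdomB; exact: expdomZ.
under eq_fun do rewrite ImM; apply: expdomD; exact: expdomZ.
Qed.

Lemma cintZ (R : realType) (k : R[i]) (f : R -> R[i]) : cdom f ->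
  cint (fun y => k * f y) = k * cint f.
Proof.
move=> [f1 f2]; apply: eqC; rewrite !reimE /= -!/(pint _).
  rewrite -!pintZ// -pintB; try exact: expdomZ.
  by apply: eq_pint => y _; rewrite ReM.
rewrite -!pintZ// -pintD; try exact: expdomZ.
by apply: eq_pint => y _; rewrite ImM.
Qed.

(** The factor 2 comes from treating real and imaginary parts separately; only finiteness of the
    bound matters later. *)
Lemma cabs_cint_le (R : realType) (f : R -> R[i]) (g : R -> R) :
  cdom f -> expdom g -> (forall y, 0 < y -> cabs (f y) <= g y) ->
  cabs (cint f) <= 2 * pint g.
Proof.
move=> [f1 f2] eg fg; apply: le_trans (cabs_le_ReIm _) _.
rewrite mulr2n mulrDl !mul1r; apply: lerD; rewrite /= -/(pint _); apply: norm_pint_le => //.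
  by move=> y /fg; apply: le_trans; exact: le_Re_cabs.
by move=> y /fg; apply: le_trans; exact: le_Im_cabs.
Qed.

(** The left side is max(1, y)^(2p): constant near 0 and of polynomial growth at infinity, hence
    absorbed by any exponential. *)
Lemma exp_ln_growth (R : realType) (p b : R) : 0 < p -> 0 < b ->
  exists2 K : R, 0 < K &
    forall y, 0 < y -> expR (p * (ln y + `|ln y|)) <= K * expR (b * y).
Proof.
(* With this [c], the inequality ln (y/c) <= y/c multiplied by 2p reads 2p ln y <= b y + 2p ln c. *)
move=> p0 b0; pose c := 2 * p / b.
have c0 : 0 < c by rewrite divr_gt0// mulr_gt0.
exists (1 + expR (2 * p * ln c)); first by rewrite ltr_wpDr ?expR_ge0.
move=> y y0; have e1 : 1 <= expR (b * y).
  by rewrite (le_trans _ (expR_ge1Dx _))// lerDl mulr_ge0 ?ltW.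
have [ly|ly] := leP (ln y) 0.
  rewrite ler0_norm// subrr mulr0 expR0.
  have := expR_ge0 (2 * p * ln c); nra.
rewrite gtr0_norm//; apply: (@le_trans _ _ (expR (2 * p * ln c) * expR (b * y))).
  rewrite -expRD ler_expR.
  have : ln (y / c) <= y / c by rewrite ltW// ln_sublinear// divr_gt0.
  rewrite ln_div ?posrE// lerBlDr => h.
  have : 2 * p * ln y <= 2 * p * (y / c + ln c) by rewrite ler_pM2l// mulr_gt0.
  have -> : 2 * p * (y / c + ln c) = b * y + 2 * p * ln c.
    by rewrite /c; field; rewrite !gt_eqF.
  lra.
by rewrite ler_wpM2r ?expR_ge0// lerDr.
Qed.

(** Half of the decay exp(-b y) pays for the growth of the kernel; the other half remains. *)
Lemma kernel_cdom (R : realType) (phi : R -> R) (k : R -> R[i]) (p K : R) :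
  expdom phi ->
  measurable_fun (`]0, +oo[ : set R) (fun y => complex.Re (k y)) ->
  measurable_fun (`]0, +oo[ : set R) (fun y => complex.Im (k y)) ->
  0 < p ->
  (forall y, 0 < y -> cabs (k y) <= K * expR (p * (ln y + `|ln y|))) ->
  cdom (fun y => (phi y)%:C * k y).
Proof.
move=> [mphi [C [b [b0 H]]]] mr mi p0 Hk.
have b2 : 0 < b / 2 by rewrite divr_gt0.
have [L L0 HL] := exp_ln_growth p0 b2.
have dom y : 0 < y -> cabs ((phi y)%:C * k y) <=
    `|C| * (`|K| * L) * expR (- (b / 2 * y)).
  move=> y0; rewrite cabsM cabs_real.
  apply: (@le_trans _ _ (`|C| * expR (- (b * y)) *
      (`|K| * (L * expR (b / 2 * y))))).
    apply: ler_pM; rewrite ?cabs_ge0//.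
      by apply: le_trans (H y y0) _; rewrite ler_wpM2r ?expR_ge0 ?ler_norm.
    apply: le_trans (Hk y y0) _.
    apply: le_trans (ler_wpM2r (expR_ge0 _) (ler_norm K)) _.
    by rewrite ler_wpM2l// HL.
  have -> : - (b / 2 * y) = - (b * y) + b / 2 * y by lra.
  rewrite expRD; lra.
split; split.
- have -> : (fun y => complex.Re ((phi y)%:C * k y)) =
      (fun y => phi y * complex.Re (k y)).
    by apply/funext => y; rewrite ReM mul0r subr0.
  exact: measurable_funM.
- exists (`|C| * (`|K| * L)), (b / 2); split => // y y0.
  by apply: le_trans (le_Re_cabs _) _; exact: dom.
- have -> : (fun y => complex.Im ((phi y)%:C * k y)) =
      (fun y => phi y * complex.Im (k y)).
    by apply/funext => y; rewrite ImM mul0r addr0.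
  exact: measurable_funM.
- exists (`|C| * (`|K| * L)), (b / 2); split => // y y0.
  by apply: le_trans (le_Im_cabs _) _; exact: dom.
Qed.

(** * Mellin transforms and their holomorphy *)

Definition mellin (R : realType) (phi : R -> R) (s : R[i]) : R[i] :=
  cint (fun y => (phi y)%:C * cpow y (s - 1)).

Lemma cabs_cpow (R : realType) (y : R) (s : R[i]) :
  cabs (cpow y s) = expR (complex.Re s * ln y).
Proof. by rewrite cabs_cexp ReM /= mulr0 subr0. Qed.

Lemma Re_cpow (R : realType) (y : R) (s : R[i]) :
  complex.Re (cpow y s) =
  expR (complex.Re s * ln y) * cos (complex.Im s * ln y).
Proof. by rewrite /cpow /cexp !reimE /= !mul0r !mulr0 !subr0 !add0r. Qed.

Lemma Im_cpow (R : realType) (y : R) (s : R[i]) :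
  complex.Im (cpow y s) =
  expR (complex.Re s * ln y) * sin (complex.Im s * ln y).
Proof. by rewrite /cpow /cexp !reimE /= !mul0r !mulr0 !subr0 !add0r ?addr0. Qed.

Lemma measurable_cpow (R : realType) (s : R[i]) (D : set R) :
  measurable D ->
  measurable_fun D (fun y => complex.Re (cpow y s)) /\
  measurable_fun D (fun y => complex.Im (cpow y s)).
Proof.
move=> mD; have mln (x : R) : measurable_fun D (fun y => x * ln y).
  by apply: measurable_funM => //; apply: measurable_funTS; exact: measurable_ln.
have me (x : R) : measurable_fun D (fun y => expR (x * ln y)).
  exact: (measurableT_comp (@measurable_expR R) (mln x)).
split.
  rewrite (funext (fun y => Re_cpow y s)); apply: measurable_funM => //.
  exact: (measurableT_comp (continuous_measurable_fun (@continuous_cos R)) (mln _)).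
rewrite (funext (fun y => Im_cpow y s)); apply: measurable_funM => //.
exact: (measurableT_comp (continuous_measurable_fun (@continuous_sin R)) (mln _)).
Qed.

Lemma cpowD (R : realType) (y : R) (s t : R[i]) :
  cpow y (s + t) = cpow y s * cpow y t.
Proof. by rewrite /cpow mulrDl cexpD. Qed.

(** Applied to x = ln y: squares of logarithms cost an arbitrarily small power of y or 1/y. *)
Lemma sqr_le_expR (R : realType) (x d : R) : 0 < d ->
  x ^+ 2 <= 2 / d ^+ 2 * expR (d * `|x|).
Proof.
move=> d0; have dx : 0 <= d * `|x| by rewrite mulr_ge0// ltW.
have := expR_ge1Dxn 1 dx; rewrite exprMn real_normK ?num_real//.
rewrite (_ : 2`!%:R = 2 :> R)// => h.
rewrite mulrAC ler_pdivlMr ?exprn_gt0//; lra.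
Qed.

Lemma mellin_cdom (R : realType) (phi : R -> R) (s : R[i]) :
  expdom phi -> 1 < complex.Re s ->
  cdom (fun y => (phi y)%:C * cpow y (s - 1)).
Proof.
move=> ephi s1; have [m1 m2] := measurable_cpow (s - 1) (measurable_itv `]0, +oo[).
apply: (kernel_cdom (p := complex.Re s - 1) (K := 1)) => //; first by lra.
move=> y y0; rewrite cabs_cpow !reimE /= mul1r ler_expR ler_wpM2l ?lerDl//; lra.
Qed.

(** Differentiation under the integral: [k1] is the s-derivative of the kernel, and the remainder is
    at most |w - s|^2 times a fixed integral [B]. *)
Lemma mellin_cdiff (R : realType) (phi : R -> R) (s : R[i]) :
  expdom phi -> 1 < complex.Re s -> exists D, cdiff (mellin phi) s D.
Proof.
(* Half the distance to the line Re s = 1. The remainder costs exp(d |ln y|) once for the square of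
   the logarithm and once for the exponential; together with y^(Re s - 1) this is the left side of
   [exp_ln_growth] with p = Re s - 1. *)
move=> ephi s1; pose d := (complex.Re s - 1) / 2.
have d0 : 0 < d by rewrite divr_gt0// subr_gt0.
have s2 : 0 < complex.Re s - 1 by lra.
have [m1 m2] := measurable_cpow (s - 1) (measurable_itv `]0, +oo[).
have mln : measurable_fun (`]0, +oo[ : set R) (@ln R).
  by apply: measurable_funTS; exact: measurable_ln.
pose k1 y := (ln y)%:C * cpow y (s - 1).
have dk1 : cdom (fun y => (phi y)%:C * k1 y).
  apply: (kernel_cdom (p := complex.Re s - 1) (K := d^-1)) => //.
  - have -> : (fun y => complex.Re (k1 y)) =
        (fun y => ln y * complex.Re (cpow y (s - 1))).
      by apply/funext => y; rewrite ReM mul0r subr0.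
    exact: measurable_funM.
  - have -> : (fun y => complex.Im (k1 y)) =
        (fun y => ln y * complex.Im (cpow y (s - 1))).
      by apply/funext => y; rewrite ImM mul0r addr0.
    exact: measurable_funM.
  move=> y y0; rewrite cabsM cabs_real cabs_cpow !reimE /=.
  have h : `|ln y| <= d^-1 * expR (d * `|ln y|).
    rewrite ler_pdivlMl//; apply: le_trans (expR_ge1Dx _); lra.
  apply: le_trans (ler_wpM2r (expR_ge0 _) h) _.
  rewrite -mulrA -expRD ler_pM2l ?invr_gt0// ler_expR.
  by rewrite mulrDr addrC lerD2l ler_wpM2r// /d; lra.
have [_ [C [b [b0 Hphi]]]] := ephi.
have b2 : 0 < b / 2 by rewrite divr_gt0.
have [L L0 HL] := exp_ln_growth s2 b2.
pose A := `|C| * (4 * (2 / d ^+ 2) * L).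
have A0 : 0 <= A.
  by rewrite mulr_ge0// mulr_ge0 ?(ltW L0)// mulr_ge0// divr_ge0// exprn_ge0// ltW.
have ekey := expdomZ A (expdom_expRN b2).
pose B := 2 * pint (fun y => A * expR (- (b / 2 * y))).
have key w : cabs (w - s) < d ->
    cabs (mellin phi w - mellin phi s - cint (fun y => (phi y)%:C * k1 y) * (w - s))
    <= cabs (w - s) ^+ 2 * B.
  move=> wd; set h := w - s.
  have w1 : 1 < complex.Re w.
    have := le_trans (le_Re_cabs _) (ltW wd); rewrite !reimE ler_norml => /andP[].
    by rewrite /d; lra.
  have dw := mellin_cdom ephi w1; have ds := mellin_cdom ephi s1.
  rewrite mulrC /mellin -cintB// -cintZ// -cintB; [|exact: cdomB|exact: cdomZ].
  have -> : cabs h ^+ 2 * B = 2 * pint (fun y => cabs h ^+ 2 * (A * expR (- (b / 2 * y)))).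
    by rewrite pintZ//; rewrite /B; ring.
  apply: cabs_cint_le; [|exact: expdomZ|].
    by apply: cdomB; [exact: cdomB|exact: cdomZ].
  move=> y y0.
  have -> : (phi y)%:C * cpow y (w - 1) - (phi y)%:C * cpow y (s - 1) -
      h * ((phi y)%:C * k1 y) = (phi y)%:C * (cpow y (s - 1) *
      (cpow y h - 1 - h * (ln y)%:C)).
    have -> : w - 1 = (s - 1) + h by rewrite /h; ring.
    by rewrite cpowD /k1; ring.
  rewrite cabsM cabs_real cabsM cabs_cpow !reimE /=.
  have h1 := cexp_taylor2 (h * (ln y)%:C).
  rewrite cabsM cabs_real in h1.
  have h2 : cabs (cpow y h - 1 - h * (ln y)%:C) <=
      cabs h ^+ 2 * (4 * (2 / d ^+ 2)) * expR ((complex.Re s - 1) * `|ln y|).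
    apply: le_trans h1 _; rewrite exprMn real_normK ?num_real//.
    have e1 : expR (cabs h * `|ln y|) <= expR (d * `|ln y|).
      by rewrite ler_expR ler_wpM2r// ltW.
    have e2 := sqr_le_expR (ln y) d0.
    have -> : (complex.Re s - 1) * `|ln y| = d * `|ln y| + d * `|ln y|.
      by rewrite /d; lra.
    rewrite expRD; set E := expR (d * _) in e1 e2 *; set E' := expR _ in e1 *.
    have -> : 4 * (cabs h ^+ 2 * ln y ^+ 2) * E' =
      cabs h ^+ 2 * 4 * (ln y ^+ 2 * E') by ring.
    have -> : cabs h ^+ 2 * (4 * (2 / d ^+ 2)) * (E * E) =
      cabs h ^+ 2 * 4 * (2 / d ^+ 2 * E * E) by ring.
    apply: ler_wpM2l; first by rewrite mulr_ge0// sqr_ge0.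
    by apply: ler_pM => //; [exact: sqr_ge0|exact: expR_ge0].
  have h3 : expR ((complex.Re s - 1) * ln y) * cabs (cpow y h - 1 - h * (ln y)%:C)
      <= cabs h ^+ 2 * (4 * (2 / d ^+ 2)) * (L * expR (b / 2 * y)).
    apply: le_trans (ler_wpM2l (expR_ge0 _) h2) _.
    rewrite mulrCA; apply: ler_wpM2l.
      by rewrite mulr_ge0 ?sqr_ge0// mulr_ge0// divr_ge0// sqr_ge0.
    by rewrite -expRD -mulrDr; exact: HL.
  have h4 : `|phi y| <= `|C| * expR (- (b * y)).
    by apply: le_trans (Hphi y y0) _; rewrite ler_wpM2r ?expR_ge0 ?ler_norm.
  apply: le_trans (ler_pM _ _ h4 h3) _ => //.
    by rewrite mulr_ge0 ?expR_ge0 ?cabs_ge0.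
  have -> : - (b / 2 * y) = - (b * y) + b / 2 * y by lra.
  rewrite expRD /A le_eqVlt; apply/orP; left; apply/eqP; ring.
have B0 : 0 <= B.
  by rewrite mulr_ge0// Rintegral_ge0// => y _; rewrite mulr_ge0 ?expR_ge0.
exists (cint (fun y => (phi y)%:C * k1 y)) => e e0.
exists (Num.min d (e / (B + 1))); first by rewrite lt_min d0 divr_gt0// ltr_wpDl.
move=> w; rewrite lt_min => /andP[/key wd]; rewrite ltr_pdivlMr ?ltr_wpDl// => we.
apply: le_trans wd _; rewrite expr2 -mulrA mulrC; apply: ler_wpM2r; first exact: cabs_ge0.
apply: le_trans (ltW we); rewrite ler_wpM2l ?cabs_ge0// lerDl//.
Qed.

(** * Coefficients of a power series and of its square *)

Lemma geometric_sum_le (R : realType) (r : R) N : 0 <= r -> r < 1 ->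
  \sum_(0 <= n < N) r ^+ n <= (1 - r)^-1.
Proof.
move=> r0 r1; have r2 : 0 < 1 - r by rewrite subr_gt0.
rewrite -[leRHS]mul1r ler_pdivlMr// mulrC.
have -> : (1 - r) * \sum_(0 <= n < N) r ^+ n = 1 - r ^+ N.
  by rewrite big_mkord -[1 - r ^+ N]opprB subrX1 -mulNr opprB.
by rewrite gerBl exprn_ge0.
Qed.

(** Abel's argument: convergence at t between x and 1 bounds the terms u n t^n, and a geometric
    series of ratio x/t dominates the rest. *)
Lemma powser_abs_bounded (R : realType) (u : nat -> R) (x : R) :
  (forall x, 0 < x < 1 -> cvgn (fun N => \sum_(0 <= n < N) u n * x ^+ n)) ->
  0 < x < 1 -> exists S, forall N, \sum_(0 <= n < N) `|u n| * x ^+ n <= S.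
Proof.
move=> cu /andP[x0 x1]; pose t := (1 + x) / 2.
have t1 : t < 1 by rewrite /t; lra.
have xt : x < t by rewrite /t; lra.
have t0 : 0 < t by lra.
have /cu ct : 0 < t < 1 by rewrite t0.
have /cvgP/cvg_seq_bounded/pinfty_ex_gt0[B B0 HB] :=
  cvg_series_cvg_0 (ct : cvgn (series (fun n => u n * t ^+ n : R^o))).
exists (B * (1 - x / t)^-1) => N.
have r0 : 0 <= x / t by rewrite divr_ge0// ltW.
have r1 : x / t < 1 by rewrite ltr_pdivrMr// mul1r.
apply: le_trans (ler_wpM2l (ltW B0) (geometric_sum_le N r0 r1)).
rewrite mulr_sumr; apply: ler_sum => n _.
have := HB n I; rewrite /= normrM (ger0_norm (exprn_ge0 _ (ltW t0))) => h.
rewrite expr_div_n mulrA ler_pdivlMr ?exprn_gt0// mulrAC.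
by rewrite ler_wpM2r// exprn_ge0// ltW.
Qed.

(** By strong induction the series starts at u n x^n, and its tail is at most S (2x)^(n+1), by
    absolute convergence at 1/2. So |u n| is at most a constant times x for every small x. *)
Lemma powser_eq0 (R : realType) (u : nat -> R) :
  (forall x : R, 0 < x < 1 -> (fun N => \sum_(0 <= n < N) u n * x ^+ n) @ \oo --> (0 : R)) ->
  forall n, u n = 0.
Proof.
move=> H; have [S HS] : exists S, forall N, \sum_(0 <= n < N) `|u n| * 2^-1 ^+ n <= S.
  by apply: powser_abs_bounded; [move=> x /H/cvgP|lra].
have S0 : 0 <= S by have := HS 0%N; rewrite big_geq.
elim/ltn_ind => n IH.
have key (x : R) : 0 < x < 2^-1 -> `|u n| <= S * 2 ^+ n.+1 * x.
  move=> /andP[x0 x2]; have x1 : 0 < x < 1 by lra.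
  suff : `|u n * x ^+ n| <= S * (2 * x) ^+ n.+1.
    rewrite normrM (ger0_norm (exprn_ge0 _ (ltW x0))) exprMn.
    by rewrite [x ^+ n.+1]exprS !mulrA ler_pM2r ?exprn_gt0.
  have dist N : (n < N)%N -> `|u n * x ^+ n - \sum_(0 <= k < N) u k * x ^+ k|
      <= S * (2 * x) ^+ n.+1.
    move=> nN; rewrite (big_cat_nat (n := n.+1)) //= big_nat_recr//=.
    rewrite big1_seq ?add0r; last first.
      by move=> k; rewrite mem_index_iota => /= kn; rewrite IH ?mul0r.
    rewrite opprD addNKr normrN; apply: le_trans (ler_norm_sum _ _ _) _.
    have p0 : 0 <= (2 * x) ^+ n.+1 by rewrite exprn_ge0// mulr_ge0// ltW.
    apply: le_trans (ler_wpM2r p0 (HS N)); rewrite mulr_suml.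
    rewrite [leRHS](big_cat_nat (n := n.+1))//=.
    apply: ler_wpDl.
      by apply: sumr_ge0 => k _; rewrite !mulr_ge0// exprn_ge0.
    rewrite big_nat [leRHS]big_nat; apply: ler_sum => k /andP[nk _].
    rewrite normrM (ger0_norm (exprn_ge0 _ (ltW x0))) -mulrA ler_wpM2l//.
    rewrite {1}(_ : x = 2^-1 * (2 * x)); last by lra.
    rewrite exprMn ler_wpM2l ?exprn_ge0//.
    by apply: ler_wiXn2l => //; lra.
  have c1 : (fun N => `|u n * x ^+ n - \sum_(0 <= k < N) u k * x ^+ k|) @ \oo
      --> `|u n * x ^+ n - 0|.
    by apply: cvg_norm; apply: cvgB; [exact: cvg_cst|exact: H].
  rewrite subr0 in c1.
  apply: (cvgr_to_le c1); exists n.+1 => // N /= nN; exact: dist.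
apply/eqP; rewrite -normr_eq0 eq_le normr_ge0 andbT leNgt; apply/negP => un0.
pose B := S * 2 ^+ n.+1 + 1.
have B0 : 0 < B by rewrite ltr_wpDl// mulr_ge0// exprn_ge0.
pose x := Num.min (4^-1) (`|u n| / (2 * B)).
have x0 : 0 < x by rewrite lt_min divr_gt0 ?mulr_gt0// andbT; lra.
have x2 : x < 2^-1 by rewrite gt_min; apply/orP; left; lra.
have xu : B * x <= `|u n| / 2.
  have : x <= `|u n| / (2 * B) by rewrite ge_min lexx orbT.
  rewrite invfM mulrA ler_pdivlMr//; lra.
have := key x; rewrite x0 x2 => /(_ isT).
by move: xu; rewrite /B; lra.
Qed.

(** * Squares of partial sums against Cauchy products *)

Lemma sum_triangle (K : comNzRingType) (x : nat -> K) (T : nat) :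
  \sum_(0 <= n < T) \sum_(0 <= i < n.+1) x i * x (n - i)%N =
  \sum_(0 <= i < T) \sum_(0 <= j < T - i) x i * x j.
Proof.
elim: T => [|T IH]; first by rewrite !big_geq.
rewrite big_nat_recr//= IH [RHS]big_nat_recr//= subSnn big_nat1.
rewrite [X in _ + X]big_nat_recr//= subnn addrA; congr (_ + _).
rewrite -big_split/= big_nat [RHS]big_nat; apply: eq_bigr => i /andP[_ iT].
by rewrite subSn ?big_nat_recr// ltnW.
Qed.

Lemma triangle_defectE (K : comNzRingType) (x : nat -> K) (T : nat) :
  (\sum_(0 <= i < T) x i) ^+ 2 -
  \sum_(0 <= n < T) \sum_(0 <= i < n.+1) x i * x (n - i)%N =
  \sum_(0 <= i < T) \sum_(T - i <= j < T) x i * x j.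
Proof.
apply/eqP; rewrite subr_eq sum_triangle; apply/eqP.
rewrite expr2 mulr_suml -big_split/=; apply: eq_bigr => i _.
by rewrite mulr_sumr addrC -big_cat_nat// leq_subr.
Qed.

(** The defect is a plain sum of products over the pairs i, j < T with i + j >= T, so moduli
    dominate it term by term. For x n = c n z^n the right side depends on |z| only. *)
Lemma cabs_triangle_defect (R : realType) (x : nat -> R[i]) (T : nat) :
  cabs ((\sum_(0 <= i < T) x i) ^+ 2 -
        \sum_(0 <= n < T) \sum_(0 <= i < n.+1) x i * x (n - i)%N) <=
  (\sum_(0 <= i < T) cabs (x i)) ^+ 2 -
  \sum_(0 <= n < T) \sum_(0 <= i < n.+1) cabs (x i) * cabs (x (n - i)%N).
Proof.
rewrite triangle_defectE (triangle_defectE (fun i => cabs (x i))).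
apply: le_trans (cabs_sum _ _ _) _; apply: ler_sum => i _.
apply: le_trans (cabs_sum _ _ _) _; apply: ler_sum => j _.
by rewrite cabsM.
Qed.

(** The square of side T/2 fits inside the triangle i + j < T. *)
Lemma half_sqr_le_triangle (R : realType) (x : nat -> R) (T : nat) :
  (forall i, 0 <= x i) ->
  (\sum_(0 <= i < T./2) x i) ^+ 2 <=
  \sum_(0 <= n < T) \sum_(0 <= i < n.+1) x i * x (n - i)%N.
Proof.
move=> x0; have hT : (T./2 <= T)%N by rewrite -[leqRHS]odd_double_half -addnn addnA leq_addl.
rewrite sum_triangle [leRHS](big_cat_nat (n := T./2))//= expr2 mulr_suml.
apply: ler_wpDr.
  by apply: sumr_ge0 => i _; apply: sumr_ge0 => j _; rewrite mulr_ge0.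
apply: ler_sum_nat => i /andP[_ iT].
have h2 : (T./2 <= T - i)%N.
  rewrite leq_subRL; last exact: leq_trans (ltnW iT) hT.
  apply: leq_trans (leq_add (ltnW iT) (leqnn _)) _.
  by rewrite addnn -{2}(odd_double_half T) leq_addl.
rewrite mulr_sumr [leRHS](big_cat_nat (n := T./2))//=.
by apply: ler_wpDr => //; apply: sumr_ge0 => j _; rewrite mulr_ge0.
Qed.

(** The defect lies between 0 and P(T)^2 - P(T/2)^2, where P denotes the convergent partial sums. *)
Lemma triangle_defect_cvg (R : realType) (x : nat -> R) (S : R) :
  (forall i, 0 <= x i) -> (forall N, \sum_(0 <= i < N) x i <= S) ->
  (fun T => (\sum_(0 <= i < T) x i) ^+ 2 -
     \sum_(0 <= n < T) \sum_(0 <= i < n.+1) x i * x (n - i)%N) @ \oo --> (0 : R).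
Proof.
move=> x0 xS; pose P T := \sum_(0 <= i < T) x i.
have ndP : nondecreasing_seq P.
  apply/nondecreasing_seqP => n; by rewrite /P big_nat_recr//= lerDl.
have cP : cvgn P.
  by apply: nondecreasing_is_cvgn => //; exists S => _ [n _ <-]; exact: xS.
have P0 T : 0 <= P T by exact: sumr_ge0.
have c2 : (fun T => P T ^+ 2 - P T./2 ^+ 2) @ \oo --> (0 : R).
  have h : (fun T => P T./2) @ \oo --> limn P.
    apply: (cvg_comp (fun T => T./2) P _ cP).
    move=> A [N _ NA]; exists N.*2 => // n /= Nn; apply: NA => /=.
    by rewrite -(doubleK N) half_leq.
  rewrite -(subrr (limn P ^+ 2)); apply: cvgB.
    by rewrite expr2; under eq_fun do rewrite expr2; exact: cvgM.
  by rewrite expr2; under eq_fun do rewrite expr2; exact: cvgM.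
apply: (squeeze_cvgr _ (cvg_cst _) c2); apply: nearW => T; apply/andP; split.
  rewrite triangle_defectE.
  by apply: sumr_ge0 => i _; apply: sumr_ge0 => j _; rewrite mulr_ge0.
by rewrite lerD2l lerN2; exact: half_sqr_le_triangle.
Qed.

Lemma cexp_iX (R : realType) (t : R) n :
  cexp (0 +i* t) ^+ n = cexp (0 +i* (n%:R * t)).
Proof.
elim: n => [|n IH]; first by rewrite expr0 mul0r cexp0.
rewrite exprS IH -cexpD; congr cexp; apply: eqC; rewrite !reimE /=; first by rewrite addr0.
by rewrite -natr1; ring.
Qed.

Lemma cexp_i_eq1 (R : realType) (t : R) : 0 < t < 2 * pi -> cexp (0 +i* t) != 1.
Proof.
move=> /andP[t0 t2]; apply/eqP => /(congr1 (@complex.Re R)).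
rewrite /cexp ReM /= expR0 mul1r mul0r subr0 => c1.
have := one_sub_cos t; rewrite c1 subrr => /esym/eqP.
rewrite mulf_eq0 (negPf (lt0r_neq0 _))//= sqrf_eq0 gt_eqF// sin_gt0_pi//.
by apply/andP; split; lra.
Qed.

Lemma root_unity_sum (K : idomainType) (z : K) (T : nat) :
  z ^+ T = 1 -> z != 1 -> \sum_(j < T) z ^+ j = 0.
Proof.
move=> zT z1; apply/eqP; have := subrX1 z T; rewrite zT subrr.
by move/esym/eqP; rewrite mulf_eq0 subr_eq0 (negPf z1).
Qed.

(* Averaging the values of a polynomial of degree less than T over the T-th
   roots of unity, twisted by a character, isolates one coefficient. *)
Lemma cauchy_coef_bound (R : realType) (p : nat -> R[i]) (T m : nat) (rho M : R) :
  (m < T)%N -> 0 <= rho ->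
  (forall z, cabs z = rho -> cabs (\sum_(0 <= n < T) p n * z ^+ n) <= M) ->
  cabs (p m) * rho ^+ m <= M.
Proof.
move=> mT rho0 H; have T0 : (0 < T)%N by exact: leq_ltn_trans mT.
have T0r : 0 < T%:R :> R by rewrite ltr0n.
pose w := cexp (0 +i* (2 * pi / T%:R : R)).
have wX k : w ^+ k = cexp (0 +i* (k%:R * (2 * pi / T%:R))) by exact: cexp_iX.
have wT : w ^+ T = 1.
  rewrite wX; have -> : T%:R * (2 * pi / T%:R) = pi *+ 2 :> R.
    by rewrite mulr2n; field; rewrite gt_eqF.
  by apply: eqC; rewrite /cexp !reimE /= cos2pi sin2pi expR0; ring.
have w1 k : (0 < k < T)%N -> w ^+ k != 1.
  move=> /andP[k0 kT]; rewrite wX; apply: cexp_i_eq1.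
  have p0 := pi_gt0 R.
  rewrite mulr_gt0 ?ltr0n ?divr_gt0 ?mulr_gt0//=.
  rewrite mulrA ltr_pdivrMr// mulrC ltr_pM2l ?mulr_gt0//.
  by rewrite ltr_nat.
have nw j : cabs (w ^+ j) = 1 by rewrite wX cabs_cexp expR0.
(* The exponent T - m stands for -m, since w^T = 1. *)
have key : \sum_(j < T) (\sum_(0 <= n < T) p n * (rho%:C * w ^+ j) ^+ n) *
    w ^+ j ^+ (T - m) = T%:R * (p m * rho%:C ^+ m).
  under eq_bigr do rewrite mulr_suml.
  rewrite exchange_big/=.
  rewrite (eq_bigr (fun n => (p n * rho%:C ^+ n) *
      \sum_(j < T) (w ^+ (n + (T - m))) ^+ j)); last first.
    move=> n _; rewrite mulr_sumr; apply: eq_bigr => j _.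
    by rewrite exprMn -!mulrA -exprD -!exprM [(j * _)%N]mulnC.
  rewrite big_mkord (bigD1 (Ordinal mT))//= [X in _ + X]big1; last first.
    move=> n nm; rewrite root_unity_sum ?mulr0//.
      by rewrite -exprM mulnC exprM wT expr1n.
    have nm' : (n != m :> nat) by apply: contra nm => /eqP nm; exact/eqP/val_inj.
    have nT := ltn_ord n.
    have [nlm|mln] := ltnP n m.
      by apply: w1; apply/andP; split; lia.
    have -> : (n + (T - m))%N = (T + (n - m))%N by lia.
    by rewrite exprD wT mul1r; apply: w1; apply/andP; split; lia.
  rewrite addr0 subnKC ?(ltnW mT)// wT.
  rewrite (eq_bigr (fun=> 1)); last by move=> j _; rewrite expr1n.
  by rewrite sumr_const card_ord mulrC.
have := congr1 (@cabs R) key; rewrite !cabsM cabsX cabs_real (ger0_norm rho0).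
have -> : cabs (T%:R : R[i]) = T%:R by rewrite -(rmorph_nat (real_complex R)) cabs_real normr_nat.
move=> E; rewrite -(ler_pM2l T0r) -E.
apply: le_trans (cabs_sum _ _ _) _.
apply: (@le_trans _ _ (\sum_(j < T) M)); last by rewrite sumr_const card_ord mulr_natl.
apply: ler_sum => j _; rewrite cabsM cabsX nw expr1n mulr1; apply: H.
by rewrite cabsM nw cabs_real ger0_norm// mulr1.
Qed.

(* A truncation of (sum c_n z^n)^2 differs from the truncated Cauchy product by
   at most the defect, which tends to 0; Cauchy's estimate then applies to the
   truncation. *)
Lemma sqrt_coef_bound (R : realType) (c : nat -> R) (rho S S' : R) (m : nat) :
  0 <= rho -> (forall N, \sum_(0 <= n < N) `|c n| * rho ^+ n <= S') ->
  (forall N, \sum_(0 <= n < N)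
     `|\sum_(0 <= i < n.+1) c i * c (n - i)%N| * rho ^+ n <= S) ->
  (`|c m| * rho ^+ m) ^+ 2 <= S.
Proof.
move=> rho0 HS' HS.
pose defect T := (\sum_(0 <= i < T) `|c i| * rho ^+ i) ^+ 2 -
  \sum_(0 <= n < T) \sum_(0 <= i < n.+1)
     (`|c i| * rho ^+ i) * (`|c (n - i)%N| * rho ^+ (n - i)).
have key T : (m < T)%N -> (`|c m| * rho ^+ m) ^+ 2 <= defect T + S.
  move=> mT.
  have H z : cabs z = rho ->
      cabs (\sum_(0 <= n < T) (c n)%:C * z ^+ n) ^+ 2 <= defect T + S.
    move=> zr; rewrite -cabsX.
    pose x n := (c n)%:C * z ^+ n.
    have xE n : cabs (x n) = `|c n| * rho ^+ n by rewrite cabsM cabs_real cabsX zr.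
    rewrite -[X in cabs X](subrK (\sum_(0 <= n < T) \sum_(0 <= i < n.+1) x i * x (n - i)%N)).
    apply: le_trans (cabsD _ _) _; apply: lerD.
      apply: le_trans (cabs_triangle_defect x T) _; rewrite /defect.
      under eq_bigr do rewrite xE; under [X in _ - X]eq_bigr do under eq_bigr do rewrite !xE.
      by [].
    apply: le_trans (HS T); apply: le_trans (cabs_sum _ _ _) _.
    apply: ler_sum => n _; rewrite -(cabs_real (\sum_(_ <= _ < _) _)) -zr -cabsX -cabsM.
    rewrite rmorph_sum mulr_suml le_eqVlt; apply/orP; left; apply/eqP; congr cabs.
    rewrite big_nat [RHS]big_nat; apply: eq_bigr => i /andP[_ iN].
    by rewrite /x rmorphM/= mulrACA -exprD subnKC.
  have D0 : 0 <= defect T + S.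
    have := H rho%:C; rewrite cabs_real (ger0_norm rho0) => /(_ erefl).
    by apply: le_trans; rewrite sqr_ge0.
  (* [H] bounds the square of the polynomial on the circle, hence the polynomial itself by the
     square root. *)
  have := @cauchy_coef_bound R (fun n => (c n)%:C) T m rho (Num.sqrt (defect T + S)) mT rho0.
  rewrite cabs_real => /(_ _) h.
  rewrite -[leRHS]sqr_sqrtr// lerXn2r ?nnegrE ?sqrtr_ge0 ?mulr_ge0 ?exprn_ge0//.
  apply: h => z /H h; have : cabs (\sum_(0 <= n < T) (c n)%:C * z ^+ n) ^+ 2 <=
      Num.sqrt (defect T + S) ^+ 2 by rewrite sqr_sqrtr.
  by rewrite ler_pXn2r ?nnegrE ?sqrtr_ge0 ?cabs_ge0.
(* [S'] forces the defect to 0, but its size disappears in the limit: the bound on c m depends only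
   on the coefficients of the square. *)
have c0 : (fun T => defect T + S) @ \oo --> 0 + S.
  apply: cvgD (cvg_cst _); apply: (triangle_defect_cvg _ HS').
  by move=> i; rewrite mulr_ge0// exprn_ge0.
rewrite add0r in c0; apply: (cvgr_to_ge c0).
by exists m.+1 => // T /= mT; exact: key.
Qed.

(** * Complex series by real and imaginary parts *)

Lemma cvg_Re (R : realType) (u : nat -> R[i]) (l : R[i]) :
  (u : nat -> R[i]^o) @ \oo --> (l : R[i]^o) ->
  (fun n => complex.Re (u n)) @ \oo --> complex.Re l.
Proof.
move=> ul; apply/cvgrPdist_lt => e e0.
have ec0 : (0 : R[i]) < e%:C by rewrite ltcR.
move/cvgrPdist_lt : ul => /(_ _ ec0); apply: filterS => n.
rewrite normC_cabs ltcR; apply: le_lt_trans.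
by rewrite -ReN -ReD le_Re_cabs.
Qed.

Lemma cvg_Im (R : realType) (u : nat -> R[i]) (l : R[i]) :
  (u : nat -> R[i]^o) @ \oo --> (l : R[i]^o) ->
  (fun n => complex.Im (u n)) @ \oo --> complex.Im l.
Proof.
move=> ul; apply/cvgrPdist_lt => e e0.
have ec0 : (0 : R[i]) < e%:C by rewrite ltcR.
move/cvgrPdist_lt : ul => /(_ _ ec0); apply: filterS => n.
rewrite normC_cabs ltcR; apply: le_lt_trans.
by rewrite -ImN -ImD le_Im_cabs.
Qed.

Lemma cvg_real_complex (R : realType) (u : nat -> R) (l : R) :
  u @ \oo --> l -> ((fun n => (u n)%:C) : nat -> R[i]^o) @ \oo --> (l%:C : R[i]^o).
Proof.
move=> ul; apply/cvgrPdist_lt => e e0.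
have eE : e = (complex.Re e)%:C by rewrite RRe_real// gtr0_real.
have e0' : 0 < complex.Re e by rewrite -ltcR -eE.
move/cvgrPdist_lt : ul => /(_ _ e0'); apply: filterS => n.
by rewrite -rmorphB normC_cabs cabs_real eE ltcR.
Qed.

Lemma Re_sum (R : realType) (u : nat -> R[i]) m n :
  complex.Re (\sum_(m <= i < n) u i) = \sum_(m <= i < n) complex.Re (u i).
Proof. by elim/big_rec2: _ => // i x y _ <-; rewrite ReD. Qed.

Lemma Im_sum (R : realType) (u : nat -> R[i]) m n :
  complex.Im (\sum_(m <= i < n) u i) = \sum_(m <= i < n) complex.Im (u i).
Proof. by elim/big_rec2: _ => // i x y _ <-; rewrite ImD. Qed.

Lemma sums_to_Re (R : realType) n0 (u : nat -> R[i]) (l : R[i]) :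
  sums_to n0 u l ->
  (fun N => \sum_(n0 <= n < N) complex.Re (u n)) @ \oo --> complex.Re l.
Proof. by move=> /cvg_Re; under eq_fun do rewrite Re_sum. Qed.

Lemma sums_to_Im (R : realType) n0 (u : nat -> R[i]) (l : R[i]) :
  sums_to n0 u l ->
  (fun N => \sum_(n0 <= n < N) complex.Im (u n)) @ \oo --> complex.Im l.
Proof. by move=> /cvg_Im; under eq_fun do rewrite Im_sum. Qed.

Lemma sums_to_real (R : realType) n0 (u : nat -> R) (l : R) :
  (fun N => \sum_(n0 <= n < N) u n) @ \oo --> l ->
  sums_to n0 (fun n => (u n)%:C) l%:C.
Proof.
move=> /cvg_real_complex; rewrite /sums_to.
by under eq_fun do rewrite rmorph_sum.
Qed.

Lemma sums_to_shift (R : realType) (u : nat -> R[i]) (l : R[i]) :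
  sums_to 1 u l -> sums_to 0 (fun n => u n.+1) l.
Proof.
rewrite /sums_to -(cvg_shiftS (fun N => \sum_(1 <= n < N) u n : R[i]^o)) /=.
by under eq_fun do rewrite big_add1.
Qed.

(** The imaginary parts of the coefficients form a power series in exp(-2 pi y) that vanishes on
    (0,1). Applied to f with beta = 1 and to its square root with beta = 1/2. *)
Lemma exp_series_real (R : realType) (u : nat -> R[i]) (H : R -> R) (beta : R) :
  (forall y, 0 < y -> sums_to 0
     (fun n => u n * (expR (- (2 * pi * (n%:R + beta) * y)))%:C) (H y)%:C) ->
  (forall n, u n = (complex.Re (u n))%:C) /\
  (forall y, 0 < y ->
     (fun N => \sum_(0 <= n < N) complex.Re (u n) * expR (- (2 * pi * y)) ^+ n)
       @ \oo --> expR (2 * pi * beta * y) * H y).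
Proof.
move=> Hu.
have expE n y : expR (- (2 * pi * y)) ^+ n =
    expR (2 * pi * beta * y) * expR (- (2 * pi * (n%:R + beta) * y)) :> R.
  by rewrite -expRD -expRM_natl; congr expR; ring.
have key (v : nat -> R) (l : R) y : 
    (fun N => \sum_(0 <= n < N) v n * expR (- (2 * pi * (n%:R + beta) * y))) @ \oo --> l ->
    (fun N => \sum_(0 <= n < N) v n * expR (- (2 * pi * y)) ^+ n)
       @ \oo --> expR (2 * pi * beta * y) * l.
  move=> h; have -> : (fun N => \sum_(0 <= n < N) v n * expR (- (2 * pi * y)) ^+ n) =
    (fun N => expR (2 * pi * beta * y) *
      \sum_(0 <= n < N) v n * expR (- (2 * pi * (n%:R + beta) * y))).
    apply/funext => N; rewrite mulr_sumr; apply: eq_bigr => n _.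
    by rewrite expE mulrCA.
  exact: (cvgM (cvg_cst _) h).
split; last first.
  move=> y y0; apply: key; have := sums_to_Re (Hu y y0).
  by under eq_fun do under eq_bigr do rewrite ReM mulr0 subr0.
suff H0 : forall n, complex.Im (u n) = 0 by move=> n; apply: eqC.
apply: powser_eq0 => x /andP[x0 x1].
pose y := - ln x / (2 * pi).
have p0 := pi_gt0 R.
have y0 : 0 < y by rewrite divr_gt0 ?mulr_gt0// oppr_gt0 ln_lt0// x0.
have -> : x = expR (- (2 * pi * y)).
  have -> : - (2 * pi * y) = ln x by rewrite /y mulrC divfK ?opprK// lt0r_neq0// mulr_gt0.
  by rewrite lnK ?posrE.
have := key (fun n => complex.Im (u n)) 0 y; rewrite mulr0; apply.
have := sums_to_Im (Hu y y0).
by under eq_fun do under eq_bigr do rewrite ImM mulr0 add0r.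
Qed.

(** By absolute convergence the Cauchy product of the series C with itself also sums to G(x)^2;
    uniqueness of coefficients then gives the convolution identity. *)
Lemma powser_sqr_coef (R : realType) (C A : nat -> R) (G : R -> R) :
  (forall x, 0 < x < 1 ->
     (fun N => \sum_(0 <= n < N) C n * x ^+ n) @ \oo --> G x) ->
  (forall x, 0 < x < 1 ->
     (fun N => \sum_(0 <= n < N) A n * x ^+ n) @ \oo --> G x ^+ 2) ->
  forall n, \sum_(0 <= i < n.+1) C i * C (n - i)%N = A n.
Proof.
move=> HC HA n; apply/eqP; rewrite -subr_eq0; apply/eqP; move: n.
apply: powser_eq0 => x x01; have /andP[x0 x1] := x01.
have [S HS] : exists S, forall N, \sum_(0 <= n < N) `|C n| * x ^+ n <= S.
  by apply: powser_abs_bounded => // t /HC/cvgP.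
pose u i := C i * x ^+ i.
pose defect T := (\sum_(0 <= i < T) u i) ^+ 2 -
  \sum_(0 <= n < T) \sum_(0 <= i < n.+1) u i * u (n - i)%N.
have nu i : `|u i| = `|C i| * x ^+ i.
  by rewrite normrM [`|x ^+ i|]ger0_norm// exprn_ge0// ltW.
have d0 : defect @ \oo --> (0 : R).
  apply/norm_cvg0P.
  have d1 : (fun T => (\sum_(0 <= i < T) `|u i|) ^+ 2 -
      \sum_(0 <= n < T) \sum_(0 <= i < n.+1) `|u i| * `|u (n - i)%N|) @ \oo --> (0 : R).
    apply: (triangle_defect_cvg (S := S)) => // N.
    by under eq_bigr do rewrite nu.
  apply: (squeeze_cvgr _ (cvg_cst _) d1); apply: nearW => T; rewrite normr_ge0/=.
  rewrite /defect triangle_defectE (triangle_defectE (fun i => `|u i|)).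
  apply: le_trans (ler_norm_sum _ _ _) _; apply: ler_sum => i _.
  apply: le_trans (ler_norm_sum _ _ _) _; apply: ler_sum => j _.
  by rewrite normrM.
have -> : (fun N => \sum_(0 <= n < N)
    (\sum_(0 <= i < n.+1) C i * C (n - i)%N - A n) * x ^+ n) =
  (fun N => (\sum_(0 <= i < N) u i) * (\sum_(0 <= i < N) u i) - defect N -
     \sum_(0 <= n < N) A n * x ^+ n).
  apply/funext => N; rewrite /defect -expr2 subKr -sumrB; apply: eq_bigr => n _; rewrite mulrBl; congr (_ - _).
  rewrite mulr_suml big_nat [RHS]big_nat; apply: eq_bigr => i /andP[_ ni].
  by rewrite /u mulrACA -exprD subnKC.
have := cvgB (cvgB (cvgM (HC x x01) (HC x x01)) d0) (HA x x01).
by rewrite subr0 -[X in _ --> X - _]expr2 subrr; exact.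
Qed.

(** * Growth of power series near the unit circle *)

Lemma expRN_gap (R : realType) (t : R) : 0 < t ->
  expR (- t) < 1 /\ (1 - expR (- t))^-1 <= (1 + t) / t.
Proof.
move=> t0; have e1 : expR (- t) < 1 by rewrite expR_lt1 oppr_lt0.
split => //; rewrite -[leRHS]invrK lef_pV2 ?posrE ?subr_gt0 ?invr_gt0 ?divr_gt0 ?addr_gt0//.
rewrite invf_div ler_pdivrMr ?addr_gt0//.
have := expRxMexpNx_1 t; have := expR_ge1Dx t; have := expR_gt0 (- t); nra.
Qed.

(** With s = t/2, half of the decay exp(-t n) turns the power of n+1 into s^-(B+1), and the other
    half is summed as a geometric series, which adds one more factor 1/s. *)
Lemma powser_growth (R : realType) (A : nat -> R) (K : R) (B : nat) :
  (forall n, `|A n| <= K * n.+1%:R ^+ B.+1) ->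
  exists K' : R, forall t, 0 < t -> t <= 4 -> forall N,
    \sum_(0 <= n < N) `|A n| * expR (- t) ^+ n <= K' * t^-1 ^+ B.+2.
Proof.
move=> HA; have K0 : 0 <= K.
  by have := HA 0%N; rewrite expr1n mulr1; exact: le_trans.
(* From t <= 4 follows s <= 2, whence expR 2 bounds exp s and 3 bounds 1 + s; the power of 2 comes
   from 1/s = 2/t. *)
exists (K * (B.+1)`!%:R * expR 2 * 3 * 2 ^+ B.+2) => t t0 t4 N.
pose s := t / 2; have s0 : 0 < s by rewrite divr_gt0.
have [es1 es2] := expRN_gap s0.
have F0 : 0 < (B.+1)`!%:R :> R by rewrite ltr0n fact_gt0.
have term n : `|A n| * expR (- t) ^+ n <=
    K * (B.+1)`!%:R * s^-1 ^+ B.+1 * expR s * expR (- s) ^+ n.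
  have h : n.+1%:R ^+ B.+1 <= (B.+1)`!%:R * s^-1 ^+ B.+1 * expR (s * n.+1%:R).
    have sn : 0 <= s * n.+1%:R by rewrite mulr_ge0// ltW.
    have := expR_ge1Dxn B sn; rewrite exprMn => h1.
    have h2 : s ^+ B.+1 * n.+1%:R ^+ B.+1 <= expR (s * n.+1%:R) * (B.+1)`!%:R.
      by rewrite -ler_pdivrMr//; lra.
    rewrite exprVn mulrAC ler_pdivlMr ?exprn_gt0//; lra.
  apply: (@le_trans _ _ (K * ((B.+1)`!%:R * s^-1 ^+ B.+1 * expR (s * n.+1%:R)) *
      expR (- t) ^+ n)).
    rewrite ler_wpM2r ?exprn_ge0 ?expR_ge0//.
    by apply: le_trans (HA n) _; rewrite ler_wpM2l.
  rewrite le_eqVlt; apply/orP; left; apply/eqP.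
  have -> : s * n.+1%:R = s + n%:R * s by rewrite -natr1; ring.
  have -> : - t = - s + - s by rewrite /s; lra.
  have u0 : expR s ^+ n != 0 by rewrite expf_neq0// gt_eqF// expR_gt0.
  have Eu : expR (- s) ^+ n = (expR s ^+ n)^-1 by rewrite expRN exprVn.
  rewrite !expRD exprMn expRM_natl Eu; move: u0; set u := expR s ^+ n => u0.
  set v := s^-1 ^+ _; set E := expR s; by field.
apply: (@le_trans _ _ (\sum_(0 <= n < N)
   K * (B.+1)`!%:R * s^-1 ^+ B.+1 * expR s * expR (- s) ^+ n)).
  by apply: ler_sum => n _; exact: term.
rewrite -mulr_sumr.
have c0 : 0 <= K * (B.+1)`!%:R * s^-1 ^+ B.+1 * expR s.
  by rewrite !mulr_ge0 ?expR_ge0// exprn_ge0// invr_ge0 ltW.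
apply: le_trans (ler_wpM2l c0 (le_trans (geometric_sum_le N (expR_ge0 _) es1) es2)) _.
have -> : K * (B.+1)`!%:R * expR 2 * 3 * 2 ^+ B.+2 * t^-1 ^+ B.+2 =
    K * (B.+1)`!%:R * s^-1 ^+ B.+1 * (expR 2 * (3 * s^-1)).
  have -> : s^-1 = 2 * t^-1 by rewrite /s invf_div.
  by rewrite [2 ^+ _]exprSr [t^-1 ^+ B.+2]exprSr exprMn; ring.
rewrite -[leLHS]mulrA; apply: ler_wpM2l.
  by rewrite !mulr_ge0// exprn_ge0// invr_ge0 ltW.
have s2 : s <= 2 by rewrite /s; lra.
apply: ler_pM; [exact: expR_ge0| |by rewrite ler_expR|].
  by rewrite divr_ge0 ?addr_ge0 ?(ltW s0).
by apply: ler_wpM2r; [rewrite invr_ge0 ltW|lra].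
Qed.

(** Write exp(-2 pi y) as rho^2 with rho = exp(-pi y). One factor rho^m serves for Cauchy's estimate
    of C m, the other for a geometric sum. The result is polynomial in 1/y, hence below exp(d/y) up
    to a constant. *)
Lemma sqrt_powser_growth (R : realType) (C A : nat -> R) (K : R) (B : nat) :
  (forall x : R, 0 < x < 1 -> exists S, forall N, \sum_(0 <= n < N) `|C n| * x ^+ n <= S) ->
  (forall n, \sum_(0 <= i < n.+1) C i * C (n - i)%N = A n) ->
  (forall n, `|A n| <= K * n.+1%:R ^+ B.+1) ->
  forall d : R, 0 < d -> exists K' : R, forall y, 0 < y -> forall N,
    \sum_(0 <= n < N) `|C n| * expR (- (2 * pi * y)) ^+ n <= K' * expR (d / y).
Proof.
move=> HC CA HA d d0; have [K1 HK1] := powser_growth HA.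
have p0 := pi_gt0 R.
have p4 : pi <= 4 :> R by have := pihalf_lt2 R; lra.
have small : exists K2 : R, forall y, 0 < y -> y <= 1 -> forall N,
    \sum_(0 <= n < N) `|C n| * expR (- (2 * pi * y)) ^+ n <= K2 * expR (d / y).
  (* Chosen so that 1/t = q (d/y), which makes every bound a polynomial in d/y, the exponent to be
     matched. *)
  pose q := (pi * d)^-1.
  have q0 : 0 < q by rewrite invr_gt0 mulr_gt0.
  have pw (z : R) n : 0 <= z -> z ^+ n.+1 <= (n.+1)`!%:R * expR z.
    move=> z0; have := expR_ge1Dxn n z0 => h.
    by rewrite mulrC -ler_pdivrMr ?ltr0n ?fact_gt0//; lra.
  exists (`|K1| * q ^+ B.+2 * 5 * q * (B.+3)`!%:R + 5 * q) => y y0 y1 N.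
  pose t := pi * y; have t0 : 0 < t by rewrite mulr_gt0.
  have t4 : t <= 4 by rewrite /t; nra.
  have [r1 r2] := expRN_gap t0; set rho := expR (- t) in r1 r2.
  have r0 : 0 < rho := expR_gt0 _.
  have tz : t^-1 = q * (d / y).
    by rewrite /q /t !invfM -mulrA mulKf// gt_eqF.
  have z0 : 0 <= d / y by rewrite divr_ge0 ?ltW.
  have [S' HS'] := HC rho (introT andP (conj r0 r1)).
  pose S := `|K1| * t^-1 ^+ B.+2.
  have S0 : 0 <= S by rewrite mulr_ge0// exprn_ge0// invr_ge0 ltW.
  have HS M : \sum_(0 <= n < M)
      `|\sum_(0 <= i < n.+1) C i * C (n - i)%N| * rho ^+ n <= S.
    under eq_bigr do rewrite CA.
    apply: le_trans (HK1 t t0 t4 M) _.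
    by rewrite ler_wpM2r ?ler_norm// exprn_ge0// invr_ge0 ltW.
  (* x^2 <= S gives x <= S + 1; this avoids the square root and is still polynomial in 1/y. *)
  have Cb m : `|C m| * rho ^+ m <= S + 1.
    have := sqrt_coef_bound m (ltW r0) HS' HS; nra.
  apply: (@le_trans _ _ (\sum_(0 <= n < N) (S + 1) * rho ^+ n)).
    apply: ler_sum => n _; have -> : expR (- (2 * pi * y)) = rho * rho.
      by rewrite /rho -expRD; congr expR; rewrite /t; ring.
    by rewrite exprMn mulrA ler_wpM2r// exprn_ge0// ltW.
  rewrite -mulr_sumr.
  have S1 : 0 <= S + 1 by lra.
  apply: le_trans (ler_wpM2l S1 (le_trans (geometric_sum_le N (ltW r0) r1) r2)) _.
  apply: (@le_trans _ _ ((S + 1) * (5 * t^-1))).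
    by apply: ler_wpM2l => //; apply: ler_wpM2r; [rewrite invr_ge0 ltW|lra].
  have -> : (S + 1) * (5 * t^-1) =
      `|K1| * q ^+ B.+2 * 5 * q * (d / y) ^+ B.+3 + 5 * q * (d / y) ^+ 1.
    rewrite /S tz exprMn; set z := d / y.
    by rewrite [z ^+ B.+3]exprSr expr1; ring.
  rewrite [leRHS]mulrDl; apply: lerD.
    rewrite -[leRHS]mulrA; apply: ler_wpM2l; last exact: pw.
    have q1 := ltW q0; have q2 : 0 <= q ^+ B.+2 by exact: exprn_ge0.
    by apply: mulr_ge0 => //; apply: mulr_ge0 => //; apply: mulr_ge0.
  by rewrite ler_wpM2l ?mulr_ge0 ?(ltW q0)// (le_trans (pw _ 0%N z0))// mul1r.
have [K2 HK2] := small; exists (`|K2| * expR d) => y y0 N.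
have [y1|y1] := leP y 1.
  apply: le_trans (HK2 y y0 y1 N) _; rewrite ler_wpM2r ?expR_ge0//.
  apply: le_trans (ler_norm _) _; rewrite ler_peMr// -expR0 ler_expR ltW//.
(* For y > 1 the sum is at most its value at y = 1. *)
apply: (@le_trans _ _ (\sum_(0 <= n < N) `|C n| * expR (- (2 * pi * 1)) ^+ n)).
  apply: ler_sum => n _; rewrite ler_wpM2l// lerXn2r ?nnegrE ?expR_ge0//.
  by rewrite ler_expR lerN2 ler_pM2l ?mulr_gt0// ltW.
apply: le_trans (HK2 1 ltr01 (lexx _) N) _; rewrite divr1.
apply: le_trans (ler_wpM2r (expR_ge0 _) (ler_norm _)) _.
by rewrite ler_peMr ?mulr_ge0 ?expR_ge0// -expR0 ler_expR divr_ge0 ?ltW.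
Qed.

(** * Dominated convergence and scaling on the half-line *)

Lemma pint_dct (R : realType) (u : nat -> R -> R) (f g : R -> R) :
  (forall n, measurable_fun (`]0, +oo[ : set R) (u n)) -> expdom g ->
  (forall y, 0 < y -> (fun n => u n y) @ \oo --> f y) ->
  (forall n y, 0 < y -> `|u n y| <= g y) ->
  expdom f /\ (fun n => pint (u n)) @ \oo --> pint f.
Proof.
move=> mu eg uf ug.
have mf : measurable_fun (`]0, +oo[ : set R) f.
  apply: (measurable_fun_cvg mu) => y; rewrite /= in_itv/= andbT; exact: uf.
have [mg [C [b [b0 Hg]]]] := eg.
have eu n : expdom (u n).
  split => //; exists C, b; split => // y y0.
  by apply: le_trans (ug n y y0) _; apply: le_trans (ler_norm _) (Hg y y0).
have ef : expdom f.
  split => //; exists C, b; split => // y y0.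
  apply: (cvgr_to_le (cvg_norm (uf y y0))); apply: nearW => n.
  by apply: le_trans (ug n y y0) _; apply: le_trans (ler_norm _) (Hg y y0).
split => //.
have H1 : {ae (@lebesgue_measure R), forall y, `]0, +oo[%classic y ->
    (fun n => (u n y)%:E) @ \oo --> (EFin \o f) y}.
  apply: aeW => y; rewrite /= in_itv/= andbT => y0.
  by apply: cvg_EFin; [exact: nearW|exact: uf].
have H2 : {ae (@lebesgue_measure R), forall y n, `]0, +oo[%classic y ->
    (`|(u n y)%:E| <= (EFin \o g) y)%E}.
  apply: aeW => y n; rewrite /= in_itv/= andbT => y0.
  by rewrite lee_fin; exact: ug.
have [_ _ H] := @dominated_convergence _ _ R lebesgue_measure `]0, +oo[
  (measurable_itv _) (fun n y => (u n y)%:E) (EFin \o f) (EFin \o g)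
  (fun n => (measurable_EFinP _ _).2 (mu n)) ((measurable_EFinP _ _).2 mf) H1
  (expdom_integrable eg) H2.
apply: fine_cvg.
by rewrite fineK //; exact: integrable_fin_num (expdom_integrable ef).
Qed.

Lemma expdom_scale (R : realType) (f : R -> R) (c : R) : 0 < c -> expdom f ->
  expdom (fun y => f (c * y)).
Proof.
move=> c0 [mf [C [b [b0 H]]]]; split.
  refine (@measurable_comp _ _ _ R R R (`]0, +oo[ : set R) f
    (`]0, +oo[ : set R) (fun y => c * y) _ _ _ _) => //.
    by move=> _ [y /= + <-]; rewrite !in_itv/= !andbT => y0; rewrite mulr_gt0.
  by apply: measurable_funTS; exact: measurable_funM.
exists C, (b * c); split; first exact: mulr_gt0.
by move=> y y0; rewrite -mulrA; apply: H; rewrite mulr_gt0.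
Qed.

(** Lebesgue measure equals c times its image under multiplication by c, since the two agree on the
    intervals ]a, b]. *)
Lemma ge0_pint_scale (R : realType) (f : R -> R) (c : R) : 0 < c ->
  measurable_fun (`]0, +oo[ : set R) f -> (forall y, 0 < y -> 0 <= f y) ->
  pint f = c * pint (fun y => f (c * y)).
Proof.
move=> c0 mf f0.
pose phi : measurableTypeR R -> measurableTypeR R := *%R c.
have mphi : measurable_fun [set: measurableTypeR R] phi by exact: measurable_funM.
pose push : {measure set (measurableTypeR R) -> \bar R} :=
  measure_function_pushforward__canonical__measure_function_Measure
  (@lebesgue_measure R) mphi.
pose cn := NngNum (ltW c0).
have scaled (A : set (measurableTypeR R)) : measurable A ->
    lebesgue_measure A = mscale cn push A.
  move=> mA; apply: lebesgue_measure_unique => // _ [[a b]] _ <-.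
  rewrite -[RHS]/(c%:E * lebesgue_measure (phi @^-1` `]a, b]))%E.
  have -> : phi @^-1` `]a, b] = `](c^-1 * a), (c^-1 * b)]%classic.
    apply/seteqP; split => x /=; rewrite !in_itv/= /phi;
      by rewrite ltr_pdivrMl// ler_pdivlMl.
  rewrite !lebesgue_measure_itv/= !lte_fin ltr_pM2l ?invr_gt0//.
  case: ifP => _; last by rewrite mule0.
  by rewrite -!EFinB -EFinM -mulrBr mulrA divff ?mul1r// gt_eqF.
have f0' x : `]0, +oo[%classic x -> (0 <= (f x)%:E)%E.
  by rewrite /= in_itv/= andbT lee_fin; exact: f0.
have mf' : measurable_fun (`]0, +oo[ : set (measurableTypeR R)) (EFin \o f).
  exact/measurable_EFinP.
rewrite /pint /Rintegral.
rewrite (eq_measure_integral (mscale cn push)); last first.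
  by move=> A mA _; exact: scaled.
rewrite ge0_integral_mscale//= ge0_integral_pushforward//; last first.
  by move=> y /[!inE]; exact: f0'.
have -> : phi @^-1` `]0, +oo[ = `]0, +oo[%classic.
  by apply/seteqP; split => y /=; rewrite !in_itv/= !andbT /phi pmulr_rgt0.
rewrite -[X in fine (_ * X)]/(\int[lebesgue_measure]_(y in `]0%R, +oo[) (f (c * y))%:E)%E.
(* If the integral is infinite, both sides are 0, the value of [fine] at infinity. *)
case: (\int[_]_(_ in _) _)%E => [r| |]//=.
  by rewrite gt0_muley ?lte_fin//= mulr0.
by rewrite gt0_muleNy ?lte_fin//= mulr0.
Qed.

(** Adding the majorant [g] of |f| makes the integrand nonnegative, and [g] itself scales by the
    nonnegative case. *)
Lemma pint_scale (R : realType) (f : R -> R) (c : R) : 0 < c -> expdom f ->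
  pint (fun y => f (c * y)) = c^-1 * pint f.
Proof.
move=> c0 ef; have [mf [C [b [b0 H]]]] := ef.
pose g y := C * expR (- (b * y)).
have eg : expdom g by apply: expdomZ; exact: expdom_expRN.
have S h : expdom h -> (forall y, 0 < y -> 0 <= h y) ->
    pint (fun y => h (c * y)) = c^-1 * pint h.
  move=> [mh _] h0; rewrite (ge0_pint_scale c0 mh h0) mulrA mulVf ?mul1r//.
  by rewrite gt_eqF.
have efg := expdomD ef eg.
have E1 : pint (fun y => f (c * y)) =
    pint (fun y => f (c * y) + g (c * y)) - pint (fun y => g (c * y)).
  by rewrite pintD ?addrK//; apply: expdom_scale.
rewrite E1 (S (fun y => f y + g y))// ?(S g)//.
- by rewrite pintD// mulrDr addrK.
- by move=> y /H; apply: le_trans.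
- by move=> y /H; rewrite ler_norml -/(g y) => /andP[]; lra.
Qed.

Lemma cint_scale (R : realType) (f : R -> R[i]) (c : R) : 0 < c -> cdom f ->
  cint (fun y => f (c * y)) = (c^-1)%:C * cint f.
Proof.
move=> c0 [f1 f2]; apply: eqC; rewrite !reimE /= -!/(pint _).
  by rewrite mul0r subr0 -pint_scale.
by rewrite mul0r addr0 -pint_scale.
Qed.

Lemma seg_pint_cvg (R : realType) (f : R -> R) : expdom f ->
  (fun n => seg f n.+1%:R^-1 n.+1%:R) @ \oo --> pint f.
Proof.
move=> ef; have [mf [C [b [b0 H]]]] := ef.
pose u n := f \_ `[n.+1%:R^-1, n.+1%:R].
have sub n : `[n.+1%:R^-1, n.+1%:R]%classic `<=` (`]0, +oo[%classic : set R).
  move=> y; rewrite /= !in_itv/= andbT => /andP[h _].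
  by apply: lt_le_trans h; rewrite invr_gt0.
have eg : expdom (fun y => C * expR (- (b * y))).
  by apply: expdomZ; exact: expdom_expRN.
have [] := @pint_dct R u f _ _ eg.
- move=> n; rewrite /u; apply/measurable_restrict => //.
  by apply: measurable_funS mf => // y [].
- move=> y y0; apply: cvg_near_cst.
  exists (maxn (Num.truncn y) (Num.truncn y^-1)) => // n /=.
  rewrite geq_max => /andP[n1 n2]; rewrite /u patchE mem_set//= in_itv/=.
  apply/andP; split.
    rewrite -[leRHS]invrK lef_pV2 ?posrE ?invr_gt0//.
    by rewrite ltW// (lt_le_trans (truncnS_gt _))// ler_nat.
  by rewrite ltW// (lt_le_trans (truncnS_gt _))// ler_nat.
- move=> n y y0; rewrite /u patchE; case: ifP => _; first exact: H.
  by rewrite normr0 (le_trans _ (H y y0)).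
move=> _; apply: cvg_trans; apply: near_eq_cvg; apply: nearW => n /=.
by rewrite /pint /u -Rintegral_mkcondr setIidr//; exact: sub.
Qed.

(** * Bessel integrals *)

(** Left unnormalised, with total mass sqrt pi, so that its derivative is exp(-x^2) and it gives an
    explicit primitive for the Bessel integrand of order 1/2. *)
Definition gauss_cdf (R : realType) (x : R) : R :=
  \int[lebesgue_measure]_(t in `]-oo, x]) gauss_fun t.

Lemma is_derive_gauss_cdf (R : realType) (x : R) :
  is_derive x (1 : R) (@gauss_cdf R) (expR (- x ^+ 2)).
Proof.
have ig : (@lebesgue_measure R).-integrable `]-oo, (x + 1)] (EFin \o @gauss_fun R).
  by apply: integrableS integrableT_gauss.
have x1 : x < x + 1 by rewrite ltrDl.
have [|d1 d2] := @continuous_FTC1 R gauss_fun -oo%O x (x + 1) x1 ig _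
  (@continuous_gauss_fun R x); first by rewrite ltNyr.
by apply: DeriveDef => //; rewrite -derive1E d2.
Qed.

(** Covers both ends at once: [D] is the whole line when v tends to +oo and empty when v tends to
    -oo. *)
Lemma gauss_cdf_cvg (R : realType) (v : nat -> R) (D : set R) :
  measurable D ->
  (forall t, \forall n \near \oo, (t \in `]-oo, v n]%classic) = (t \in D)) ->
  (fun n => gauss_cdf (v n)) @ \oo --> \int[lebesgue_measure]_(t in D) gauss_fun t.
Proof.
move=> mD vD.
have mg : measurable_fun setT (@gauss_fun R) by exact: measurable_gauss_fun.
have H1 : {ae (@lebesgue_measure R), forall y : R, [set: R] y ->
    (fun n => (EFin \o (gauss_fun \_ `]-oo, v n])) y) @ \oo --> (EFin \o (gauss_fun \_ D)) y}.
  apply: aeW => t _; apply: cvg_near_cst; apply: filterS (vD t) => n h.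
  by rewrite /= !patchE h.
have H2 : {ae (@lebesgue_measure R), forall y n, [set: R] y ->
    (`|(EFin \o (gauss_fun \_ `]-oo, v n])) y| <= (EFin \o @gauss_fun R) y)%E}.
  apply: aeW => t n _; rewrite /= lee_fin patchE.
  by case: ifP => _; rewrite ?normr0 ?ger0_norm ?gauss_fun_ge0.
have mr (B : set R) : measurable B -> measurable_fun setT (EFin \o (@gauss_fun R \_ B)).
  move=> mB; apply/measurable_EFinP; apply/measurable_restrict => //.
  exact: measurable_funS mg.
have [ig _ H] := @dominated_convergence _ _ R lebesgue_measure setT
  measurableT (fun n => EFin \o (gauss_fun \_ `]-oo, v n]))
  (EFin \o (gauss_fun \_ D)) (EFin \o @gauss_fun R)
  (fun n => mr _ (measurable_itv _)) (mr _ mD) H1 integrableT_gauss H2.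
rewrite /gauss_cdf Rintegral_mkcond; under eq_fun do rewrite Rintegral_mkcond.
by apply: fine_cvg; rewrite fineK //; exact: integrable_fin_num ig.
Qed.

Lemma gauss_cdf_cvgy (R : realType) (v : nat -> R) : v @ \oo --> +oo ->
  (fun n => gauss_cdf (v n)) @ \oo --> Num.sqrt (pi : R).
Proof.
move=> vy; have -> : Num.sqrt (pi : R) = \int[lebesgue_measure]_t gauss_fun t.
  by rewrite /Rintegral integralT_gauss.
apply: gauss_cdf_cvg => // t; move/cvgryPge : vy => /(_ t); apply: filterS => n h.
by rewrite in_setT mem_set//= in_itv.
Qed.

Lemma gauss_cdf_cvgNy (R : realType) (v : nat -> R) : v @ \oo --> -oo ->
  (fun n => gauss_cdf (v n)) @ \oo --> (0 : R).
Proof.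
move=> vy; rewrite -(Rintegral_set0 (@lebesgue_measure R) gauss_fun).
apply: gauss_cdf_cvg => // t; move/cvgrNyPlt : vy => /(_ t); apply: filterS => n h.
by rewrite in_set0 memNset//= in_itv/= leNgt h.
Qed.

Lemma seg_FTC (R : realType) (f P : R -> R) (a b : R) : 0 < a -> a < b ->
  (forall y : R, 0 < y -> is_derive y (1 : R) P (f y)) ->
  (forall y : R, 0 < y -> {for y, continuous f}) ->
  seg f a b = P b - P a.
Proof.
move=> a0 ab Pf cf; have b0 : 0 < b by exact: lt_trans ab.
have cP y : 0 < y -> {for y, continuous P}.
  move=> /Pf [dP _]; apply: differentiable_continuous; exact/derivable1_diffP.
have := @continuous_FTC2 R f P a b ab.
rewrite /seg /Rintegral => ->//.
- apply: continuous_in_subspaceT => y; rewrite inE/= in_itv/= => /andP[ay _].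
  by apply: cf; exact: lt_le_trans ay.
- split.
  + move=> y; rewrite in_itv/= => /andP[ay _].
    by have [] := Pf y (lt_trans a0 ay).
  + by apply: cvg_at_right_filter; exact: cP.
  + by apply: cvg_at_left_filter; exact: cP.
- move=> y; rewrite in_itv/= => /andP[ay _].
  by rewrite derive1E; have [_ ->] := Pf y (lt_trans a0 ay).
Qed.

(** With s = sqrt y, (a s - b/s)^2 and (a s + b/s)^2 differ from a^2 y + b^2/y by -2ab and +2ab,
    which the two exponential factors cancel. The inner derivatives add up to a/s, because their
    b-terms are opposite. *)
Lemma half_bessel_derive (R : realType) (a b y : R) : 0 < a -> 0 < y ->
  is_derive y (1 : R)
    (fun y => a^-1 * (expR (- (2 * a * b)) * gauss_cdf (a * Num.sqrt y - b * (Num.sqrt y)^-1) +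
               expR (2 * a * b) * gauss_cdf (a * Num.sqrt y + b * (Num.sqrt y)^-1)))
    (expR (- (a ^+ 2 * y + b ^+ 2 / y)) / Num.sqrt y).
Proof.
move=> a0 y0; set s := Num.sqrt y.
have s0 : 0 < s by rewrite sqrtr_gt0.
have yE : y = s ^+ 2 by rewrite sqr_sqrtr// ltW.
have ds := is_derive1_sqrt y0.
have di : is_derive y (1 : R) (fun y => (Num.sqrt y)^-1) (- (2 * s ^+ 3)^-1).
  have := is_deriveV (lt0r_neq0 s0) ds.
  move/is_derive_eq; apply; rewrite /GRing.scale/= -/s.
  by field; rewrite gt_eqF.
have chain (c : R) : is_derive y (1 : R)
    (fun y => gauss_cdf (a * Num.sqrt y + c * (Num.sqrt y)^-1))
    (expR (- (a * s + c * s^-1) ^+ 2) * (a * (2 * s)^-1 + c * - (2 * s ^+ 3)^-1)).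
  have dl : is_derive y (1 : R) (fun y => a * Num.sqrt y + c * (Num.sqrt y)^-1)
      (a * (2 * s)^-1 + c * - (2 * s ^+ 3)^-1).
    exact: is_deriveD (is_deriveZ a ds) (is_deriveZ c di).
  exact: (is_derive1_comp (is_derive_gauss_cdf _) dl).
have c1 := chain (- b); have c2 := chain b.
have E1 : (fun y => gauss_cdf (a * Num.sqrt y + - b * (Num.sqrt y)^-1)) =
    (fun y => gauss_cdf (a * Num.sqrt y - b * (Num.sqrt y)^-1)).
  by apply/funext => t; rewrite mulNr.
rewrite E1 in c1.
have := is_deriveZ a^-1 (is_deriveD (is_deriveZ (expR (- (2 * a * b))) c1)
  (is_deriveZ (expR (2 * a * b)) c2)).
move/is_derive_eq; apply; rewrite /GRing.scale/=.
have alg (t z : R) : t != 0 -> t ^+ 2 = z ->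
    - (2 * a * b) + - (a * t + - b * t^-1) ^+ 2 = - (a ^+ 2 * z + b ^+ 2 / z) /\
    2 * a * b + - (a * t + b * t^-1) ^+ 2 = - (a ^+ 2 * z + b ^+ 2 / z).
  by move=> t0 <-; split; field.
have [] := alg s y (lt0r_neq0 s0) (esym yE) => e1 e2.
rewrite [expR (- (2 * a * b)) * _]mulrA -expRD e1.
rewrite [expR (2 * a * b) * _]mulrA -expRD e2.
by field; rewrite !gt_eqF.
Qed.

(** At infinity both Gaussian arguments tend to +oo; at 0 the argument a s - b/s tends to -oo and
    the other to +oo. The second terms cancel and one sqrt pi survives. *)
Lemma half_bessel (R : realType) (a b : R) : 0 < a -> 0 < b ->
  expdom (fun y => expR (- (a ^+ 2 * y + b ^+ 2 / y)) / Num.sqrt y) ->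
  pint (fun y => expR (- (a ^+ 2 * y + b ^+ 2 / y)) / Num.sqrt y) =
  Num.sqrt pi / a * expR (- (2 * a * b)).
Proof.
move=> a0 b0 ef; set f := (fun y => _) in ef *.
pose P (s : R) := a^-1 * (expR (- (2 * a * b)) * gauss_cdf (a * s - b * s^-1) +
               expR (2 * a * b) * gauss_cdf (a * s + b * s^-1)).
have cf (y : R) : 0 < y -> {for y, continuous f}.
  move=> y0; have s0 : Num.sqrt y != 0 by rewrite gt_eqF// sqrtr_gt0.
  apply: cvgM; last by apply: cvgV => //; exact: sqrt_continuous.
  apply: (@continuous_comp _ _ _ (fun y : R => - (a ^+ 2 * y + b ^+ 2 / y)) expR);
    last exact: continuous_expR.
  apply: cvgN; apply: cvgD.
    by apply: cvgM; [exact: cvg_cst|exact: cvg_id].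
  apply: cvgM; first exact: cvg_cst.
  by apply: cvgV; [rewrite gt_eqF|exact: cvg_id].
have H1 := seg_pint_cvg ef.
(* The index starts at 2 because [1, 1] is degenerate and [seg_FTC] needs a proper interval. *)
have segE n : seg f n.+2%:R^-1 n.+2%:R = P (Num.sqrt n.+2%:R) - P (Num.sqrt n.+2%:R^-1).
  have N0 : 0 < n.+2%:R^-1 :> R by rewrite invr_gt0.
  have N1 : n.+2%:R^-1 < n.+2%:R :> R.
    by apply: (@lt_trans _ _ 1); rewrite ?invf_lt1 ?ltr1n.
  exact: (seg_FTC N0 N1 (fun y y0 => half_bessel_derive b a0 y0) cf).
have {}H1 : (fun n => seg f n.+2%:R^-1 n.+2%:R) @ \oo --> pint f.
  by rewrite -cvg_shiftS in H1.
have sy : (fun n : nat => Num.sqrt n.+2%:R : R) @ \oo --> +oo.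
  apply/cvgryPge => M.
  exists (Num.truncn (M ^+ 2)) => // n /= hn.
  have [M0|M0] := leP M 0; first by rewrite (le_trans M0)// sqrtr_ge0.
  rewrite -(ger0_norm (ltW M0)) -sqrtr_sqr ler_wsqrtr//.
  by rewrite ltW// (lt_le_trans (truncnS_gt _))// ler_nat; exact: leqW hn.
pose s (n : nat) : R := Num.sqrt n.+2%:R.
have s1 n : 1 <= s n by rewrite -[leLHS]sqrtr1 ler_wsqrtr// ler1n.
have s0 n : 0 < s n by rewrite (lt_le_trans ltr01).
have sV n : Num.sqrt n.+2%:R^-1 = (s n)^-1 :> R by rewrite sqrtrV.
have lin (c d : R) : 0 < c -> (fun n => c * s n + d * (s n)^-1) @ \oo --> +oo.
  move=> c0; apply/cvgryPge => M.
  move/cvgryPge : sy => /(_ ((M + `|d|) / c)); apply: filterS => n.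
  rewrite -/(s n) ler_pdivrMr// mulrC => h.
  have : `|d * (s n)^-1| <= `|d|.
    by rewrite normrM ler_piMr// ger0_norm ?invr_ge0 ?(ltW (s0 n))// invf_le1.
  by rewrite ler_norml => /andP[h1 _]; lra.
have G1 : (fun n => gauss_cdf (a * s n - b * (s n)^-1)) @ \oo --> Num.sqrt (pi : R).
  apply: gauss_cdf_cvgy; have := lin a (- b) a0.
  by under eq_fun do rewrite mulNr.
have G2 : (fun n => gauss_cdf (a * s n + b * (s n)^-1)) @ \oo --> Num.sqrt (pi : R).
  exact: gauss_cdf_cvgy (lin a b a0).
have G3 : (fun n => gauss_cdf (a * (s n)^-1 - b * ((s n)^-1)^-1)) @ \oo --> (0 : R).
  apply: gauss_cdf_cvgNy.
  have -> : (fun n => a * (s n)^-1 - b * ((s n)^-1)^-1) =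
      - (fun n => b * s n + - a * (s n)^-1).
    by apply/funext => n; rewrite fctE invrK; ring.
  by apply/cvgNrNy; exact: lin.
have G4 : (fun n => gauss_cdf (a * (s n)^-1 + b * ((s n)^-1)^-1)) @ \oo --> Num.sqrt (pi : R).
  apply: gauss_cdf_cvgy.
  have -> : (fun n => a * (s n)^-1 + b * ((s n)^-1)^-1) =
      (fun n => b * s n + a * (s n)^-1).
    by apply/funext => n; rewrite invrK addrC.
  exact: lin.
have cc (x : R) : (fun _ : nat => x) @ \oo --> x by exact: cvg_cst.
have PP : (fun n => P (s n) - P (s n)^-1) @ \oo -->
    a^-1 * (expR (- (2 * a * b)) * Num.sqrt pi + expR (2 * a * b) * Num.sqrt pi) -
    a^-1 * (expR (- (2 * a * b)) * 0 + expR (2 * a * b) * Num.sqrt pi).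
  apply: cvgB; apply: cvgM; [exact: cc| |exact: cc|]; apply: cvgD; apply: cvgM;
    by [exact: cc|exact: G1|exact: G2|exact: G3|exact: G4].
have EE : (fun n => seg f n.+2%:R^-1 n.+2%:R) = (fun n => P (s n) - P (s n)^-1).
  by apply/funext => n; rewrite segE sV.
rewrite EE in H1.
by rewrite (cvg_unique (@Rhausdorff R) H1 PP); field; rewrite gt_eqF.
Qed.

(** * The Mellin transform of a Fourier series *)

Lemma pint0 (R : realType) : pint (fun=> 0 : R) = 0.
Proof. by rewrite /pint Rintegral_cst// mul0r. Qed.

Lemma expdom_sum (R : realType) (f : nat -> R -> R) N :
  (forall n, expdom (f n)) -> expdom (fun y => \sum_(0 <= n < N) f n y).
Proof.
move=> ef; elim: N => [|N IH].
  have -> : (fun y => \sum_(0 <= n < 0) f n y) = (fun y => 0 * expR (- (1 * y))).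
    by apply/funext => y; rewrite big_geq// mul0r.
  by apply: expdomZ; exact: expdom_expRN.
have -> : (fun y => \sum_(0 <= n < N.+1) f n y) =
    (fun y => \sum_(0 <= n < N) f n y + f N y).
  by apply/funext => y; rewrite big_nat_recr.
exact: expdomD.
Qed.

Lemma pint_sum (R : realType) (f : nat -> R -> R) N :
  (forall n, expdom (f n)) ->
  pint (fun y => \sum_(0 <= n < N) f n y) = \sum_(0 <= n < N) pint (f n).
Proof.
move=> ef; elim: N => [|N IH].
  rewrite big_geq//; transitivity (pint (fun=> 0 : R)).
    by apply: eq_pint => y _; rewrite big_geq.
  exact: pint0.
rewrite big_nat_recr//= -IH -pintD//; last exact: expdom_sum.
by apply: eq_pint => y _; rewrite big_nat_recr.
Qed.

Lemma cvg_complex (R : realType) (u : nat -> R[i]) (l : R[i]) :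
  (fun n => complex.Re (u n)) @ \oo --> complex.Re l ->
  (fun n => complex.Im (u n)) @ \oo --> complex.Im l ->
  (u : nat -> R[i]^o) @ \oo --> (l : R[i]^o).
Proof.
move=> ur ui; apply/cvgrPdist_lt => e e0.
have eE : e = (complex.Re e)%:C by rewrite RRe_real// gtr0_real.
have e0' : 0 < complex.Re e / 2 by rewrite divr_gt0// -ltcR -eE.
move/cvgrPdist_lt : ur => /(_ _ e0') ur; move/cvgrPdist_lt : ui => /(_ _ e0') ui.
near=> n; rewrite normC_cabs eE ltcR; apply: le_lt_trans (cabs_le_ReIm _) _.
rewrite !reimE (splitr (complex.Re e)); apply: ltrD; near: n; [exact: ur|exact: ui].
Unshelve. all: by end_near. Qed.

Lemma cint_dct (R : realType) (u : nat -> R -> R[i]) (f : R -> R[i]) (g : R -> R) :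
  (forall n, cdom (u n)) -> expdom g ->
  (forall y, 0 < y -> (fun n => u n y : R[i]^o) @ \oo --> (f y : R[i]^o)) ->
  (forall n y, 0 < y -> cabs (u n y) <= g y) ->
  (fun n => cint (u n) : R[i]^o) @ \oo --> (cint f : R[i]^o).
Proof.
move=> cu eg uf ug.
have [_ H1] := pint_dct (fun n => (cu n).1.1) eg (fun y y0 => cvg_Re (uf y y0))
  (fun n y y0 => le_trans (le_Re_cabs _) (ug n y y0)).
have [_ H2] := pint_dct (fun n => (cu n).2.1) eg (fun y y0 => cvg_Im (uf y y0))
  (fun n y y0 => le_trans (le_Im_cabs _) (ug n y y0)).
exact: cvg_complex.
Qed.

Lemma cpow_natN1 (R : realType) (c : R) : 0 < c -> cpow c (- 1) = (c^-1)%:C.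
Proof.
move=> c0; apply: eqC; rewrite ?Re_cpow ?Im_cpow /= oppr0 mul0r ?cos0 ?sin0.
  by rewrite mulN1r expRN lnK ?posrE// mulr1.
by rewrite mulr0.
Qed.

Lemma cpowMl (R : realType) (x y : R) (s : R[i]) : 0 < x -> 0 < y ->
  cpow (x * y) s = cpow x s * cpow y s.
Proof.
by move=> x0 y0; rewrite /cpow lnM ?posrE// rmorphD/= mulrDr cexpD.
Qed.

Lemma cpow0 (R : realType) (y : R) : cpow y 0 = 1.
Proof. by rewrite /cpow mul0r cexp0. Qed.

Lemma mellin_scale (R : realType) (phi : R -> R) (c : R) (s : R[i]) :
  expdom phi -> 0 < c -> 1 < complex.Re s ->
  mellin (fun y => phi (c * y)) s = cpow c (- s) * mellin phi s.
Proof.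
move=> ephi c0 s1; have := cint_scale c0 (mellin_cdom ephi s1).
rewrite -/(mellin phi s) -cpow_natN1// => H.
have -> : - s = - (s - 1) + - 1 by ring.
rewrite cpowD -mulrA -H -cintZ; last first.
  have [f1 f2] := mellin_cdom ephi s1; split.
    exact: (expdom_scale (f := fun y => complex.Re ((phi y)%:C * cpow y (s - 1)))).
  exact: (expdom_scale (f := fun y => complex.Im ((phi y)%:C * cpow y (s - 1)))).
have E y : 0 < y -> (phi (c * y))%:C * cpow y (s - 1) =
   cpow c (- (s - 1)) * ((phi (c * y))%:C * cpow (c * y) (s - 1)).
  move=> y0; rewrite cpowMl//.
  have : cpow c (- (s - 1)) * cpow c (s - 1) = 1 by rewrite -cpowD addNr cpow0.
  set u := cpow _ _; set v := cpow c _ => uv.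
  have -> : u * ((phi (c * y))%:C * (v * cpow y (s - 1))) =
    (u * v) * ((phi (c * y))%:C * cpow y (s - 1)) by ring.
  by rewrite uv mul1r.
by apply: eqC; apply: eq_pint => y y0; rewrite E.
Qed.

Lemma mellin_real (R : realType) (phi : R -> R) (s : R) :
  mellin phi s%:C = (pint (fun y => phi y * expR ((s - 1) * ln y)))%:C.
Proof.
apply: eqC.
  transitivity (pint (fun y => complex.Re ((phi y)%:C * cpow y (s%:C - 1)))) => //.
  by apply: eq_pint => y y0; rewrite ReM Re_cpow /= oppr0 addr0 !mul0r cos0; ring.
transitivity (pint (fun y => complex.Im ((phi y)%:C * cpow y (s%:C - 1)))) => //.
transitivity (0 : R) => //; rewrite -[RHS](pint0 R).
by apply: eq_pint => y y0; rewrite ImM Im_cpow /= oppr0 addr0 !mul0r sin0; ring.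
Qed.

Lemma mellin_sum (R : realType) (phi : nat -> R -> R) (s : R[i]) N :
  (forall n, expdom (phi n)) -> 1 < complex.Re s ->
  mellin (fun y => \sum_(0 <= n < N) phi n y) s =
  \sum_(0 <= n < N) mellin (phi n) s.
Proof.
move=> ephi s1; have cd n := mellin_cdom (ephi n) s1.
apply: eqC.
  rewrite Re_sum; transitivity (pint (fun y => \sum_(0 <= n < N)
      complex.Re ((phi n y)%:C * cpow y (s - 1)))).
    apply: eq_pint => y _; rewrite -Re_sum; congr complex.Re.
    by rewrite rmorph_sum mulr_suml.
  by rewrite pint_sum// => n; exact: (cd n).1.
rewrite Im_sum; transitivity (pint (fun y => \sum_(0 <= n < N)
    complex.Im ((phi n y)%:C * cpow y (s - 1)))).
  apply: eq_pint => y _; rewrite -Im_sum; congr complex.Im.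
  by rewrite rmorph_sum mulr_suml.
by rewrite pint_sum// => n; exact: (cd n).2.
Qed.

(* For large real part of s both sides are obtained by integrating the Fourier
   series term by term; the identity theorem does the rest. *)
Theorem mellin_dirichlet (R : realType) (A : nat -> R) (F : R -> R)
    (L : R[i] -> R[i]) (K : R) (k : nat) :
  (forall n, `|A n| <= K * n.+1%:R ^+ k.+1) -> expdom F ->
  (forall y, 0 < y -> (fun N => \sum_(0 <= n < N)
     A n * expR (- (2 * pi * (n.+1%:R * y)))) @ \oo --> F y) ->
  (forall s, exists D, cdiff L s D) ->
  (forall s, k.+3%:R < complex.Re s ->
     sums_to 0 (fun n => (A n)%:C * cpow n.+1%:R (- s)) (L s)) ->
  forall s, 1 < complex.Re s ->
    mellin (fun y => expR (- (2 * pi * y))) s * L s = mellin F s.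
Proof.
move=> HA eF HF dL HL.
have p0 := pi_gt0 R; have pp0 : 0 < 2 * pi :> R by rewrite mulr_gt0.
pose phi y : R := expR (- (2 * pi * y)).
have ephi : expdom phi by exact: expdom_expRN.
suff H : forall s, 1 < complex.Re s -> mellin phi s * L s + -1 * mellin F s = 0.
  by move=> s /H; rewrite mulN1r => /eqP; rewrite subr_eq0 => /eqP.
apply: (@halfplane_identity _ _ 1 k.+3%:R).
  move=> s s1; have [D1 d1] := mellin_cdiff ephi s1.
  have [D2 d2] := mellin_cdiff eF s1; have [D3 d3] := dL s.
  by eexists; exact: cdiffD (cdiffM d1 d3) (cdiffM (cdiff_cst (-1) s) d2).
move=> s sk; have s1 : 1 < complex.Re s.
  by apply: le_lt_trans sk; rewrite ler1n.
apply/eqP; rewrite mulN1r subr_eq0; apply/eqP.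
have ephin n : expdom (fun y => A n * phi (n.+1%:R * y)).
  by apply: expdomZ; exact: (expdom_scale (f := phi)).
have mE n : mellin (fun y => A n * phi (n.+1%:R * y)) s =
    mellin phi s * ((A n)%:C * cpow n.+1%:R (- s)).
  have -> : mellin phi s * ((A n)%:C * cpow n.+1%:R (- s)) =
    (A n)%:C * (cpow n.+1%:R (- s) * mellin phi s) by ring.
  rewrite -mellin_scale// /mellin -cintZ; last first.
    by apply: mellin_cdom => //; exact: (expdom_scale (f := phi)).
  have E y : ((A n * phi (n.+1%:R * y))%:C * cpow y (s - 1)) =
    (A n)%:C * ((phi (n.+1%:R * y))%:C * cpow y (s - 1)).
    by rewrite rmorphM mulrA.
  by apply: eqC; apply: eq_pint => y y0; rewrite E.
pose FN N y := \sum_(0 <= n < N) A n * phi (n.+1%:R * y).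
have C1 : (fun N => mellin (FN N) s : R[i]^o) @ \oo --> (mellin phi s * L s : R[i]^o).
  have -> : (fun N => mellin (FN N) s) =
      (fun N => mellin phi s * \sum_(0 <= n < N) (A n)%:C * cpow n.+1%:R (- s)).
    apply/funext => N; rewrite mellin_sum// mulr_sumr.
    by apply: eq_bigr => n _; exact: mE.
  by apply: (cvgM (cvg_cst (mellin phi s : R[i]^o))); exact: HL.
have [K1 HK1] := powser_growth HA.
pose p := complex.Re s - 1.
(* This is the reason for the threshold k + 3: y^p outweighs the singularity t^-(k+2) of the bound
   for the partial sums. *)
have p1 : k.+2%:R < p by rewrite /p; move: sk; rewrite -natr1; lra.
have pp : 0 < p by apply: lt_trans p1; rewrite ltr0n.
have [W W0 HW] := exp_ln_growth pp p0.
have C2 : (fun N => mellin (FN N) s : R[i]^o) @ \oo --> (mellin F s : R[i]^o).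
  have eg : expdom (fun y => (2 * `|K1| * W) * expR (- (pi * y))).
    by apply: expdomZ; exact: expdom_expRN.
  apply: (cint_dct _ eg).
  - by move=> N; apply: mellin_cdom => //; exact: expdom_sum.
  - move=> y y0.
    apply: (cvgM _ (cvg_cst (cpow y (s - 1) : R[i]^o))).
    apply: cvg_real_complex.
    have := HF y y0.
    by [].
  - move=> N y y0; rewrite cabsM cabs_real cabs_cpow !reimE /= -/p.
    pose t := 2 * pi * y; have t0 : 0 < t by rewrite mulr_gt0.
    have phiE n : phi (n.+1%:R * y) = expR (- t) * expR (- t) ^+ n.
      by rewrite -expRM_natl -expRD /phi /t; congr expR; rewrite -natr1; ring.
    (* Uniform in N; the summand 1 covers t > 4, where the sum is at most its value at t = 4. *)
    have b1 : `|FN N y| <= expR (- t) * (`|K1| * (t^-1 ^+ k.+2 + 1)).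
      apply: (@le_trans _ _ (expR (- t) * \sum_(0 <= n < N) `|A n| * expR (- t) ^+ n)).
        rewrite mulr_sumr; apply: le_trans (ler_norm_sum _ _ _) _.
        apply: ler_sum => n _; rewrite phiE normrM.
        rewrite [`|expR _ * _|]ger0_norm ?mulr_ge0 ?exprn_ge0 ?expR_ge0//.
        by rewrite le_eqVlt; apply/orP; left; apply/eqP; ring.
      rewrite ler_wpM2l ?expR_ge0//.
      have tp : 0 <= t^-1 ^+ k.+2 by rewrite exprn_ge0// invr_ge0 ltW.
      have [t4|t4] := leP t 4.
        apply: le_trans (HK1 t t0 t4 N) _.
        apply: le_trans (ler_wpM2r tp (ler_norm _)) _.
        by rewrite ler_wpM2l// lerDl.
      apply: (@le_trans _ _ (\sum_(0 <= n < N) `|A n| * expR (- 4) ^+ n)).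
        apply: ler_sum => n _; rewrite ler_wpM2l// lerXn2r ?nnegrE ?expR_ge0//.
        by rewrite ler_expR lerN2 ltW.
      apply: le_trans (HK1 4 _ (lexx _) N) _ => //.
      have f4 : (4^-1 : R) ^+ k.+2 <= 1 by rewrite exprn_ile1//; lra.
      have f0 : 0 <= (4^-1 : R) ^+ k.+2 by rewrite exprn_ge0.
      apply: le_trans (ler_wpM2r f0 (ler_norm _)) _.
      by rewrite ler_wpM2l// (le_trans f4)// lerDr.
    apply: le_trans (ler_wpM2r (expR_ge0 _) b1) _.
    set E := expR (p * (ln y + `|ln y|)).
    have e1 : expR (p * ln y) <= E.
      by rewrite ler_expR ler_wpM2l ?(ltW pp)// lerDl.
    (* For y < 1 the product is at most y^(p-k-2) <= 1; for y >= 1 the negative power only helps. *)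
    have e2 : t^-1 ^+ k.+2 * expR (p * ln y) <= E.
      have yE : y^-1 ^+ k.+2 = expR (- (k.+2%:R * ln y)).
        by rewrite expRN expRM_natl lnK ?posrE// exprVn.
      apply: (@le_trans _ _ (y^-1 ^+ k.+2 * expR (p * ln y))).
        rewrite ler_wpM2r ?expR_ge0// lerXn2r ?nnegrE ?invr_ge0 ?(ltW y0) ?(ltW t0)//.
        rewrite lef_pV2 ?posrE// /t ler_peMl ?(ltW y0)//.
        by have := pi_ge2 R; lra.
      rewrite yE -expRD ler_expR.
      have k0 : 0 <= k.+2%:R :> R by [].
      have := normr_ge0 (ln y); have := ler_norm (- ln y); rewrite normrN.
      nra.
    have E0 : 0 < E by exact: expR_gt0.
    have e3 : (t^-1 ^+ k.+2 + 1) * expR (p * ln y) <= 2 * (W * expR (pi * y)).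
      by have := HW y y0; rewrite -/E; lra.
    have -> : expR (- t) * (`|K1| * (t^-1 ^+ k.+2 + 1)) * expR (p * ln y) =
      expR (- t) * `|K1| * ((t^-1 ^+ k.+2 + 1) * expR (p * ln y)) by ring.
    apply: le_trans (ler_wpM2l _ e3) _; first by rewrite mulr_ge0 ?expR_ge0.
    have -> : - (pi * y) = - t + pi * y by rewrite /t; ring.
    by rewrite expRD le_eqVlt; apply/orP; left; apply/eqP; ring.
exact: (cvg_unique (@norm_hausdorff _ R[i]^o) C1 C2).
Qed.

(** * Termwise integration of the double series *)

Lemma exprn_le_fact_expR (R : realType) (z : R) n : 0 <= z ->
  z ^+ n <= n`!%:R * expR z.
Proof.
move=> z0; case: n => [|n].
  by rewrite expr0 fact0 mul1r (le_trans _ (expR_ge1Dx _))// lerDl.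
have h := expR_ge1Dxn n z0.
by rewrite mulrC -ler_pdivrMr ?ltr0n ?fact_gt0//; lra.
Qed.

Lemma inv_exprn_expRN_le (R : realType) (c y : R) n : 0 < c -> 0 < y ->
  y^-1 ^+ n * expR (- (c / y)) <= n`!%:R / c ^+ n.
Proof.
move=> c0 y0; have z0 : 0 <= c / y by rewrite divr_ge0 ?ltW.
have h := exprn_le_fact_expR n z0.
rewrite ler_pdivlMr ?exprn_gt0// expRN.
have -> : y^-1 ^+ n / expR (c / y) * c ^+ n = (c / y) ^+ n / expR (c / y).
  by rewrite exprMn; ring.
by rewrite ler_pdivrMr ?expR_gt0.
Qed.

Lemma measurable_invr_pos (R : realType) :
  measurable_fun (`]0, +oo[ : set R) (fun y : R => y^-1).
Proof.
apply: (@eq_measurable_fun _ _ _ _ _ (fun y : R => expR (- ln y))).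
  by move=> y; rewrite inE/= in_itv/= andbT => y0; rewrite expRN lnK.
apply: measurable_funTS; apply: (measurableT_comp (@measurable_expR R)).
by apply: measurableT_comp => //; exact: measurable_ln.
Qed.

(** The weight [r] may blow up at 0 as long as a part exp(-c/y) of the damping bounds it. *)
Lemma expdom_theta (R : realType) (r : R -> R) (a b c M : R) :
  0 < a -> c <= b -> measurable_fun (`]0, +oo[ : set R) r ->
  (forall y, 0 < y -> 0 <= r y) ->
  (forall y, 0 < y -> r y * expR (- (c / y)) <= M) ->
  expdom (fun y => expR (- (a * y + b / y)) * r y).
Proof.
move=> a0 cb mr r0 hr; split.
  apply: measurable_funM => //; apply: (measurableT_comp (@measurable_expR R)).
  apply: measurableT_comp => //; apply: measurable_funD.
    by apply: measurable_funTS; exact: measurable_funM.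
  by apply: measurable_funM => //; exact: measurable_invr_pos.
exists M, a; split => // y y0.
rewrite ger0_norm ?mulr_ge0 ?expR_ge0 ?r0// opprD expRD -mulrA [leRHS]mulrC.
apply: ler_wpM2l; first exact: expR_ge0.
apply: le_trans (hr y y0); rewrite mulrC; apply: ler_wpM2l; first exact: r0.
by rewrite ler_expR lerN2 ler_wpM2r// invr_ge0 ltW.
Qed.

(** Let B(y) = K exp(d/y - pi y) with d = pi/(2q); it bounds g and all its partial sums. Then B(y)
    B(1/(qy)) = K^2 exp(-pi y/2) exp(-d/y), and the last factor absorbs [r], so the single majorant
    [D] serves the inner and the outer limit. The weight will be 1/sqrt y and 1/y for the two
    values, and y^(-k/2) to control F. *)
Theorem pint_double_sum (R : realType) (C : nat -> R) (g r : R -> R) (q K M : R) :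
  0 < q ->
  (forall y, 0 < y -> forall N,
     \sum_(0 <= m < N) `|C m| * expR (- (2 * pi * y)) ^+ m
       <= K * expR (pi / (2 * q) / y)) ->
  (forall y, 0 < y -> (fun N => \sum_(0 <= m < N)
     C m * expR (- (pi * (2 * m%:R + 1) * y))) @ \oo --> g y) ->
  measurable_fun (`]0, +oo[ : set R) r ->
  (forall y, 0 < y -> 0 <= r y) ->
  (forall y, 0 < y -> r y * expR (- (pi / (2 * q) / y)) <= M) ->
  expdom (fun y => g y * g (q * y)^-1 * r y) /\
  exists2 G : nat -> R,
    forall m, (fun N => \sum_(0 <= n < N) C m * C n *
      pint (fun y => expR (- (pi * (2 * m%:R + 1) * y +
                             pi * (2 * n%:R + 1) / q / y)) * r y)) @ \oo --> G m &
    (fun N => \sum_(0 <= m < N) G m) @ \oo -->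
      pint (fun y => g y * g (q * y)^-1 * r y).
Proof.
move=> q0 hC hg mr r0 hr; have p0 := pi_gt0 R.
set d := pi / (2 * q) in hC hr *.
have d0 : 0 < d by rewrite divr_gt0// mulr_gt0.
pose E m y : R := expR (- (pi * (2 * m%:R + 1) * y)).
have EE m y : E m y = expR (- (pi * y)) * expR (- (2 * pi * y)) ^+ m.
  by rewrite -expRM_natl -expRD /E; congr expR; ring.
pose B y := K * expR (d / y) * expR (- (pi * y)).
have K0 : 0 <= K.
  have := hC 1 ltr01 0%N; rewrite big_geq// => h.
  by move: h; rewrite pmulr_lge0 ?expR_gt0.
have nE m y : `|C m * E m y| = expR (- (pi * y)) * (`|C m| * expR (- (2 * pi * y)) ^+ m).
  by rewrite EE normrM [`|_ * _ ^+ _|]ger0_norm ?mulr_ge0 ?exprn_ge0 ?expR_ge0//; ring.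
have sB y N : 0 < y -> \sum_(0 <= m < N) `|C m * E m y| <= B y.
  move=> y0; under eq_bigr do rewrite nE.
  rewrite -mulr_sumr /B [leRHS]mulrC ler_wpM2l ?expR_ge0//; exact: hC.
pose gN N y := \sum_(0 <= m < N) C m * E m y.
have gNB N y : 0 < y -> `|gN N y| <= B y.
  by move=> y0; apply: le_trans (ler_norm_sum _ _ _) _; exact: sB.
have tB m y : 0 < y -> `|C m * E m y| <= B y.
  move=> y0; apply: le_trans (sB y m.+1 y0); rewrite big_nat_recr//= lerDr.
  by apply: sumr_ge0.
have gB y : 0 < y -> `|g y| <= B y.
  move=> y0; apply: (cvgr_to_le (cvg_norm (hg y y0))); apply: nearW => N.
  exact: gNB.
have B0 y : 0 <= B y by rewrite !mulr_ge0 ?expR_ge0.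
have i0 y : 0 < y -> 0 < (q * y)^-1 by move=> y0; rewrite invr_gt0 mulr_gt0.
pose D y := K ^+ 2 * M * expR (- (pi / 2 * y)).
have eD : expdom D by apply: expdomZ; apply: expdom_expRN; rewrite divr_gt0.
have BB y : 0 < y -> B y * B (q * y)^-1 * r y <= D y.
  move=> y0.
  have -> : B y * B (q * y)^-1 * r y =
     K ^+ 2 * (expR (- (pi / 2 * y)) * (r y * expR (- (d / y)))).
    have -> : - (pi / 2 * y) = d / (q * y)^-1 - pi * y.
      by rewrite invrK /d; field; rewrite lt0r_neq0.
    have -> : - (d / y) = d / y - pi * (q * y)^-1.
      by rewrite /d; field; rewrite !lt0r_neq0.
    by rewrite /B !expRD; ring.
  rewrite /D -[leRHS]mulrA; apply: ler_wpM2l; first exact: sqr_ge0.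
  by rewrite mulrC; apply: ler_wpM2r; [exact: expR_ge0|exact: hr].
have dom x z y : 0 < y -> `|x| <= B y -> `|z| <= B (q * y)^-1 -> `|x * z * r y| <= D y.
  move=> y0 hx hz; apply: le_trans (BB y y0).
  rewrite normrM (ger0_norm (r0 y y0)) ler_wpM2r ?r0// normrM.
  by rewrite ler_pM.
have mE' m : measurable_fun (`]0, +oo[ : set R) (E m).
  apply: measurable_funTS.
  apply: (measurableT_comp (@measurable_expR R)).
  by apply: measurableT_comp => //; exact: measurable_funM.
have mEi' m : measurable_fun (`]0, +oo[ : set R) (fun y => E m (q * y)^-1).
  apply: (measurableT_comp (@measurable_expR R)).
  apply: measurableT_comp => //; apply: measurable_funM => //.
  have -> : (fun y : R => (q * y)^-1) = (fun y => q^-1 * y^-1).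
    by apply/funext => y; rewrite invfM.
  by apply: measurable_funM => //; exact: measurable_invr_pos.
have mE m : measurable_fun (`]0, +oo[ : set R) (fun y => C m * E m y).
  exact: measurable_funM.
have mEi m : measurable_fun (`]0, +oo[ : set R) (fun y => C m * E m (q * y)^-1).
  exact: measurable_funM.
have mgi N : measurable_fun (`]0, +oo[ : set R) (fun y => gN N (q * y)^-1).
  by apply: measurable_sum => m; exact: mEi.
have mgl : measurable_fun (`]0, +oo[ : set R) (fun y => g (q * y)^-1).
  apply: (measurable_fun_cvg mgi) => y; rewrite /= in_itv/= andbT => y0.
  exact/hg/i0.
pose f m y := C m * E m y * g (q * y)^-1 * r y.
have eterm m n : expdom (fun y => C m * E m y * (C n * E n (q * y)^-1) * r y).
  split; first by apply: measurable_funM => //; exact: measurable_funM.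
  have [_ [C' [b [b0 HD]]]] := eD; exists C', b; split => // y y0.
  apply: le_trans (dom _ _ y y0 (tB m y y0) (tB n _ (i0 y y0))) _.
  exact: le_trans (ler_norm _) (HD y y0).
have eh m n : expdom (fun y => expR (- (pi * (2 * m%:R + 1) * y +
                             pi * (2 * n%:R + 1) / q / y)) * r y).
  have n0 : 0 <= n%:R :> R by [].
  have m0 : 0 <= m%:R :> R by [].
  apply: expdom_theta mr r0 hr; first by rewrite mulr_gt0//; lra.
  rewrite /d invfM mulrA ler_pM2r ?invr_gt0// ler_pM2l//; lra.
have step1 m : expdom (f m) /\ (fun N => \sum_(0 <= n < N) C m * C n *
      pint (fun y => expR (- (pi * (2 * m%:R + 1) * y +
                             pi * (2 * n%:R + 1) / q / y)) * r y)) @ \oo --> pint (f m).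
  have [H1 H2] := @pint_dct R (fun N y => C m * E m y * gN N (q * y)^-1 * r y) (f m) D
    (fun N => measurable_funM (measurable_funM (mE m) (mgi N)) mr) eD
    (fun y y0 => cvgM (cvgM (cvg_cst _) (hg _ (i0 y y0))) (cvg_cst _))
    (fun N y y0 => dom _ _ y y0 (tB m y y0) (gNB N _ (i0 y y0))).
  split => //; apply: cvg_trans H2; apply: near_eq_cvg; apply: nearW => N.
  have -> : pint (fun y => C m * E m y * gN N (q * y)^-1 * r y) =
    \sum_(0 <= n < N) pint (fun y => C m * E m y * (C n * E n (q * y)^-1) * r y).
    rewrite -pint_sum//; apply: eq_pint => y _.
    by rewrite /gN mulr_sumr mulr_suml.
  apply: eq_bigr => n _.
  rewrite -pintZ//; apply: eq_pint => y y0.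
  have -> : C m * E m y * (C n * E n (q * y)^-1) * r y =
    C m * C n * (E m y * E n (q * y)^-1 * r y) by ring.
  by rewrite /E -expRD; congr (_ * (expR _ * _)); rewrite invfM; ring.
have em m : expdom (f m) by have [] := step1 m.
have mgN N : measurable_fun (`]0, +oo[ : set R) (gN N).
  by apply: measurable_sum => m; exact: mE.
(* [step1] summed over n with m fixed; here the first factor is the partial sum over m and the
   second is already g(1/(qy)). *)
have [H1 H2] := @pint_dct R (fun N y => gN N y * g (q * y)^-1 * r y) _ D
    (fun N => measurable_funM (measurable_funM (mgN N) mgl) mr) eD
    (fun y y0 => cvgM (cvgM (hg y y0) (cvg_cst _)) (cvg_cst _))
    (fun N y y0 => dom _ _ y y0 (gNB N y y0) (gB _ (i0 y y0))).
split => //; exists (fun m => pint (f m)); first by move=> m; have [] := step1 m.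
apply: cvg_trans H2; apply: near_eq_cvg; apply: nearW => N.
rewrite -pint_sum//; apply: eq_pint => y _.
by rewrite /gN !mulr_suml.
Qed.

(** * The Gamma function and the Bessel function of order 0 *)

Lemma eq_expdom (R : realType) (f g : R -> R) :
  (forall y, 0 < y -> f y = g y) -> expdom f -> expdom g.
Proof.
move=> fg [mf [C [b [b0 H]]]]; split.
  apply: (eq_measurable_fun f) => // y.
  by rewrite inE/= in_itv/= andbT => /fg.
by exists C, b; split => // y y0; rewrite -fg// H.
Qed.

Lemma expdom_power (R : realType) (phi : R -> R) (p : R) : expdom phi -> 0 < p ->
  expdom (fun y => phi y * expR (p * ln y)).
Proof.
move=> ephi p0; have s1 : 1 < complex.Re ((1 + p)%:C : R[i]) by rewrite /= ltrDl.
apply: eq_expdom (mellin_cdom ephi s1).1 => y y0.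
rewrite ReM Re_cpow /= oppr0 addr0 !mul0r cos0 subr0 mulr1.
by congr (_ * expR (_ * _)); ring.
Qed.

Lemma GammaE (R : realType) (s : R) : 1 < s ->
  Gamma s = pint (fun t => expR (- (1 * t)) * expR ((s - 1) * ln t)).
Proof.
move=> s1; apply: eq_pint => t t0.
by rewrite mul1r mulrC /powR gt_eqF.
Qed.

Lemma Gamma_gt0 (R : realType) (s : R) : 1 < s -> 0 < Gamma s.
Proof.
move=> s1; rewrite GammaE//; have s2 : 0 < s - 1 by rewrite subr_gt0.
(* On [1, 2] the power of t is at least 1 and exp(-t) is at least exp(-2), which gives a positive
   lower bound. *)
pose u : R -> R := (fun=> expR (- 2)) \_ `[1, 2].
have sub : `[1, 2]%classic `<=` (`]0, +oo[%classic : set R).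
  by move=> y; rewrite /= !in_itv/= andbT => /andP[h _]; exact: lt_le_trans h.
have uE t : u t <= expR (- (1 * t)) /\ 0 <= u t.
  rewrite /u patchE; case: ifPn => [|_]; last by rewrite expR_ge0.
  by rewrite inE/= in_itv/= => /andP[_ t2]; rewrite ler_expR mul1r lerN2 t2 expR_ge0.
have eu : expdom u.
  split; first by apply/measurable_restrict => //; exact: measurable_cst.
  exists 1, 1; split => // t t0; have [h1 h2] := uE t.
  by rewrite ger0_norm// [leRHS]mul1r.
have eh := expdom_power (expdom_expRN (@ltr01 R)) s2.
apply: (@lt_le_trans _ _ (pint u)); last first.
  apply: le_pint => // t t0; have [h1 h2] := uE t.
  have [t1|t1] := leP 1 t.
    rewrite (le_trans h1)// ler_peMr ?expR_ge0//.
    by rewrite -[leLHS]expR0 ler_expR mulr_ge0 ?(ltW s2)// ln_ge0.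
  have -> : u t = 0 by rewrite /u patchE memNset//= in_itv/= leNgt t1.
  by rewrite mulr_ge0 ?expR_ge0.
rewrite /pint -Rintegral_mkcondr setIidr// Rintegral_cst//=.
rewrite lebesgue_measure_itv/= lte_fin ltr1n/= mulr_gt0 ?expR_gt0//; lra.
Qed.

Lemma mellin_expRN (R : realType) (s : R) : 1 < s ->
  mellin (fun y => expR (- (2 * pi * y))) s%:C =
  ((2 * pi) `^ (- s) * Gamma s)%:C.
Proof.
move=> s1; have s2 : 0 < s - 1 by rewrite subr_gt0.
have p2 : 0 < 2 * pi :> R by rewrite mulr_gt0// pi_gt0.
rewrite mellin_real GammaE//; congr (_%:C).
pose h t : R := expR (- (1 * t)) * expR ((s - 1) * ln t).
have eh : expdom h by apply: expdom_power => //; exact: expdom_expRN.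
have H := pint_scale p2 eh; rewrite -/h.
have -> : pint h = 2 * pi * pint (fun y => h (2 * pi * y)).
  by rewrite H mulrA divff ?mul1r// gt_eqF.
rewrite mulrA.
have -> : (2 * pi) `^ (- s) * (2 * pi) = expR (- ((s - 1) * ln (2 * pi))) :> R.
  rewrite /powR gt_eqF// -{2}(lnK (x := 2 * pi)) ?posrE// -expRD.
  by congr expR; ring.
rewrite -pintZ; last exact: expdom_scale.
apply: eq_pint => y y0.
have lE : ln (2 * pi * y) = ln (2 * pi) + ln y by rewrite [LHS]lnM ?posrE.
rewrite /h lE mul1r.
rewrite [(s - 1) * (_ + _)]mulrDr expRD.
set u := (s - 1) * ln (2 * pi); set X := expR (- _); set Z := expR _.
have -> : expR (- u) * (X * (expR u * Z)) = expR u * expR (- u) * (X * Z) by ring.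
by rewrite expRxMexpNx_1 mul1r.
Qed.

Lemma besselK0E (R : realType) (x : R) :
  besselK 0 x = (2^-1 * pint (fun t => expR (- (x / 2 * (t + t^-1))) * t^-1))%:C.
Proof.
rewrite rmorphM/= fmorphV rmorph_nat /besselK; congr (_ * _).
have E (t : R) : (expR (- (x / 2 * (t + t^-1))))%:C * cpow t (- 0) * (t^-1)%:C =
    (expR (- (x / 2 * (t + t^-1))) * t^-1)%:C.
  by rewrite oppr0 cpow0 mulr1 rmorphM.
apply: eqC.
  by apply: eq_pint => t _; rewrite E.
transitivity (0 : R) => //; rewrite -[RHS](pint0 R).
by apply: eq_pint => t _; rewrite E.
Qed.

(** The substitution y = (b/a) t turns both a^2 y + b^2/y into ab (t + 1/t) and dy/y into dt/t; the
    factor 2 undoes the 1/2 in the definition of K. *)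
Lemma pint_besselK0 (R : realType) (a b : R) : 0 < a -> 0 < b ->
  (pint (fun y => expR (- (a ^+ 2 * y + b ^+ 2 / y)) * y^-1))%:C =
  2 * besselK 0 (2 * (a * b)).
Proof.
move=> a0 b0; rewrite besselK0E -[2 in RHS](rmorph_nat (real_complex R) 2) -rmorphM.
congr (_%:C); rewrite [RHS]mulrA divff// mul1r.
have ef : expdom (fun y => expR (- (a ^+ 2 * y + b ^+ 2 / y)) * y^-1).
  apply: (expdom_theta (c := b ^+ 2) (M := 1`!%:R / (b ^+ 2) ^+ 1)) => //.
  - by rewrite exprn_gt0.
  - exact: measurable_invr_pos.
  - by move=> y y0; rewrite invr_ge0 ltW.
  - by move=> y y0; rewrite -[y^-1]expr1 inv_exprn_expRN_le// exprn_gt0.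
have l0 : 0 < b / a by rewrite divr_gt0.
have H := pint_scale l0 ef.
rewrite -[LHS](mulVKf (lt0r_neq0 l0)) -H -pintZ; last first.
  exact: (expdom_scale (f := fun y => expR (- (a ^+ 2 * y + b ^+ 2 / y)) * y^-1)).
apply: eq_pint => t t0.
have -> : - (a ^+ 2 * (b / a * t) + b ^+ 2 / (b / a * t)) =
    - (2 * (a * b) / 2 * (t + t^-1)).
  by field; rewrite !lt0r_neq0.
by field; rewrite !lt0r_neq0.
Qed.

Lemma inv_sqrt_expRN_le (R : realType) (c y : R) : 0 < c -> 0 < y ->
  (Num.sqrt y)^-1 * expR (- (c / y)) <= 1 + 1`!%:R / c ^+ 1.
Proof.
move=> c0 y0; have h := inv_exprn_expRN_le 1 c0 y0.
have e1 : expR (- (c / y)) <= 1.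
  by rewrite expR_le1 oppr_le0 divr_ge0 ?ltW.
have e0 := expR_ge0 (- (c / y)).
have i0 : 0 < y^-1 by rewrite invr_gt0.
have s1 : (Num.sqrt y)^-1 <= 1 + y^-1.
  rewrite -sqrtrV ?(ltW y0)//; have s0 := sqrtr_ge0 y^-1.
  have := sqr_sqrtr (ltW i0); nra.
apply: le_trans (ler_wpM2r e0 s1) _.
by rewrite mulrDl mul1r lerD.
Qed.

Lemma measurable_inv_sqrt_pos (R : realType) :
  measurable_fun (`]0, +oo[ : set R) (fun y : R => (Num.sqrt y)^-1).
Proof.
apply: (@eq_measurable_fun _ _ _ _ _ (fun y : R => Num.sqrt y^-1)).
  by move=> y; rewrite inE/= in_itv/= andbT => y0; rewrite sqrtrV// ltW.
have ms : measurable_fun [set: R] (@Num.sqrt R).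
  by apply: continuous_measurable_fun => x; exact: sqrt_continuous.
exact: (measurableT_comp ms (@measurable_invr_pos R)).
Qed.

Lemma pint_half_bessel (R : realType) (a b : R) : 0 < a -> 0 < b ->
  pint (fun y => expR (- (a ^+ 2 * y + b ^+ 2 / y)) * (Num.sqrt y)^-1) =
  Num.sqrt pi / a * expR (- (2 * a * b)).
Proof.
move=> a0 b0; apply: half_bessel => //.
apply: (expdom_theta (c := b ^+ 2) (M := 1 + 1`!%:R / (b ^+ 2) ^+ 1)) => //.
- by rewrite exprn_gt0.
- exact: measurable_inv_sqrt_pos.
- by move=> y y0; apply: inv_sqrt_expRN_le => //; rewrite exprn_gt0.
Qed.

(** * Restriction to the imaginary axis *)

(** The order of [R[i]] is partial: 0 < z already says that z is real. *)
Lemma gt0_complexE (R : realType) (z : R[i]) : 0 < z ->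
  z = (complex.Re z)%:C /\ 0 < complex.Re z.
Proof. by case: z => a b; rewrite ltcE /= => /andP[/eqP -> a0]. Qed.

Lemma fourier_imaginary_axis (R : realType) (f : R[i] -> R[i]) (a : nat -> R[i]) :
  fourier_expansion f a -> (forall y : R, 0 < y -> 0 < f (0 +i* y)) ->
  (forall n, a n.+1 = (complex.Re (a n.+1))%:C) /\
  (forall y : R, 0 < y -> (fun N => \sum_(0 <= n < N)
     complex.Re (a n.+1) * expR (- (2 * pi * y)) ^+ n) @ \oo -->
     expR (2 * pi * 1 * y) * complex.Re (f (0 +i* y))).
Proof.
move=> ffou fpos; apply: (exp_series_real (u := fun n => a n.+1)) => y y0.
have [fE _] := gt0_complexE (fpos y y0); rewrite -fE.
have -> : (fun n => a n.+1 * (expR (- (2 * pi * (n%:R + 1) * y)))%:C) =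
    (fun n => a n.+1 * cexp ((2 * pi * n.+1%:R)%:C * 'i * (0 +i* y))).
  apply/funext => n; rewrite -cexp_real; congr (_ * cexp _).
  by apply: eqC; rewrite !reimE /= -?[n.+1%:R]natr1; ring.
exact: sums_to_shift (ffou (0 +i* y) y0).
Qed.

Lemma powser_unit_interval (R : realType) (u : nat -> R) (H : R -> R) :
  (forall y, 0 < y ->
     (fun N => \sum_(0 <= n < N) u n * expR (- (2 * pi * y)) ^+ n) @ \oo --> H y) ->
  forall x, 0 < x < 1 ->
    (fun N => \sum_(0 <= n < N) u n * x ^+ n) @ \oo --> H (- ln x / (2 * pi)).
Proof.
move=> uH x /andP[x0 x1]; pose y := - ln x / (2 * pi).
have p0 := pi_gt0 R.
have y0 : 0 < y by rewrite divr_gt0 ?mulr_gt0// oppr_gt0 ln_lt0// x0.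
have xE : expR (- (2 * pi * y)) = x.
  have -> : - (2 * pi * y) = ln x.
    by rewrite /y mulrC divfK ?opprK// lt0r_neq0// mulr_gt0.
  by rewrite lnK ?posrE.
by have := uH y y0; rewrite xE.
Qed.

Lemma invr_half_expR (R : realType) (k : nat) (y : R) : (2 %| k)%N -> 0 < y ->
  y^-1 ^+ k./2 = expR (- (k%:R / 2 * ln y)).
Proof.
move=> k2 y0; have kE : (k./2).*2 = k by apply: even_halfK; rewrite -dvdn2.
have -> : k%:R / 2 = (k./2)%:R :> R by rewrite -{1}kE -mul2n natrM; field.
by rewrite expRN expRM_natl lnK ?posrE// exprVn.
Qed.

(** Since i^4 = 1, (iy)^k is real and positive, so the Fricke relation becomes an identity of
    positive reals and can be halved after taking logarithms. *)
Lemma fricke_imaginary_axis (R : realType) (k q : nat) (f : R[i] -> R[i]) :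
  (4 %| k)%N -> (0 < q)%N ->
  (forall z, upper_half z -> fricke k q f z = f z) ->
  (forall y : R, 0 < y -> 0 < f (0 +i* y)) ->
  forall y : R, 0 < y ->
    let g t := expR (1 / 2 * ln (complex.Re (f (0 +i* t)))) in
    complex.Re (f (0 +i* y)) =
    g y * g (q%:R * y)^-1 * (q%:R `^ (- (k%:R / 4)) * y^-1 ^+ k./2).
Proof.
move=> k4 q0 ffr fpos y y0 g.
have q0r : 0 < q%:R :> R by rewrite ltr0n.
pose F t := complex.Re (f (0 +i* t)).
have F0 t : 0 < t -> 0 < F t by move=> /fpos/gt0_complexE[].
have y1 : 0 < (q%:R * y)^-1 by rewrite invr_gt0 mulr_gt0.
have FE : F y = q%:R `^ (- (k%:R / 2)) * y^-1 ^+ k * F (q%:R * y)^-1.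
  rewrite /F -(ffr (0 +i* y)) //= /fricke.
  have -> : - (q%:R * (0 +i* y))^-1 = 0 +i* (q%:R * y)^-1 :> R[i].
    have yq : (q%:R : R[i]) = (q%:R)%:C by rewrite rmorph_nat.
    apply: (@mulfI _ (q%:R * (0 +i* y))).
      by rewrite yq eq_complex !reimE /= !mul0r mulr0 subr0 eqxx addr0 gt_eqF// mulr_gt0.
    rewrite mulrN divff; last first.
      by rewrite yq eq_complex !reimE /= !mul0r mulr0 subr0 eqxx addr0 gt_eqF// mulr_gt0.
    by rewrite yq; apply: eqC; rewrite !reimE /=; field; rewrite !lt0r_neq0.
  have -> : ((0 +i* y) ^- k : R[i]) = (y^-1 ^+ k)%:C.
    have [j ->] : exists j, k = (4 * j)%N.
      by case/dvdnP: k4 => j ->; exists j; rewrite mulnC.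
    rewrite exprM [in RHS]exprM.
    have -> : (0 +i* y) ^+ 4 = (y ^+ 4)%:C :> R[i].
      by apply: eqC; rewrite !exprS expr0 !reimE /=; ring.
    by rewrite -rmorphXn/= -fmorphV/= [y^-1 ^+ 4]exprVn exprVn.
  have [fE _] := gt0_complexE (fpos _ y1).
  by rewrite fE -!rmorphM.
have lF : ln (F y) = - (k%:R / 2) * ln q%:R - k%:R * ln y + ln (F (q%:R * y)^-1).
  have F1 := F0 _ y1.
  have Q0 : 0 < q%:R `^ (- (k%:R / 2)) :> R by rewrite powR_gt0.
  have Y0 : 0 < y^-1 ^+ k by rewrite exprn_gt0// invr_gt0.
  rewrite FE lnM ?posrE ?mulr_gt0// lnM ?posrE// ln_powR lnXn ?invr_gt0// lnV ?posrE//.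
  by rewrite -mulr_natl; ring.
rewrite /g -/(F y) -/(F _) -[LHS](lnK (x := F y)) ?posrE ?F0//.
rewrite invr_half_expR//; last exact: dvdn_trans k4.
rewrite /powR gt_eqF// -!expRD; congr expR.
(* Of the two halves of ln F(y), the first is kept as g(y) and only the second is replaced by the
   Fricke relation. *)
by rewrite {1}(_ : ln (F y) = 1 / 2 * ln (F y) + 1 / 2 * ln (F y)); [rewrite {2}lF; field|field].
Qed.

(** At s = k + 1, inside the half-plane of convergence, the terms a(n) n^-(k+1) tend to 0 and are
    therefore bounded. *)
Lemma dirichlet_coef_bound (R : realType) (k : nat) (A : nat -> R) (a : nat -> R[i])
    (L : R[i] -> R[i]) : (0 < k)%N ->
  (forall n, a n.+1 = (A n)%:C) -> entire_continuation k a L ->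
  exists K : R, forall n, `|A n| <= K * n.+1%:R ^+ k.+1.
Proof.
move=> k0 aA [_ HL].
have k1 : 1 <= k%:R :> R by rewrite ler1n.
have sk : (k%:R + 1) / 2 < complex.Re ((k.+1%:R)%:C : R[i]).
  by rewrite /= -[k.+1%:R]natr1; lra.
have H := sums_to_Re (sums_to_shift (HL _ sk)).
have E n : complex.Re (a n.+1 * cpow n.+1%:R (- (k.+1%:R)%:C)) =
    A n / n.+1%:R ^+ k.+1.
  rewrite aA ReM Re_cpow /= oppr0 mul0r cos0 mul0r subr0 mulr1 mulNr expRN.
  by rewrite expRM_natl lnK ?posrE.
have H' : (fun N => \sum_(0 <= n < N) A n / n.+1%:R ^+ k.+1) @ \oo -->
    complex.Re (L (k.+1%:R)%:C).
  by move: H; under eq_fun do under eq_bigr do rewrite E.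
have /cvgP/cvg_seq_bounded/pinfty_ex_gt0[B B0 HB] :=
  cvg_series_cvg_0 (cvgP _ H' : cvgn (series (fun n => A n / n.+1%:R ^+ k.+1 : R^o))).
exists B => n; have := HB n I; rewrite /= normrM normfV [`|_ ^+ _|]ger0_norm ?exprn_ge0//.
by rewrite ler_pdivrMr// exprn_gt0.
Qed.

(** The two formulas differ only in the weight r(y) = y^(-k/2) y^(s-1), so the Mellin identity and
    the double sum are combined once, for a general [r]. *)
Lemma central_value (R : realType) (A C : nat -> R) (F g r : R -> R)
    (L : R[i] -> R[i]) (k q : nat) (K Kc M s : R) :
  (0 < q)%N -> 1 < s ->
  (forall n, `|A n| <= K * n.+1%:R ^+ k.+1) ->
  (forall y, 0 < y -> (fun N => \sum_(0 <= n < N)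
     A n * expR (- (2 * pi * (n.+1%:R * y)))) @ \oo --> F y) ->
  (forall z, exists D, cdiff L z D) ->
  (forall z, k.+3%:R < complex.Re z ->
     sums_to 0 (fun n => (A n)%:C * cpow n.+1%:R (- z)) (L z)) ->
  (forall y, 0 < y -> forall N,
     \sum_(0 <= m < N) `|C m| * expR (- (2 * pi * y)) ^+ m
       <= Kc * expR (pi / (2 * q%:R) / y)) ->
  (forall y, 0 < y -> (fun N => \sum_(0 <= m < N)
     C m * expR (- (pi * (2 * m%:R + 1) * y))) @ \oo --> g y) ->
  (forall y, 0 < y -> F y =
     g y * g (q%:R * y)^-1 * (q%:R `^ (- (k%:R / 4)) * y^-1 ^+ k./2)) ->
  measurable_fun (`]0, +oo[ : set R) r ->
  (forall y, 0 < y -> 0 <= r y) ->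
  (forall y, 0 < y -> r y * expR (- (pi / (2 * q%:R) / y)) <= M) ->
  (forall y, 0 < y -> y^-1 ^+ k./2 * expR ((s - 1) * ln y) = r y) ->
  exists2 G : nat -> R,
    forall m, (fun N => \sum_(0 <= n < N) C m * C n *
      pint (fun y => expR (- (pi * (2 * m%:R + 1) * y +
                             pi * (2 * n%:R + 1) / q%:R / y)) * r y)) @ \oo --> G m &
    exists2 S : R, (fun N => \sum_(0 <= m < N) G m) @ \oo --> S &
      L s%:C = ((2 * pi) `^ s / (q%:R `^ (k%:R / 4) * Gamma s) * S)%:C.
Proof.
move=> q0 s1 HA HF dL HL hC hg FE mr r0 hr rE.
have q0r : 0 < q%:R :> R by rewrite ltr0n.
have d0 : 0 < pi / (2 * q%:R) :> R by rewrite divr_gt0 ?pi_gt0// mulr_gt0.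
have [egr [G HG1 HG2]] := pint_double_sum q0r hC hg mr r0 hr.
exists G => //; exists (pint (fun y => g y * g (q%:R * y)^-1 * r y)) => //.
(* The double-sum theorem with weight y^(-k/2) shows in particular that F is bounded at 0. *)
have eF : expdom F.
  have m1 : measurable_fun (`]0, +oo[ : set R) (fun y => y^-1 ^+ k./2).
    by apply: measurable_funX; exact: measurable_invr_pos.
  have m2 (y : R) : 0 < y -> 0 <= y^-1 ^+ k./2.
    by move=> y0; rewrite exprn_ge0// invr_ge0 ltW.
  have [e1 _] := pint_double_sum q0r hC hg m1 m2 (fun y y0 => inv_exprn_expRN_le k./2 d0 y0).
  apply: eq_expdom (expdomZ (q%:R `^ (- (k%:R / 4))) e1) => y y0.
  by rewrite FE//; ring.
have H : ((2 * pi) `^ (- s) * Gamma s)%:C * L s%:C =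
    (q%:R `^ (- (k%:R / 4)) * pint (fun y => g y * g (q%:R * y)^-1 * r y))%:C.
  rewrite -mellin_expRN// (mellin_dirichlet HA eF HF dL HL)// mellin_real -pintZ//.
  by congr (_%:C); apply: eq_pint => y y0; rewrite FE// -rE//; ring.
have P0 : 0 < (2 * pi) `^ (- s) :> R by rewrite powR_gt0// mulr_gt0// pi_gt0.
have Q0 : 0 < q%:R `^ (k%:R / 4) :> R by rewrite powR_gt0.
have G0 := Gamma_gt0 s1.
have U0 : ((2 * pi) `^ (- s) * Gamma s)%:C != 0 :> R[i].
  by rewrite (inj_eq (@complexI R)) lt0r_neq0// mulr_gt0.
apply: (mulfI U0); rewrite H -rmorphM; congr (_%:C).
by rewrite !powRN in P0 *; field; rewrite !lt0r_neq0// powR_gt0 ?mulr_gt0 ?pi_gt0.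
Qed.

(** * Assembly of the two values *)

Lemma cvg_sumZ (R : realType) (x : R) (u v : nat -> R) (l : R) :
  (forall n, v n = x * u n) ->
  (fun N => \sum_(0 <= n < N) u n) @ \oo --> l ->
  (fun N => \sum_(0 <= n < N) v n) @ \oo --> x * l.
Proof.
move=> vE ul; have -> : (fun N => \sum_(0 <= n < N) v n) =
    (fun N => x * \sum_(0 <= n < N) u n).
  by apply/funext => N; rewrite mulr_sumr; apply: eq_bigr => n _; rewrite vE.
by apply: cvgM => //; exact: cvg_cst.
Qed.

(** Derives the real-variable hypotheses of [central_value] from the form f; the integrals are left
    unevaluated, since their closed form depends on [r]. *)
Lemma weighted_central_value (R : realType) (k q : nat) (f : R[i] -> R[i])
    (a c : nat -> R[i]) (L : R[i] -> R[i]) (r : R -> R) (M s : R) :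
  (0 < k)%N -> (4 %| k)%N -> (0 < q)%N -> fourier_expansion f a ->
  (forall z, upper_half z -> fricke k q f z = f z) ->
  (forall y : R, 0 < y -> 0 < f (0 +i* y)) ->
  entire_continuation k a L -> power_expansion f a (1 / 2) c -> 1 < s ->
  measurable_fun (`]0, +oo[ : set R) r ->
  (forall y, 0 < y -> 0 <= r y) ->
  (forall y, 0 < y -> r y * expR (- (pi / (2 * q%:R) / y)) <= M) ->
  (forall y, 0 < y -> y^-1 ^+ k./2 * expR ((s - 1) * ln y) = r y) ->
  exists2 S : R, double_sums_to (fun m n => c m * c n *
      (pint (fun y => expR (- (pi * (2 * m%:R + 1) * y +
                               pi * (2 * n%:R + 1) / q%:R / y)) * r y))%:C) S%:C &
    L s%:C = ((2 * pi) `^ s / (q%:R `^ (k%:R / 4) * Gamma s) * S)%:C.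
Proof.
move=> k0 k4 q0 ffou ffr fpos Lc [_ cexpn] s1 mr r0 hr rE.
have p0 := pi_gt0 R; have q0r : 0 < q%:R :> R by rewrite ltr0n.
have [aR HA] := fourier_imaginary_axis ffou fpos.
have [cR HC] := exp_series_real cexpn.
set F := fun y => complex.Re (f (0 +i* y)); pose g y := expR (1 / 2 * ln (F y)).
have F0 y : 0 < y -> 0 < F y by move=> /fpos/gt0_complexE[].
set A := fun n => complex.Re (a n.+1) in HA *; set C := fun n => complex.Re (c n) in HC *.
have HC1 := powser_unit_interval HC.
have HA1 := powser_unit_interval HA.
(* In x = exp(-2 pi y), the series of [C] sums to exp(pi y) g(y) and that of [A] to exp(2 pi y)
   F(y), which is its square. *)
have conv n : \sum_(0 <= i < n.+1) C i * C (n - i)%N = A n.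
  apply: powser_sqr_coef HC1 _ n => x x01; move: (HA1 x x01); congr (_ --> _).
  have y0 : 0 < - ln x / (2 * pi) by rewrite divr_gt0 ?mulr_gt0// oppr_gt0 ln_lt0.
  rewrite exprMn -!expRM_natl -[X in _ * X](lnK (x := F _)) ?posrE ?F0//.
  by rewrite /F; move: (_ / (2 * pi)) => y; congr (expR _ * expR _); field.
have [K hK] := dirichlet_coef_bound k0 aR Lc.
have Cb (x : R) : 0 < x < 1 -> exists S, forall N, \sum_(0 <= n < N) `|C n| * x ^+ n <= S.
  by apply: powser_abs_bounded => t t01; apply/cvg_ex; eexists; exact: HC1.
have d0 : 0 < pi / (2 * q%:R) :> R by rewrite divr_gt0 ?mulr_gt0.
have [Kc hC] := sqrt_powser_growth Cb conv hK d0.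
have hg (y : R) : 0 < y -> (fun N => \sum_(0 <= m < N)
    C m * expR (- (pi * (2 * m%:R + 1) * y))) @ \oo --> g y.
  move=> y0; have -> : g y = expR (- (2 * pi * (1 / 2) * y)) *
      (expR (2 * pi * (1 / 2) * y) * g y).
    by rewrite mulrA -expRD addNr expR0 mul1r.
  apply: cvg_sumZ (HC y y0) => n; rewrite [RHS]mulrCA -expRM_natl.
  by congr (_ * _); rewrite -expRD; congr expR; field.
have HF (y : R) : 0 < y -> (fun N => \sum_(0 <= n < N)
    A n * expR (- (2 * pi * (n.+1%:R * y)))) @ \oo --> F y.
  move=> y0; have -> : F y = expR (- (2 * pi * 1 * y)) * (expR (2 * pi * 1 * y) * F y).
    by rewrite mulrA -expRD addNr expR0 mul1r.
  apply: cvg_sumZ (HA y y0) => n; rewrite [RHS]mulrCA -expRM_natl.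
  by congr (_ * _); rewrite -expRD; congr expR; rewrite -[n.+1%:R]natr1; ring.
have dL z : exists D, cdiff L z D by apply: complex_derivable_cdiff; exact: Lc.1.
have HL z : k.+3%:R < complex.Re z ->
    sums_to 0 (fun n => (A n)%:C * cpow n.+1%:R (- z)) (L z).
  move=> kz; have H : (k%:R + 1) / 2 < complex.Re z.
    have kr : 0 <= k%:R :> R by [].
    by apply: le_lt_trans kz; rewrite -addn3 natrD; lra.
  have := sums_to_shift (Lc.2 z H); congr (sums_to _ _ _).
  by apply/funext => n; rewrite aR.
have FE := fricke_imaginary_axis k4 q0 ffr fpos.
have [G hG [S hS LS]] := central_value q0 s1 hK HF dL HL hC hg FE mr r0 hr rE.
exists S => //; exists (fun m => (G m)%:C); last exact: sums_to_real.
move=> m; have := sums_to_real (hG m); congr (sums_to _ _ _).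
by apply/funext => n; rewrite [in RHS](cR m) [in RHS](cR n) rmorphM; congr (_ * _); rewrite rmorphM.
Qed.

(** This is the quantity 2ab of the Bessel integrals for a^2 = pi u and b^2 = pi v/q, where u = 2m+1
    and v = 2n+1. *)
Lemma sqrt_lattice (R : realType) (p q u v : R) : 0 < p -> 0 < q -> 0 < u -> 0 < v ->
  2 * (Num.sqrt (p * u) * Num.sqrt (p * v / q)) =
  2 * p / Num.sqrt q * Num.sqrt (u * v).
Proof.
move=> p0 q0 u0 v0; rewrite (sqrtrM _ (ltW p0)) (sqrtrM _ (mulr_ge0 (ltW p0) (ltW v0))).
rewrite (sqrtrM _ (ltW p0)) (sqrtrM _ (ltW u0)) sqrtrV ?ltW// -[in RHS](sqr_sqrtr (ltW p0)).
rewrite expr2; move: (Num.sqrt _) (Num.sqrt _) (Num.sqrt _) (Num.sqrt _)^-1 => w x y z.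
by ring.
Qed.

Lemma pint_half_bessel_lattice (R : realType) (q u v : R) :
  0 < q -> 0 < u -> 0 < v ->
  pint (fun y => expR (- (pi * u * y + pi * v / q / y)) * (Num.sqrt y)^-1) =
  expR (- (2 * pi / Num.sqrt q * Num.sqrt (u * v))) / Num.sqrt u.
Proof.
move=> q0 u0 v0; have p0 := pi_gt0 R.
have pu : 0 < pi * u by rewrite mulr_gt0.
have pv : 0 < pi * v / q by rewrite divr_gt0// mulr_gt0.
have := @pint_half_bessel R (Num.sqrt (pi * u)) (Num.sqrt (pi * v / q)).
rewrite !sqr_sqrtr ?ltW// !sqrtr_gt0 => -> //.
rewrite mulrC; congr (expR (- _) * _); last first.
  by rewrite sqrtrM ?ltW// invfM mulrA divff ?mul1r ?lt0r_neq0 ?sqrtr_gt0.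
by rewrite -mulrA sqrt_lattice.
Qed.

Lemma pint_besselK0_lattice (R : realType) (q u v : R) :
  0 < q -> 0 < u -> 0 < v ->
  (pint (fun y => expR (- (pi * u * y + pi * v / q / y)) * y^-1))%:C =
  2 * besselK 0 (2 * pi / Num.sqrt q * Num.sqrt (u * v)).
Proof.
move=> q0 u0 v0; have p0 := pi_gt0 R.
have pu : 0 < pi * u by rewrite mulr_gt0.
have pv : 0 < pi * v / q by rewrite divr_gt0// mulr_gt0.
have := @pint_besselK0 R (Num.sqrt (pi * u)) (Num.sqrt (pi * v / q)).
by rewrite !sqr_sqrtr ?ltW// !sqrtr_gt0 sqrt_lattice// => ->.
Qed.

Lemma inv_sqrt_expR (R : realType) (y : R) : 0 < y ->
  (Num.sqrt y)^-1 = expR (- (1 / 2 * ln y)).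
Proof.
move=> y0; rewrite expRN; congr (_^-1); rewrite -{1}(lnK (x := y)) ?posrE//.
have -> : ln y = 2%:R * (1 / 2 * ln y) by field.
by rewrite expRM_natl sqrtr_sqr ger0_norm ?expR_ge0//; congr expR; field.
Qed.

Lemma sums_toZ (R : realType) n0 (x : R[i]) (u v : nat -> R[i]) (l : R[i]) :
  (forall n, v n = x * u n) -> sums_to n0 u l -> sums_to n0 v (x * l).
Proof.
move=> vE ul; rewrite /sums_to; have -> : (fun N => (\sum_(n0 <= n < N) v n : R[i]^o)) =
    (fun N => (x : R[i]^o) * \sum_(n0 <= n < N) (u n : R[i]^o)).
  by apply/funext => N; rewrite mulr_sumr; apply: eq_bigr => n _; rewrite vE.
by apply: cvgM => //; exact: cvg_cst.
Qed.

Lemma double_sums_toZ (R : realType) (x : R[i]) (u v : nat -> nat -> R[i]) (l : R[i]) :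
  (forall m n, v m n = x * u m n) -> double_sums_to u l -> double_sums_to v (x * l).
Proof.
move=> vE [G uG Gl]; exists (fun m => x * G m); last exact: (sums_toZ _ Gl).
by move=> m; apply: sums_toZ (uG m).
Qed.

Theorem corollary3 (R : realType) (k q : nat)
    (k_gt0 : (0 < k)%N) (k_mod4 : (4 %| k)%N) (q_gt0 : (0 < q)%N)
    (f : R[i] -> R[i]) (a : nat -> R[i])
    (f_cusp : cusp_form k q f)
    (f_fourier : fourier_expansion f a)
    (a1 : a 1%N = 1)
    (f_fricke : forall z, upper_half z -> fricke k q f z = f z)
    (f_pos : forall y : R, 0 < y -> 0 < f (0 +i* y))
    (L : R[i] -> R[i]) (L_cont : entire_continuation k a L)
    (c : nat -> R[i]) (c_exp : power_expansion f a (1 / 2) c) :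
  (exists2 S : R[i],
      double_sums_to
        (fun m n => c m * c n *
           (expR (- (2 * pi / Num.sqrt q%:R *
                     Num.sqrt ((2 * m%:R + 1) * (2 * n%:R + 1))))
            / Num.sqrt (2 * m%:R + 1))%:C) S
    & L ((k%:R + 1) / 2) =
      ((2 * pi) `^ ((k%:R + 1) / 2) /
       (q%:R `^ (k%:R / 4) * Gamma ((k%:R + 1) / 2)))%:C * S) /\
  (exists2 S : R[i],
      double_sums_to
        (fun m n => c m * c n *
           besselK 0 (2 * pi / Num.sqrt q%:R *
                      Num.sqrt ((2 * m%:R + 1) * (2 * n%:R + 1)))) S
    & L (k%:R / 2) =
      (2 / Gamma (k%:R / 2) *
       (2 * pi / Num.sqrt q%:R) `^ (k%:R / 2))%:C * S).
Proof.
have k_even : (2 %| k)%N by exact: dvdn_trans k_mod4.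
(* This puts k/2 and (k+1)/2 to the right of the line Re s = 1. *)
have k4 : 4 <= k%:R :> R by rewrite (ler_nat _ 4) dvdn_leq.
have qr : 0 < q%:R :> R by rewrite ltr0n.
have odd_gt0 (m : nat) : 0 < 2 * m%:R + 1 :> R by rewrite ltr_wpDl// mulr_ge0.
have d0 : 0 < pi / (2 * q%:R) :> R by rewrite divr_gt0 ?pi_gt0// mulr_gt0.
have value := weighted_central_value k_gt0 k_mod4 q_gt0 f_fourier f_fricke f_pos L_cont c_exp.
split.
(* The weight is 1/sqrt y because -k/2 + (k+1)/2 - 1 = -1/2. *)
- have [] := value _ _ ((k%:R + 1) / 2) _ (@measurable_inv_sqrt_pos R) _
    (fun y y0 => inv_sqrt_expRN_le d0 y0) _.
  + lra.
  + by move=> y y0; rewrite invr_ge0 sqrtr_ge0.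
  + move=> y y0; rewrite invr_half_expR// inv_sqrt_expR// -expRD.
    by congr expR; field.
  move=> S dS LS; exists S%:C; last first.
    transitivity (L ((k%:R + 1) / 2)%:C); last by rewrite LS rmorphM.
    by congr L; rewrite rmorphM fmorphV rmorphD !rmorph_nat.
  move: dS; congr (double_sums_to _ _); apply/funext => m; apply/funext => n.
  by rewrite pint_half_bessel_lattice.
(* Here the exponent -k/2 + k/2 - 1 is -1. *)
- have [] := value _ _ (k%:R / 2) _ (@measurable_invr_pos R) _
    (fun y y0 => inv_exprn_expRN_le 1 d0 y0) _.
  + lra.
  + by move=> y y0; rewrite invr_ge0 ltW.
  + move=> y y0; rewrite invr_half_expR// -expRD -[in RHS](lnK (x := y))// -expRN.
    by congr expR; field.
  (* Each integral is twice a value of K_0, so the sum of K_0 values is S/2; this produces the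
     leading 2 of the formula. *)
  move=> S dS LS; exists (2^-1 * S%:C).
    apply: double_sums_toZ dS => m n; rewrite pint_besselK0_lattice//.
    by rewrite [X in _ = _ * X]mulrCA mulKf// pnatr_eq0.
  transitivity (L (k%:R / 2)%:C); first by congr L; rewrite rmorphM fmorphV !rmorph_nat.
  rewrite LS mulrA; have -> : (2^-1 : R[i]) = (2^-1)%:C by rewrite fmorphV rmorph_nat.
  rewrite -!rmorphM; congr (_%:C).
  rewrite [in RHS](powRM (x := 2 * pi)) ?mulr_ge0 ?pi_ge0 ?invr_ge0 ?sqrtr_ge0//.
  (* The power of q is hidden in (2 pi / sqrt q)^(k/2), as q^(-1/2) raised to k/2 is q^(-k/4). *)
  have -> : (Num.sqrt q%:R)^-1 `^ (k%:R / 2) = (q%:R `^ (k%:R / 4))^-1 :> R.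
    by rewrite -(powR12_sqrt (ltW qr)) -[(_ `^ 2^-1)^-1]powRN -powRrM -powRN; congr (_ `^ _); field.
  have G0 : 0 < Gamma (k%:R / 2 : R) by apply: Gamma_gt0; lra.
  have Q0 : 0 < q%:R `^ (k%:R / 4) :> R by rewrite powR_gt0.
  move: (_ `^ _) (_ `^ _) (Gamma _) Q0 G0 => x y z y0 z0.
  by field; rewrite !lt0r_neq0.
Qed.
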